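(* Assume (H3.1) and (H3.2) (stated in the context), let $l<T\le 2l$, and let $X^{1,\varepsilon}$ be the solution of the first-order variational equation given in the context. Let $(\overline\Omega,\overline{\mathcal F},\overline P)$ be an intermediate probability space, independent of $(\Omega,\mathcal F,P)$, with expectation $\overline E$, and let $\overline X^{1,\varepsilon}$ be the copy of $X^{1,\varepsilon}$ on $(\overline\Omega,\overline{\mathcal F},\overline P)$. Let $(\Psi_1(\omega,\overline\omega,t))_{t\in[-l,T]}$ and $(\Psi_2(\overline\omega,t))_{t\in[-l,T]}$ be two stochastic processes defined on the product space $(\Omega\times\overline\Omega,\mathcal F\otimes\overline{\mathcal F},P\otimes\overline P)$ and on $(\overline\Omega,\overline{\mathcal F},\overline P)$, respectively, such that: (i) there exists a constant $C>0$ such that for $t\in[-l,T]$, $|\Psi_1(\omega,\overline\omega,t)|\le C$, $P\otimes\overline P$-a.s.; (ii) for every $\beta\ge1$ there is a constant $C_\beta$ with $\overline E\big[\sup_{t\in[-l,T]}|\Psi_2(\overline\omega,t)|^{2\beta}\big]\le C_\beta$. Then there is a function $\rho:(0,+\infty)\to(0,+\infty)$ with $\rho(\varepsilon)\to0$ as $\varepsilon\downarrow0$ such that $$E\Big[\int_{-l}^T\big|\overline E[\Psi_1(\omega,\overline\omega,t)\Psi_2(\overline\omega,t)\overline X^{1,\varepsilon}(t)]\big|^4dt\Big]\le\varepsilon^2\rho(\varepsilon).$$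
   Context: **Probability space.** $(\Omega,\mathcal F,P)$ is a complete probability space with a one-dimensional Brownian motion $W$; $\mathcal F^*\subset\mathcal F$ is a sub-$\sigma$-field independent of $W$ with $\mathcal P_2(\mathbb R^d)=\{P_\xi:\xi\in L^2(\mathcal F^*;\mathbb R^d)\}$; $\mathcal F_t=\sigma\{W_s,0\le s\le t\}\vee\mathcal F^*\vee\mathcal N$, $\mathcal N$ the $P$-null sets. $P_\xi=P\circ\xi^{-1}$ is the law of $\xi$. $\mathcal P_2(\mathbb R^d)$ is the space of probability measures on $\mathbb R^d$ with finite second moment, with the 2-Wasserstein metric. **Derivative in a measure.** $h:\mathcal P_2(\mathbb R^d)\to\mathbb R$ is differentiable if $\tilde h(\xi):=h(P_\xi)$ is Fréchet differentiable on $L^2(\mathcal F;\mathbb R^d)$; then $D\tilde h(\xi)(\zeta)=E[\partial_\nu h(P_\xi;\xi)\cdot\zeta]$ for a Borel function $a\mapsto\partial_\nu h(P_\xi;a)$ depending only on $P_\xi$. $C_b^{1,1}(\mathcal P_2(\mathbb R^d))$: continuously differentiable $h$ with $\partial_\nu h(\nu;a)$ bounded and Lipschitz in $(\nu,a)$. For $f(\dots,\mu,\dots)$ with $\mu\in\mathcal P_2(\mathbb R^2)$, the derivative in $\mu$ is $\mathbb R^2$-valued. **Control system.** $l>0$, $l<T\le2l$; $U\subset\mathbb R$, not necessarily convex; $x(\cdot)$ is a continuous function on $[-l,0]$. $\mathcal U_{ad}$ is the set of $\mathcal F_t$-adapted $U$-valued processes $v$ on $[0,T]$ with $E[\sup_{t\in[0,T]}|v(t)|^\beta]<\infty$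 for all $\beta\ge1$. The coefficients are $b,\sigma:[0,T]\times\mathbb R\times\mathbb R\times\mathcal P_2(\mathbb R)\times U\to\mathbb R$ with arguments $(t,x,x',\nu,v)$, $f:[0,T]\times\mathbb R^4\times\mathcal P_2(\mathbb R^2)\times U\to\mathbb R$ with arguments $(t,x,x',y,z,\mu,v)$, and $\Phi:\mathbb R\times\mathcal P_2(\mathbb R)\to\mathbb R$ with arguments $(x,\nu)$. For $v\in\mathcal U_{ad}$, $$dX^v(t)=b(t,X^v(t),X^v(t-l),P_{X^v(t)},v(t))dt+\sigma(t,X^v(t),X^v(t-l),P_{X^v(t)},v(t))dW_t,\ t\in[0,T],$$ $X^v(\theta)=x(\theta)$ for $\theta\in[-l,0]$, and $$-dY^v(t)=f(t,X^v(t),X^v(t-l),Y^v(t),Z^v(t),P_{(X^v(t),Y^v(t))},v(t))dt-Z^v(t)dW_t,\quad Y^v(T)=\Phi(X^v(T),P_{X^v(T)}).$$ The cost is $J(v)=Y^v(0)$; $u^*\in\mathcal U_{ad}$ is an optimal control, $J(u^* )=\min_{v\in\mathcal U_{ad}}J(v)$, with trajectory $(X^*,Y^*,Z^* )$. **(H3.1)** $b,\sigma,\Phi$ are bounded by $C(1+|x|+|x'|+(\int x^2\nu(dx))^{1/2}+|v|)$, and $f$ is bounded by $C(1+|x|+|x'|+|y|+|z|+(\int|a|^2\mu(da))^{1/2}+|v|)$ (with only the arguments each function has); $b,\sigma,f$ and all the derivatives of $b,\sigma,f$ up to order 2 are Lipschitz continuous in $v$. **(H3.2)** For each $(t,v)$: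 (i) as functions of the measure with the other arguments fixed, $b,\sigma,\Phi$ belong to $C_b^{1,1}(\mathcal P_2(\mathbb R))$ and $f$ to $C_b^{1,1}(\mathcal P_2(\mathbb R^2))$; (ii) with the measure fixed, $b,\sigma\in C_b^1(\mathbb R^2)$ in $(x,x')$, $\Phi\in C^1_b(\mathbb R)$ in $x$, $f\in C_b^1(\mathbb R^4)$ in $(x,x',y,z)$; (iii) the derivatives of $b,\sigma,\Phi,f$ of order 1 are Lipschitz continuous and bounded. **Spike variation.** For $\varepsilon>0$, $E_\varepsilon\subset[0,T]$ is a Borel set of Lebesgue measure $\varepsilon$ and $v\in\mathcal U_{ad}$ is fixed; $v^\varepsilon=v\mathbf 1_{E_\varepsilon}+u^*\mathbf 1_{(E_\varepsilon)^c}$. **Copies.** $(\widehat\Omega,\widehat{\mathcal F},\widehat P)$ is an independent copy of $(\Omega,\mathcal F,P)$; hatted variables are the corresponding copies and $\widehat E$ acts only on hatted variables. Variables with a bar are defined similarly on $(\overline\Omega,\overline{\mathcal F},\overline P)$. **Notation.** For $\psi=b,\sigma$: $\psi_x(t),\psi_{x'}(t)$ are the partial derivatives of $\psi$ at $(t,X^*(t),X^*(t-l),P_{X^*(t)},u^*(t))$; $\widehat\psi_\nu(t)=\partial_\nu\psi(t,X^*(t),X^*(t-l),P_{X^*(t)},u^*(t);\widehat X^*(t))$; $\Delta\psi(t)=\psi(t,X^*(t),X^*(t-l),P_{X^*(t)},v(t))-\psi(t,X^*(t),X^*(t-l),P_{X^*(t)},u^*(t))$. **First-order variational equation.** $X^{1,\varepsilon}(t)=0$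 for $t\in[-l,0]$ and, for $t\in[0,T]$, $$dX^{1,\varepsilon}(t)=\{b_x(t)X^{1,\varepsilon}(t)+b_{x'}(t)X^{1,\varepsilon}(t-l)+\widehat E[\widehat b_\nu(t)\widehat X^{1,\varepsilon}(t)]+\Delta b(t)\mathbf 1_{E_\varepsilon}(t)\}dt$$ $$\quad+\{\sigma_x(t)X^{1,\varepsilon}(t)+\sigma_{x'}(t)X^{1,\varepsilon}(t-l)+\widehat E[\widehat\sigma_\nu(t)\widehat X^{1,\varepsilon}(t)]+\Delta\sigma(t)\mathbf 1_{E_\varepsilon}(t)\}dW_t.$$ *)

(* Defs.v *)
From HB Require Import structures.
From mathcomp Require Import all_boot all_order all_algebra.
From mathcomp Require Import all_classical all_reals all_analysis.

Set Implicit Arguments.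
Unset Strict Implicit.
Unset Printing Implicit Defensive.

Import Order.TTheory GRing.Theory Num.Theory.
Import numFieldNormedType.Exports.

Local Open Scope classical_set_scope.
Local Open Scope ring_scope.

(* The Euclidean spaces R and R * R that carry the laws.  Their library norm is
   the sup norm; it is used in boundedness and Lipschitz conditions only, where
   it is interchangeable with the Euclidean norm.  Second moments, the
   Wasserstein metric and the derivative in a measure use [dot]. *)
HB.mixin Record hasDot (R : realType) d V
    of NormedModule R V & Measurable d V := { dot : V -> V -> R }.

#[short(type="euclidType")]
HB.structure Definition Euclid (R : realType) d :=
  { V of NormedModule R V & Measurable d V & hasDot R d V }.

Section dot_instances.
Context (R : realType).
HB.instance Definition _ :=
  hasDot.Build R _ (Real.sort R) (fun x y : R => x * y).
HB.instance Definition _ := hasDot.Build R _ (R * R)%type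
  (fun x y : R * R => x.1 * y.1 + x.2 * y.2).
End dot_instances.

Section square_integrable_laws.
Context (R : realType) (dV : measure_display) (V : euclidType R dV).

Definition sqn (a : V) : R := dot a a.

(* A function of a measure is represented on all probability measures; every
   condition below only constrains it on P_2. *)
Definition P2 (nu : probability V R) : Prop :=
  (\int[nu]_a (sqn a)%:E < +oo)%E.

Definition l2norm (nu : probability V R) : R :=
  Num.sqrt (\int[nu]_a sqn a).

Definition coupling (mu nu : probability V R) (pi : probability (V * V)%type R) :=
  forall A, measurable A ->
    pi (A `*` [set: V]) = mu A /\ pi ([set: V] `*` A) = nu A.

Definition W2 (mu nu : probability V R) : R :=
  Num.sqrt (fine (ereal_inf
    [set \int[pi]_z (sqn (z.1 - z.2))%:E | pi in coupling mu nu])%E).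

End square_integrable_laws.

Section random_variables.
Context (R : realType) (d : measure_display) (Om : measurableType d)
  (P : probability Om R).

(* The random vector (X, Y). *)
Definition pairRV (X Y : {RV P >-> R}) : Om -> R * R := fun w => (X w, Y w).

Lemma measurable_pairRV (X Y : {RV P >-> R}) : measurable_fun setT (pairRV X Y).
Proof. by apply: measurable_fun_pair. Qed.

HB.instance Definition _ (X Y : {RV P >-> R}) :=
  isMeasurableFun.Build _ _ _ _ (pairRV X Y) (measurable_pairRV X Y).

Definition law2 (X Y : {RV P >-> R}) : probability (R * R)%type R :=
  distribution P (pairRV X Y).

Section measure_derivative.
Context (dV : measure_display) (V : euclidType R dV).

Definition L2 (xi : {RV P >-> V}) : Prop :=
  (\int[P]_w (sqn (xi w))%:E < +oo)%E.

Definition L2dist (xi eta : {RV P >-> V}) : R :=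
  Num.sqrt (\int[P]_w sqn (eta w - xi w)).

(* The lift [fun xi => h (distribution P xi)] is Frechet differentiable on
   L2(Om; V), with differential [zeta |-> E[dh(P_xi; xi) . zeta]]; the
   increment zeta is written eta - xi. *)
Definition is_measure_derivative (h : probability V R -> R)
    (dh : probability V R -> V -> V) : Prop :=
  forall xi : {RV P >-> V}, L2 xi ->
  let D := dh (distribution P xi) in
  [/\ measurable_fun setT D,
      (\int[P]_w (sqn (D (xi w)))%:E < +oo)%E &
      forall e : R, 0 < e -> exists2 r : R, 0 < r &
        forall eta : {RV P >-> V}, L2 eta -> L2dist xi eta <= r ->
        `| h (distribution P eta) - h (distribution P xi)
           - \int[P]_w dot (D (xi w)) (eta w - xi w) | <= e * L2dist xi eta].

(* Continuity of the differential follows from the Lipschitz condition. *)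
Definition C11b (h : probability V R -> R) (dh : probability V R -> V -> V) :=
  is_measure_derivative h dh /\
  exists C : R,
    (forall nu, P2 nu -> forall a, `|dh nu a| <= C) /\
    (forall nu nu', P2 nu -> P2 nu' -> forall a a',
      `|dh nu a - dh nu' a'| <= C * (W2 nu nu' + `|a - a'|)).

Context (E : normedModType R).

(* Only the derivative is bounded: the coefficients have linear growth. *)
Definition C1b (g : E -> R) : Prop :=
  [/\ forall e, differentiable g e,
      forall h, continuous (fun e => 'D_h g e) &
      exists C : R, forall e h, `|'D_h g e| <= C * `|h|].

(* [g] is a coefficient with (t, v) fixed and [dg] its derivative in the measure;
   the constant is uniform in (t, v) below. *)
Definition regular_at (C : R) (g : E -> probability V R -> R)
    (dg : E -> probability V R -> V -> V) : Prop :=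
  [/\ forall e, C11b (g e) (dg e),
      forall nu, P2 nu -> C1b (g ^~ nu),
      forall e nu, P2 nu ->
        (forall h, `|'D_h (g ^~ nu) e| <= C * `|h|) /\
        (forall a, `|dg e nu a| <= C) &
      forall e e' nu nu', P2 nu -> P2 nu' ->
        (forall h, `|'D_h (g ^~ nu) e - 'D_h (g ^~ nu') e'|
                   <= C * `|h| * (`|e - e'| + W2 nu nu')) /\
        (forall a a', `|dg e nu a - dg e' nu' a'|
                   <= C * (`|e - e'| + W2 nu nu' + `|a - a'|))].

Section lipschitz_in_control.
Context (U : set R) (C : R).

Definition lip_on (W : normedModType R) (F : R -> W) : Prop :=
  forall v v', U v -> U v' -> `|F v - F v'| <= C * `|v - v'|.

(* Second derivatives are only required to be Lipschitz in v when they exist. *)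
Definition lip_D (X W : normedModType R) (F : R -> X -> W) : Prop :=
  forall x h, `|h| <= 1 -> (forall v, U v -> derivable (F v) x h) ->
    lip_on (fun v => 'D_h (F v) x).

Definition lip_measure_D (h : R -> probability V R -> R) : Prop :=
  (forall v, U v -> exists D, is_measure_derivative (h v) D) ->
  exists D : R -> probability V R -> V -> V,
    (forall v, U v -> is_measure_derivative (h v) (D v)) /\
    (forall nu a, P2 nu -> lip_on (fun v => D v nu a)).

(* [g] and its derivatives of order 1 and 2 (D_e, D_nu, D_e D_e, D_nu D_e,
   D_e D_nu, D_a D_nu, D_nu D_nu) are Lipschitz in v, for a fixed t. *)
Definition lip_order2 (g : R -> E -> probability V R -> R)
    (dg : R -> E -> probability V R -> V -> V) : Prop :=
  [/\ forall e nu, P2 nu -> lip_on (fun v => g v e nu),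
      forall e h nu, P2 nu -> `|h| <= 1 ->
        lip_on (fun v => 'D_h (g v ^~ nu) e),
      forall e nu a, P2 nu -> lip_on (fun v => dg v e nu a),
      (forall h nu, P2 nu -> `|h| <= 1 ->
        lip_D (fun v e => 'D_h (g v ^~ nu) e)) /\
      (forall e h, `|h| <= 1 ->
        lip_measure_D (fun v nu => 'D_h (g v ^~ nu) e)) &
      [/\ forall nu a, P2 nu -> lip_D (fun v e => dg v e nu a),
          forall e nu, P2 nu -> lip_D (fun v a => dg v e nu a) &
          forall e a c, `|c| <= 1 ->
            lip_measure_D (fun v nu => dot c (dg v e nu a))]].

End lipschitz_in_control.

End measure_derivative.

End random_variables.

(* The spatial arguments are grouped: (x, x') for b and sigma, (x, x', y, z)
   for f.  [db], [dsigma], [df], [dPhi] are the derivatives in the measure. *)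
Record coefficients (R : realType) := Coefficients {
  b : R -> R * R -> probability R R -> R -> R;
  sigma : R -> R * R -> probability R R -> R -> R;
  f : R -> R * R * R * R -> probability (R * R)%type R -> R -> R;
  Phi : R -> probability R R -> R;
  db : R -> R * R -> probability R R -> R -> R -> R;
  dsigma : R -> R * R -> probability R R -> R -> R -> R;
  df : R -> R * R * R * R -> probability (R * R)%type R -> R -> R * R -> R * R;
  dPhi : R -> probability R R -> R -> R
}.

Section assumptions.
Context (R : realType) (d : measure_display) (Om : measurableType d)
  (P : probability Om R).
Variables (T : R) (U : set R) (c : coefficients R).

Definition coef_measurable : Prop :=
  forall v, U v ->
  [/\ forall e nu, P2 nu -> measurable_fun `[0, T] (fun t => b c t e nu v),
      forall e nu, P2 nu -> measurable_fun `[0, T] (fun t => sigma c t e nu v) &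
      forall e mu, P2 mu -> measurable_fun `[0, T] (fun t => f c t e mu v)].

Definition growth_lipschitz : Prop := exists C : R,
  [/\ forall t x x' nu v, t \in `[0, T] -> P2 nu -> U v ->
        `|b c t (x, x') nu v| <= C * (1 + `|x| + `|x'| + l2norm nu + `|v|) /\
        `|sigma c t (x, x') nu v| <= C * (1 + `|x| + `|x'| + l2norm nu + `|v|),
      forall x nu, P2 nu -> `|Phi c x nu| <= C * (1 + `|x| + l2norm nu),
      forall t x x' y z mu v, t \in `[0, T] -> P2 mu -> U v ->
        `|f c t (x, x', y, z) mu v|
          <= C * (1 + `|x| + `|x'| + `|y| + `|z| + l2norm mu + `|v|) &
      forall t, t \in `[0, T] ->
      [/\ lip_order2 P U C (fun v e nu => b c t e nu v)
                           (fun v e nu a => db c t e nu v a),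
          lip_order2 P U C (fun v e nu => sigma c t e nu v)
                           (fun v e nu a => dsigma c t e nu v a) &
          lip_order2 P U C (fun v e mu => f c t e mu v)
                           (fun v e mu a => df c t e mu v a)]].

Definition regular : Prop := exists C : R,
  regular_at P C (Phi c) (dPhi c) /\
  forall t v, t \in `[0, T] -> U v ->
  [/\ regular_at P C (fun e nu => b c t e nu v) (fun e nu a => db c t e nu v a),
      regular_at P C (fun e nu => sigma c t e nu v)
                 (fun e nu a => dsigma c t e nu v a) &
      regular_at P C (fun e mu => f c t e mu v) (fun e mu a => df c t e mu v a)].

End assumptions.

Section stochastic_basis.
Context (R : realType) (d : measure_display) (Om : measurableType d)
  (P : probability Om R).
Implicit Types (Fs G H : set (set Om)) (W : R -> {RV P >-> R}).

Definition independent G H : Prop :=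
  forall A B, G A -> H B -> P (A `&` B) = (P A * P B)%E.

(* Generators of sigma{W_s : s in D}. *)
Definition history (D : set R) W : set (set Om) :=
  [set A | exists s B, [/\ D s, measurable B & A = W s @^-1` B]].

Definition brownian W : Prop :=
  [/\ {ae P, forall w, W 0 w = 0},
      forall s t, 0 <= s -> s < t ->
        (forall B, measurable B ->
          P [set w | B (W t w - W s w)] = normal_prob 0 (Num.sqrt (t - s)) B) /\
        independent [set A | exists2 B : set R, measurable B
                               & A = [set w | B (W t w - W s w)]]
                    <<s history `[0, s] W >> &
      forall w, {within `[0, +oo[, continuous (fun t => W t w)}].

Definition realizes_P2 Fs dV (V : euclidType R dV) : Prop :=
  forall nu : probability V R, P2 nu ->
  exists xi : {RV P >-> V},
    (forall B, measurable B -> Fs (xi @^-1` B)) /\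
    (forall B, measurable B -> distribution P xi B = nu B).

(* The reverse inclusion in P_2(V) = {P_xi : xi in L2(Fs; V)} always holds. *)
Definition stochastic_basis Fs W : Prop :=
  [/\ measure_is_complete P,
      brownian W,
      sigma_algebra setT Fs /\ Fs `<=` measurable,
      independent Fs <<s history `[0, +oo[ W >> &
      realizes_P2 Fs R /\ realizes_P2 Fs (R * R)%type].

Definition filtration Fs W (t : R) : set (set Om) :=
  <<s history `[0, t] W `|` Fs `|` P.-negligible >>.

End stochastic_basis.

(* A probability space carrying copies of all random variables of (Om, P): the
   copy of xi is [xi \o copy].  An isomorphic copy of (Om, P) is the special case
   where [copy] is an isomorphism.  The copy is independent of (Om, P) because
   only the product P \x Pb is used. *)
Definition is_copy (R : realType) d (Om : measurableType d)
    (P : probability Om R) d' (Omb : measurableType d')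
    (Pb : probability Omb R) (copy : {mfun Omb >-> Om}) : Prop :=
  forall A, measurable A -> Pb (copy @^-1` A) = P A.

Section stochastic_calculus.
Context (R : realType) (d : measure_display) (Om : measurableType d)
  (P : probability Om R).
Variables (F : R -> set (set Om)) (W : R -> {RV P >-> R}) (T : R).

Definition adapted (X : R -> Om -> R) : Prop :=
  forall t B, t \in `[0, T] -> measurable B -> F t (X t @^-1` B).

Definition jointly_measurable (X : R -> Om -> R) : Prop :=
  measurable_fun (`[0, T] `*` [set: Om]) (fun p : R * Om => X p.1 p.2).

(* The simple process \sum_(i < n) xi_i 1_]t_i, t_(i+1)]. *)
Record simple_process := SimpleProcess {
  sp_size : nat;
  sp_time : nat -> R;
  sp_value : nat -> {RV P >-> R}
}.

Definition simple_wf (S : simple_process) : Prop :=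
  [/\ 0 <= sp_time S 0 /\ sp_time S (sp_size S) <= T,
      forall i, (i < sp_size S)%N -> sp_time S i <= sp_time S i.+1,
      forall i, (i < sp_size S)%N -> exists K : R,
        forall w, `|sp_value S i w| <= K &
      forall i B, (i < sp_size S)%N -> measurable B ->
        F (sp_time S i) (sp_value S i @^-1` B)].

Definition simple_eval (S : simple_process) (t : R) (w : Om) : R :=
  \sum_(i < sp_size S)
    sp_value S i w * \1_(`]sp_time S i, sp_time S i.+1]) t.

Definition simple_integral (S : simple_process) (t : R) (w : Om) : R :=
  \sum_(i < sp_size S) sp_value S i w *
    (W (Num.min (sp_time S i.+1) t) w - W (Num.min (sp_time S i) t) w).

(* M t = \int_0^t H dW for t in [0, T], as the L2 limit of the integrals of
   simple processes converging to H in L2(dt x dP). *)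
Definition is_ito_integral (H : R -> Om -> R) (M : R -> {RV P >-> R}) : Prop :=
  [/\ adapted H,
      jointly_measurable H,
      (\int[P]_w \int[lebesgue_measure]_(t in `[0%R, T])
         ((H t w) ^+ 2)%:E < +oo)%E &
      exists S : nat -> simple_process,
      [/\ forall n, simple_wf (S n),
          (fun n => \int[P]_w \int[lebesgue_measure]_(t in `[0%R, T])
             ((simple_eval (S n) t w - H t w) ^+ 2)%:E)%E @ \oo --> 0%E &
          forall t, t \in `[0, T] ->
          (fun n => \int[P]_w
             ((simple_integral (S n) t w - M t w) ^+ 2)%:E)%E @ \oo --> 0%E]].

(* dX = B dt + S dW on [0, T]. *)
Definition ito_process (B S : R -> Om -> R) (X : R -> {RV P >-> R}) : Prop :=
  [/\ adapted B,
      jointly_measurable B,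
      (\int[P]_w \int[lebesgue_measure]_(t in `[0%R, T]) `|B t w|%:E < +oo)%E &
      exists2 M : R -> {RV P >-> R}, is_ito_integral S M &
      forall t, t \in `[0, T] -> {ae P, forall w,
        X t w = X 0 w + \int[lebesgue_measure]_(s in `[0, t]) B s w + M t w}].

(* Continuous on [t0, T], adapted on [0, T], with E[sup |X|^2] finite. *)
Definition S2_process (t0 : R) (X : R -> {RV P >-> R}) : Prop :=
  [/\ adapted (fun t => X t : Om -> R),
      forall w, {within `[t0, T], continuous (fun t => X t w)} &
      (\int[P]_w ereal_sup [set ((X t w) ^+ 2)%:E | t in `[t0, T]] < +oo)%E].

Definition M2_process (Z : R -> {RV P >-> R}) : Prop :=
  [/\ adapted (fun t => Z t : Om -> R),
      jointly_measurable (fun t => Z t : Om -> R) &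
      (\int[P]_w \int[lebesgue_measure]_(t in `[0%R, T])
         ((Z t w) ^+ 2)%:E < +oo)%E].

Definition admissible (U : set R) (v : R -> {RV P >-> R}) : Prop :=
  [/\ forall t w, t \in `[0, T] -> U (v t w),
      adapted (fun t => v t : Om -> R),
      jointly_measurable (fun t => v t : Om -> R) &
      forall beta : R, 1 <= beta ->
      (\int[P]_w ereal_sup [set (`|v t w| `^ beta)%:E | t in `[0%R, T]]
         < +oo)%E].

Section control_system.
Variables (l : R) (x0 : R -> R) (c : coefficients R).
Implicit Types X Y Z v u : R -> {RV P >-> R}.

Local Notation law := (distribution P).

Definition state_equation v X : Prop :=
  [/\ forall t w, t \in `[- l, 0] -> X t w = x0 t,
      S2_process (- l) X &
      ito_process
        (fun t w => b c t (X t w, X (t - l) w) (law (X t)) (v t w))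
        (fun t w => sigma c t (X t w, X (t - l) w) (law (X t)) (v t w)) X].

Definition backward_equation v X Y Z : Prop :=
  [/\ S2_process 0 Y,
      M2_process Z,
      {ae P, forall w, Y T w = Phi c (X T w) (law (X T))} &
      ito_process
        (fun t w => - f c t (X t w, X (t - l) w, Y t w, Z t w)
                        (law2 (X t) (Y t)) (v t w))
        (fun t w => Z t w) Y].

Definition FBSDE v X Y Z : Prop :=
  state_equation v X /\ backward_equation v X Y Z.

(* J(v) = Y^v(0) is measurable with respect to F_0, which contains the initial
   sigma-field; costs are compared almost surely. *)
Definition optimal (U : set R) u X Y Z : Prop :=
  [/\ admissible U u,
      FBSDE u X Y Z &
      forall v X' Y' Z', admissible U v -> FBSDE v X' Y' Z' ->
        {ae P, forall w, Y 0 w <= Y' 0 w}].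

Section variational_equation.
Variables (X u v : R -> {RV P >-> R}).

Local Notation coef := (R -> R * R -> probability R R -> R -> R).

Definition d_x (psi : coef) (t : R) (w : Om) : R :=
  'D_((1, 0) : R * R) (fun e => psi t e (law (X t)) (u t w))
    (X t w, X (t - l) w).

Definition d_x' (psi : coef) (t : R) (w : Om) : R :=
  'D_((0, 1) : R * R) (fun e => psi t e (law (X t)) (u t w))
    (X t w, X (t - l) w).

(* The hatted expectation of dpsi(t, ...; X^(t)) X1^(t); the hatted variables
   are copies on a second factor (Om, P), integrated out under P. *)
Definition mean_nu (dpsi : R -> R * R -> probability R R -> R -> R -> R)
    (X1 : R -> {RV P >-> R}) (t : R) (w : Om) : R :=
  \int[P]_w' (dpsi t (X t w, X (t - l) w) (law (X t)) (u t w) (X t w')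
              * X1 t w').

Definition Delta (psi : coef) (t : R) (w : Om) : R :=
  psi t (X t w, X (t - l) w) (law (X t)) (v t w)
  - psi t (X t w, X (t - l) w) (law (X t)) (u t w).

Definition first_variation (E : set R) (X1 : R -> {RV P >-> R}) : Prop :=
  [/\ forall t w, t \in `[- l, 0] -> X1 t w = 0,
      S2_process (- l) X1 &
      ito_process
        (fun t w => d_x (b c) t w * X1 t w + d_x' (b c) t w * X1 (t - l) w
           + mean_nu (db c) X1 t w + Delta (b c) t w * \1_E t)
        (fun t w => d_x (sigma c) t w * X1 t w
           + d_x' (sigma c) t w * X1 (t - l) w
           + mean_nu (dsigma c) X1 t w + Delta (sigma c) t w * \1_E t) X1].

End variational_equation.

End control_system.

End stochastic_calculus.

(* Main.v *)
(** Write [phi = X1 eps / sqrt eps].  A Gronwall estimate bounds [phi t] in L2(P),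
    so the left-hand side is O(eps^2), and it is o(eps^2) as soon as [phi t] tends
    weakly to 0 in L2(P).  To see this, test the equation of [phi] against [eta]:
    the drift is transposed onto [eta] by Fubini, and the stochastic integral
    becomes a time integral of [E[theta s * S s]] with [theta] given by an
    approximate martingale representation of [eta].  The spike terms have size
    [eps / sqrt eps], and what remains is a linear Volterra inequality: with the
    weight [exp (- g t)], [g] large, it halves any asymptotic bound on
    [|E[eta * phi t]|], hence the limit is 0.  For fixed [w] and [t] the mean over
    the copy is [phi t] tested against an element of L2(Pb), whose projection on
    the copies of L2(P) brings it back to the space of [P]; dominated convergence
    in [w], then in [t], concludes. *)

Require Import Defs.
From HB Require Import structures.
From mathcomp Require Import all_boot all_order all_algebra.
From mathcomp Require Import all_classical all_reals all_analysis measurable_realfun.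
From mathcomp Require Import lra ring.

Set Implicit Arguments.
Unset Strict Implicit.
Unset Printing Implicit Defensive.

Import Order.TTheory GRing.Theory Num.Theory.
Import numFieldNormedType.Exports.

Local Open Scope classical_set_scope.
Local Open Scope ring_scope.

(** * Square-integrable functions *)

(** The limit is only weak: the spike in the diffusion in general leaves [X1 eps / sqrt eps] of
    order one in L2(P), so norm estimates alone cannot produce [rho]. Against a fixed test function
    the spike counts through the measure of the set, and not through the square root of that
    measure. The obstacle is that the coefficients are random. Transposing them produces a new test
    function at each time, so no closed equation exists for a single [eta], and the index from which
    smallness holds is not uniform in the test function. The inductive bound is therefore required
    of all test functions, with an index depending on each, and dominated convergence in time
    replaces uniformity; the a priori moment bound supplies the domination. Two projections are
    taken up to an error only, on the integrals of simple processes and on the copies. This is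
    enough because each error is multiplied by a norm of order [sqrt eps], hence is absorbed in the
    weak limit. *)

Section L2.
Context (R : realType) (d : measure_display) (T : measurableType d)
  (mu : {measure set T -> \bar R}).
Implicit Types f g h : T -> R.

Definition sqi f : Prop :=
  measurable_fun setT f /\ (\int[mu]_x ((f x) ^+ 2)%:E < +oo)%E.

Definition ip f g : R := \int[mu]_x (f x * g x).

Definition nrm f : R := Num.sqrt (ip f f).

(** Two dominating squares serve both uses: [2 * f] and [2 * g] for a sum, one multiple together
    with [cst 0] for a bounded factor. *)
Lemma sqi_le f g h : measurable_fun setT f -> sqi g -> sqi h ->
  (forall x, (f x) ^+ 2 <= (g x) ^+ 2 + (h x) ^+ 2) -> sqi f.
Proof.
move=> mf [mg ig] [mh ih] le; split => //.
have mX (k : T -> R) : measurable_fun setT k ->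
    measurable_fun setT (fun x => ((k x) ^+ 2)%:E : \bar R).
  by move=> mk; apply/measurable_EFinP; exact: measurable_funX.
apply: (@le_lt_trans _ _ (\int[mu]_x (((g x) ^+ 2)%:E + ((h x) ^+ 2)%:E))%E).
  apply: ge0_le_integral => //=.
  - by move=> x _; rewrite lee_fin sqr_ge0.
  - exact: mX.
  - by apply: emeasurable_funD; exact: mX.
  - by move=> x _; rewrite -EFinD lee_fin.
rewrite ge0_integralD//.
- by rewrite lte_add_pinfty.
- by move=> x _; rewrite lee_fin sqr_ge0.
- exact: mX.
- by move=> x _; rewrite lee_fin sqr_ge0.
- exact: mX.
Qed.

Lemma sqi0 : sqi (cst 0).
Proof.
split => //; rewrite [X in (X < _)%E](_ : _ = 0%E)// integral0_eq// => x _.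
by rewrite expr0n.
Qed.

Lemma sqiZ a f : sqi f -> sqi (fun x => a * f x).
Proof.
move=> [mf iF]; split; first exact: measurable_funM.
under eq_integral do rewrite exprMn EFinM.
rewrite ge0_integralZl//.
- by rewrite lte_mul_pinfty// ?lee_fin ?sqr_ge0.
- by apply/measurable_EFinP; exact: measurable_funX.
- by move=> x _; rewrite lee_fin sqr_ge0.
- by rewrite lee_fin sqr_ge0.
Qed.

Lemma sqiD f g : sqi f -> sqi g -> sqi (fun x => f x + g x).
Proof.
move=> sf sg.
apply: (@sqi_le _ (fun x => 2 * f x) (fun x => 2 * g x)); [|exact: sqiZ..|].
  by apply: measurable_funD; [case: sf|case: sg].
by move=> x; have := sqr_ge0 (f x - g x); have := sqr_ge0 (f x);
  have := sqr_ge0 (g x); nra.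
Qed.

Lemma sqiB f g : sqi f -> sqi g -> sqi (fun x => f x - g x).
Proof.
move=> sf sg; have := sqiD sf (sqiZ (-1) sg).
by under eq_fun do rewrite mulN1r.
Qed.

Lemma sqi_bounded C f g : measurable_fun setT f -> (forall x, `|f x| <= C) ->
  sqi g -> sqi (fun x => f x * g x).
Proof.
move=> mf fC sg; have [mg _] := sg.
apply: (@sqi_le _ (fun x => C * g x) (cst 0)); [|exact: sqiZ|exact: sqi0|].
  exact: measurable_funM.
move=> x /=; rewrite expr0n addr0 !exprMn ler_wpM2r ?sqr_ge0//.
rewrite -[leLHS]real_normK ?num_real// ler_sqr ?nnegrE//.
exact: le_trans (fC x).
Qed.

Lemma sqi_integrableM f g : sqi f -> sqi g ->
  mu.-integrable setT (fun x => (f x * g x)%:E).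
Proof.
move=> sf sg; have [mf iF] := sf; have [mg iG] := sg.
have mX (k : T -> R) : measurable_fun setT k ->
    measurable_fun setT (fun x => ((k x) ^+ 2)%:E : \bar R).
  by move=> mk; apply/measurable_EFinP; exact: measurable_funX.
apply/integrableP; split.
  by apply/measurable_EFinP; exact: measurable_funM.
apply: (@le_lt_trans _ _ (\int[mu]_x (((f x) ^+ 2)%:E + ((g x) ^+ 2)%:E))%E).
  apply: ge0_le_integral => //=.
  - apply/measurable_EFinP; apply: measurableT_comp => //.
    exact: measurable_funM.
  - by apply: emeasurable_funD; exact: mX.
  - move=> x _; rewrite -EFinD lee_fin ler_norml; apply/andP; split.
      have := sqr_ge0 (f x + g x); have := sqr_ge0 (f x).
      by have := sqr_ge0 (g x); nra.
    have := sqr_ge0 (f x - g x); have := sqr_ge0 (f x).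
    by have := sqr_ge0 (g x); nra.
rewrite ge0_integralD//; [|by move=> x _; rewrite lee_fin sqr_ge0|exact: mX|
  by move=> x _; rewrite lee_fin sqr_ge0|exact: mX].
by rewrite lte_add_pinfty.
Qed.

Lemma ipC f g : ip f g = ip g f.
Proof. by rewrite /ip; under eq_Rintegral do rewrite mulrC. Qed.

Lemma ipDl f g h : sqi f -> sqi g -> sqi h ->
  ip (fun x => f x + g x) h = ip f h + ip g h.
Proof.
move=> sf sg sh; rewrite /ip; under eq_Rintegral do rewrite mulrDl.
by rewrite RintegralD//; exact: sqi_integrableM.
Qed.

Lemma ipZl a f h : sqi f -> sqi h -> ip (fun x => a * f x) h = a * ip f h.
Proof.
move=> sf sh; rewrite /ip; under eq_Rintegral do rewrite -mulrA.
by rewrite RintegralZl//; exact: sqi_integrableM.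
Qed.

Lemma ipBl f g h : sqi f -> sqi g -> sqi h ->
  ip (fun x => f x - g x) h = ip f h - ip g h.
Proof.
move=> sf sg sh; rewrite /ip; under eq_Rintegral do rewrite mulrBl.
by rewrite RintegralB//; exact: sqi_integrableM.
Qed.

Lemma ipDr f g h : sqi f -> sqi g -> sqi h ->
  ip h (fun x => f x + g x) = ip h f + ip h g.
Proof. by move=> *; rewrite ipC ipDl// ipC; congr (_ + _); rewrite ipC. Qed.

Lemma ipZr a f h : sqi f -> sqi h -> ip h (fun x => a * f x) = a * ip h f.
Proof. by move=> *; rewrite ipC ipZl// ipC. Qed.

Lemma ipBr f g h : sqi f -> sqi g -> sqi h ->
  ip h (fun x => f x - g x) = ip h f - ip h g.
Proof. by move=> *; rewrite ipC ipBl// ipC; congr (_ - _); rewrite ipC. Qed.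

Lemma ip_sqrBZ a f g : sqi f -> sqi g ->
  ip (fun x => f x - a * g x) (fun x => f x - a * g x) =
  ip f f - 2 * a * ip f g + a ^+ 2 * ip g g.
Proof.
move=> sf sg; have sa := sqiZ a sg.
rewrite ipBl ?ipBr ?ipZl ?ipZr ?(ipC g f)//; last exact: sqiB.
by ring.
Qed.

Lemma ip_ge0 f : 0 <= ip f f.
Proof. by apply: Rintegral_ge0 => x _; rewrite -expr2 sqr_ge0. Qed.

Lemma ipE f : sqi f -> (\int[mu]_x ((f x) ^+ 2)%:E = (ip f f)%:E)%E.
Proof.
move=> sf; rewrite /ip /Rintegral fineK; first by [].
exact/integrable_fin_num/sqi_integrableM.
Qed.

Lemma nrm_ge0 f : 0 <= nrm f. Proof. exact: sqrtr_ge0. Qed.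

Lemma nrm_sqr f : nrm f ^+ 2 = ip f f.
Proof. by rewrite sqr_sqrtr// ip_ge0. Qed.

Lemma cauchy_schwarz_sqr f g : sqi f -> sqi g -> ip f g ^+ 2 <= ip f f * ip g g.
Proof.
move=> sf sg.
have key a b : 0 <= a ^+ 2 * ip f f - 2 * a * b * ip f g + b ^+ 2 * ip g g.
  have := ip_ge0 (fun x => a * f x - b * g x).
  have sa := sqiZ a sf; have sb := sqiZ b sg.
  rewrite ipBl ?ipBr ?ipZl ?ipZr// ?(ipC g f); last exact: sqiB.
  by move=> H; apply: le_trans H _; rewrite le_eqVlt; apply/orP; left; apply/eqP; ring.
have := ip_ge0 g; rewrite le_eqVlt => /predU1P[g0|g0].
  rewrite -g0 mulr0; have [->|n0] := eqVneq (ip f g) 0; first by rewrite expr0n.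
  have H b := key 1 b.
  (* When [ip g g = 0] the quadratic form with [a = 1] is affine in [b]; this [b] gives it the value
     -1. *)
  have := H ((ip f f + 1) / (2 * ip f g)).
  rewrite -g0 mulr0 addr0 mulr1 expr1n mul1r.
  rewrite (_ : 2 * _ * _ = ip f f + 1); first by lra.
  by field.
have := key (ip g g) (ip f g).
rewrite (_ : _ - _ + _ = ip g g * (ip f f * ip g g - ip f g ^+ 2)); last by ring.
by rewrite pmulr_rge0// subr_ge0.
Qed.

Lemma cauchy_schwarz f g : sqi f -> sqi g -> `|ip f g| <= nrm f * nrm g.
Proof.
move=> sf sg; rewrite -sqrtr_sqr /nrm -sqrtrM ?ip_ge0//.
by rewrite ler_sqrt ?mulr_ge0 ?ip_ge0//; exact: cauchy_schwarz_sqr.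
Qed.

Lemma nrmD f g : sqi f -> sqi g -> nrm (fun x => f x + g x) <= nrm f + nrm g.
Proof.
move=> sf sg; rewrite -ler_sqr ?nnegrE ?addr_ge0 ?nrm_ge0// nrm_sqr.
rewrite ipDl ?ipDr//; last exact: sqiD.
have := cauchy_schwarz sf sg; rewrite ler_norml (ipC g f) => /andP[_ H].
by rewrite sqrrD !nrm_sqr; lra.
Qed.

Lemma nrmZ a f : sqi f -> nrm (fun x => a * f x) = `|a| * nrm f.
Proof.
move=> sf; have saf := sqiZ a sf.
rewrite /nrm ipZl ?ipZr// mulrA -expr2 sqrtrM ?sqr_ge0//.
by rewrite sqrtr_sqr.
Qed.

Lemma nrmB f g : sqi f -> sqi g -> nrm (fun x => f x - g x) <= nrm f + nrm g.
Proof.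
move=> sf sg; have sN := sqiZ (-1) sg; have := nrmD sf sN.
by rewrite nrmZ// normrN1 mul1r; under [X in nrm X <= _]eq_fun do rewrite mulN1r.
Qed.

(* The infimum over [K] need not be attained, as [K] is not assumed closed. *)
Lemma near_projection (K : set (T -> R)) (eta : T -> R) (e : R) :
  K (cst 0) -> (forall a f g, K f -> K g -> K (fun x => f x + a * g x)) ->
  (forall f, K f -> sqi f) -> sqi eta -> 0 < e ->
  exists g, [/\ K g, nrm g <= 2 * nrm eta &
    forall h, K h -> `|ip (fun x => eta x - g x) h| <= e * nrm h].
Proof.
move=> K0 KD Ks se e0.
pose q g := ip (fun x => eta x - g x) (fun x => eta x - g x).
pose S := [set q g | g in K].
have hS : has_inf S.
  split; first by exists (q (cst 0)); exists (cst 0).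
  by exists 0 => _ [g _ <-]; exact: ip_ge0.
have q0 : q (cst 0) = ip eta eta.
  by rewrite /q; congr ip; apply/funext => x; rewrite subr0.
(* Besides being within [e ^+ 2] of the infimum, [g] must not do worse than 0: this bounds the
   residual by [nrm eta], hence [g] by twice that. If the near-minimizer does worse than 0, then 0
   is itself a near-minimizer. *)
have [g [Kg gS gq]] : exists g, [/\ K g, q g < inf S + e ^+ 2 & q g <= ip eta eta].
  have [_ [g Kg <-] gS] := inf_adherent (exprn_gt0 2 e0) hS.
  have [le|lt] := leP (q g) (ip eta eta); first by exists g.
  by exists (cst 0); rewrite q0; split => //; exact: lt_trans gS.
have sg := Ks _ Kg; have sr := sqiB se sg.
exists g; split => //.
  have -> : g = (fun x => eta x - (eta x - g x)) by apply/funext => x; ring.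
  apply: (le_trans (nrmB se sr)).
  rewrite mulr2n mulrDl mul1r lerD2l /nrm ler_sqrt ?ip_ge0//.
move=> h Kh; have sh := Ks _ Kh.
set r := fun x => _ in sr *.
have [h0|h0] := eqVneq (ip h h) 0.
  apply: (le_trans (cauchy_schwarz sr sh)).
  by rewrite /nrm h0 sqrtr0 !mulr0.
have hp : 0 < ip h h by rewrite lt0r h0 ip_ge0.
rewrite -ler_sqr ?nnegrE ?normr_ge0 ?mulr_ge0 ?nrm_ge0 ?(ltW e0)//.
rewrite real_normK ?num_real// exprMn nrm_sqr.
(* The optimal step from [g] along [h] lowers the squared distance by [ip r h ^+ 2 / ip h h]; since
   [g] is within [e ^+ 2] of the infimum, this gain is at most [e ^+ 2]. *)
pose s := ip r h / ip h h.
have inS : inf S <= q (fun x => g x + s * h x).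
  by apply: ge_inf; [case: hS|exists (fun x => g x + s * h x) => //; exact: KD].
have ssh := sqiZ s sh.
have qE : q (fun x => g x + s * h x) = q g - ip r h ^+ 2 / ip h h.
  rewrite /q (_ : (fun x => eta x - (g x + s * h x)) = fun x => r x - s * h x).
    by rewrite ip_sqrBZ// /s /r; field.
  by apply/funext => x; rewrite /r; ring.
move: inS; rewrite qE => inS.
by rewrite -ler_pdivrMr//; lra.
Qed.

End L2.

(** * Increments of the Brownian motion *)

Section independence.
Context (R : realType) (d : measure_display) (Om : measurableType d)
  (P : probability Om R).

(** The law of the pair agrees with the product of the laws on rectangles, hence everywhere, and
    Fubini factorizes the integral. Independence is asked of preimages, which fits increments as
    well as their squares. *)
Lemma expectation_indep (f g : Om -> R) :
  measurable_fun setT f -> measurable_fun setT g ->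
  (forall A B, measurable A -> measurable B ->
    P (f @^-1` A `&` g @^-1` B) = (P (f @^-1` A) * P (g @^-1` B))%E) ->
  P.-integrable setT (EFin \o f) -> P.-integrable setT (EFin \o g) ->
  P.-integrable setT (fun w => (f w * g w)%:E) ->
  \int[P]_w (f w * g w) = \int[P]_w f w * \int[P]_w g w.
Proof.
move=> mf mg ind intf intg intfg.
pose X : {RV P >-> R} := MeasurableFun.Pack
  (MeasurableFun.Class (isMeasurableFun.Build _ _ _ _ f mf)).
pose Y : {RV P >-> R} := MeasurableFun.Pack
  (MeasurableFun.Class (isMeasurableFun.Build _ _ _ _ g mg)).
pose m1 := distribution P X; pose m2 := distribution P Y.
have mxy : measurable_fun [set: R * R] (fun z : R * R => (z.1 * z.2)%:E).
  by apply/measurable_EFinP; exact: measurable_funM.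
have mE A : measurable A -> (m1 \x m2)%E A = law2 X Y A.
  by move=> mA; apply: product_measure_unique.
have E1 (h : R * R -> \bar R) :
    (\int[law2 X Y]_z h z = \int[(m1 \x m2)%E]_z h z)%E.
  by apply: eq_measure_integral => A mA _; exact/esym/mE.
have int12 : (m1 \x m2)%E.-integrable setT (fun z : R * R => (z.1 * z.2)%:E).
  apply/integrableP; split => //; rewrite -E1 ge0_integral_distribution//.
    by case/integrableP: intfg.
  exact: measurableT_comp.
have E2 : (\int[P]_w (f w * g w)%:E = \int[m1]_x \int[m2]_y (x * y)%:E)%E.
  have := integral12_prod_meas1 int12; rewrite /fubini_F/= => ->.
  by rewrite -E1 integral_distribution.
have i1 : (\int[m1]_x x%:E = \int[P]_w (f w)%:E)%E.
  by rewrite integral_distribution//; exact/measurable_EFinP.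
have i2 : (\int[m2]_x x%:E = \int[P]_w (g w)%:E)%E.
  by rewrite integral_distribution//; exact/measurable_EFinP.
have I1 : m1.-integrable setT (EFin \o id).
  apply/integrableP; split; first exact/measurable_EFinP.
  rewrite ge0_integral_distribution//; first by case/integrableP: intf.
  by apply: measurableT_comp => //; exact/measurable_EFinP.
have I2 : m2.-integrable setT (EFin \o id).
  apply/integrableP; split; first exact/measurable_EFinP.
  rewrite ge0_integral_distribution//; first by case/integrableP: intg.
  by apply: measurableT_comp => //; exact/measurable_EFinP.
rewrite {1}/Rintegral E2.
under eq_integral.
  move=> x _; under eq_integral do rewrite EFinM.
  rewrite integralZl// i2 -(fineK (integrable_fin_num _ intg))//.
  over.
rewrite /= integralZr// i1 fineM//; last exact: integrable_fin_num.
Qed.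

End independence.

(** * Moments of the centered normal law *)

Section normal_moments.
Context (R : realType).
Notation mu := (@lebesgue_measure R).

(** The Radon-Nikodym derivative of [normal_prob] is almost everywhere the normal density, as both
    have the same integral over each measurable set. *)
Lemma ge0_integral_normal (s : R) (f : R -> \bar R) :
  measurable_fun setT f -> (forall x, 0 <= f x)%E ->
  (\int[normal_prob 0%R s]_x f x = \int[mu]_x (f x * (normal_pdf 0%R s x)%:E))%E.
Proof.
move=> mf f0.
have dom := @normal_prob_dominates R 0 s.
rewrite -(Radon_Nikodym_SigmaFinite.change_of_variables dom)//.
apply: ae_eq_integral => //.
- apply: emeasurable_funM => //.
  exact: (measurable_int _ (Radon_Nikodym_SigmaFinite.f_integrable dom)).
- apply: emeasurable_funM => //.
  by apply/measurable_EFinP; exact: measurable_normal_pdf.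
- apply: ae_eqe_mul2l; apply: integral_ae_eq => //.
  + exact: Radon_Nikodym_SigmaFinite.f_integrable.
  + by apply/measurable_EFinP; exact: measurable_normal_pdf.
  + by move=> A _ mA; rewrite -Radon_Nikodym_SigmaFinite.f_integral.
Qed.

(** Kept as a symbol: it enters the isometry, and every estimate derived from it, as a factor. *)
Definition normal_var : R := \int[normal_prob 0 1]_x (x ^+ 2).

Lemma normal_pdf_opp (s x : R) : s != 0 -> normal_pdf 0 s (- x) = normal_pdf 0 s x.
Proof. by move=> s0; rewrite !normal_pdfE// /normal_fun !subr0 sqrrN. Qed.

Lemma normal_pdfM (s x : R) : 0 < s ->
  normal_pdf 0 s (s * x) * s = normal_pdf 0 1 x.
Proof.
move=> s0; rewrite !normal_pdfE ?gt_eqF//.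
rewrite /normal_fun /normal_peak !subr0 expr1n mul1r.
rewrite (_ : - (s * x) ^+ 2 / (s ^+ 2 *+ 2) = - x ^+ 2 / (1 *+ 2)); last first.
  rewrite exprMn -mulrN -mulr_natr invfM mulrACA mulfV ?mul1r//.
  by rewrite expf_neq0// gt_eqF.
rewrite -mulrnAr sqrtrM ?sqr_ge0// sqrtr_sqr gtr0_norm// invfM.
by rewrite mulrC !mulrA mulfV ?gt_eqF// mul1r.
Qed.

Lemma normal_sqr_scale (s : R) : 0 < s ->
  (\int[normal_prob 0%R s]_x (x ^+ 2)%:E =
   (s ^+ 2)%:E * \int[normal_prob (0 : R)%R (1 : R)%R]_x (x ^+ 2)%:E)%E.
Proof.
move=> s0.
have m2 : measurable_fun [set: R] (fun x : R => (x ^+ 2)%:E).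
  by apply/measurable_EFinP; exact: measurable_funX.
rewrite !ge0_integral_normal//; last 2 first.
  by move=> x; rewrite lee_fin sqr_ge0.
  by move=> x; rewrite lee_fin sqr_ge0.
pose F (x : R) := s * x.
have dF (x : R) : is_derive x (1 : R) (F : R -> R) s.
  by rewrite -[X in is_derive _ _ _ X]mulr1; exact: is_deriveZ.
have F' : F^`()%classic = cst s.
  by apply/funext => x; rewrite derive1E; exact: derive_val.
pose G x : R := x ^+ 2 * normal_pdf 0 s x.
have cG : continuous G.
  move=> x; apply: cvgM; first exact: sqr_continuous.
  by apply: continuous_normal_pdf; rewrite gt_eqF.
rewrite (_ : (fun x => _) = EFin \o G) in |- *.
  rewrite (@increasing_ge0_integration_by_substitutionT _ F G)//.
  - rewrite -ge0_integralZl//.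
    + apply: eq_integral => x _; rewrite /= !fctE F' /G /F -!EFinM.
      by rewrite -[_ * _ * cst s x]mulrA normal_pdfM// exprMn -!mulrA.
    + apply: emeasurable_funM => //.
      by apply/measurable_EFinP; exact: measurable_normal_pdf.
    + by move=> x _; rewrite -EFinM lee_fin mulr_ge0 ?sqr_ge0 ?normal_pdf_ge0.
    + by rewrite lee_fin sqr_ge0.
  - by move=> x y xy; rewrite /F ltr_pM2l.
  - by rewrite F' => x; exact: cvg_cst.
  - by rewrite F'; exact: is_cvg_cst.
  - by rewrite F'; exact: is_cvg_cst.
  - by apply: gt0_cvgMrNy => //; exact: cvg_id.
  - by apply: gt0_cvgMry => //; exact: cvg_id.
  - by move=> x; rewrite /G mulr_ge0 ?sqr_ge0 ?normal_pdf_ge0.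
by apply/funext => x; rewrite /= /G EFinM.
Qed.

(** From [x ^+ 2 <= 4 * expR (x ^+ 2 / 4)] the integrand is at most a constant times the normal
    density of variance 2, whose integral is 1. *)
Lemma normal_sqr_fin : (\int[normal_prob (0 : R)%R (1 : R)%R]_x (x ^+ 2)%:E < +oo)%E.
Proof.
have m2 : measurable_fun [set: R] (fun x : R => (x ^+ 2)%:E).
  by apply/measurable_EFinP; exact: measurable_funX.
rewrite ge0_integral_normal//; last by move=> x; rewrite lee_fin sqr_ge0.
pose s : R := Num.sqrt 2.
have s0 : 0 < s by rewrite sqrtr_gt0.
have s2 : s ^+ 2 = 2 by rewrite sqr_sqrtr.
pose K : R := 4 * normal_peak 1 / normal_peak s.
have half (y : R) : - y / 2 = - (y / 4) + - y / (2 *+ 2).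
  by rewrite (_ : 2 *+ 2 = 4 :> R); [lra|rewrite -mulrnA].
have K0 : 0 <= K by rewrite /K !mulr_ge0 ?invr_ge0 ?normal_peak_ge0.
apply: (@le_lt_trans _ _ (\int[mu]_x (K%:E * (normal_pdf 0%R s x)%:E))%E).
  apply: ge0_le_integral => //.
  - by move=> x _; rewrite -EFinM lee_fin mulr_ge0 ?sqr_ge0 ?normal_pdf_ge0.
  - apply: emeasurable_funM => //.
    by apply/measurable_EFinP; exact: measurable_normal_pdf.
  - apply: emeasurable_funM => //.
    by apply/measurable_EFinP; exact: measurable_normal_pdf.
  - move=> x _; rewrite -!EFinM lee_fin !normal_pdfE ?oner_eq0 ?gt_eqF//.
    rewrite (_ : K * _ = 4 * normal_peak 1 * normal_fun 0 s x); last first.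
      by rewrite /K mulrA divfK// gt_eqF// normal_peak_gt0// gt_eqF.
    rewrite mulrCA -mulrA [leRHS]mulrCA ler_wpM2l ?normal_peak_ge0//.
    rewrite /normal_fun subr0 expr1n s2.
    rewrite half.
    rewrite expRD mulrA ler_wpM2r ?expR_ge0// expRN -ler_pdivlMr ?invr_gt0 ?expR_gt0//.
    rewrite invrK mulrC; have := expR_ge1Dx (x ^+ 2 / 4); lra.
rewrite ge0_integralZl//.
- by rewrite integral_normal_pdf mule1 ltry.
- by apply/measurable_EFinP; exact: measurable_normal_pdf.
- by move=> x _; rewrite lee_fin normal_pdf_ge0.
Qed.

End normal_moments.

Section probability_L2.
Context (R : realType) (d : measure_display) (Om : measurableType d)
  (P : probability Om R).

Lemma sqi1 : sqi P (cst 1).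
Proof.
split => //; under eq_integral do rewrite expr1n.
by rewrite integral_cst// mul1e (le_lt_trans (probability_le1 P _))// ltry.
Qed.

Lemma sqi_integrable (f : Om -> R) : sqi P f -> P.-integrable setT (EFin \o f).
Proof.
move=> sf; have := sqi_integrableM sqi1 sf.
by apply: eq_integrable => // w _; rewrite /= mul1r.
Qed.

Lemma sqi_bdd C (f : Om -> R) : measurable_fun setT f ->
  (forall w, `|f w| <= C) -> sqi P f.
Proof.
move=> mf fC; have := sqi_bounded mf fC sqi1.
by under eq_fun do rewrite mulr1.
Qed.

End probability_L2.

Section normal_increments.
Context (R : realType) (d : measure_display) (Om : measurableType d)
  (P : probability Om R).
Notation mu := (@lebesgue_measure R).

Lemma normal_prob_opp (s : R) (B : set (measurableTypeR R)) : s != 0 -> measurable B ->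
  normal_prob 0 s ((-%R : _ -> measurableTypeR R) @^-1` B) = normal_prob 0 s B.
Proof.
move=> s0 mB; rewrite /normal_prob.
transitivity (\int[mu]_(x in (-%R : _ -> measurableTypeR R) @^-1` B)
    (EFin \o normal_pdf 0 s \o (-%R : _ -> measurableTypeR R)) x)%E.
  by apply: eq_integral => x _; rewrite /= normal_pdf_opp.
rewrite -ge0_integral_pushforward//.
- by apply: eq_measure_integral => A mA _; exact: lebesgue_measureN.
- apply/measurable_EFinP/measurable_funTS; exact: measurable_normal_pdf.
- by move=> x _; rewrite lee_fin normal_pdf_ge0.
Qed.

(* [lebesgue_measure] and [normal_prob] live on [measurableTypeR R], whose
   measurable sets are those of [R] but whose display differs. *)
Variables (D : {mfun Om >-> measurableTypeR R}) (s : R).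
Hypothesis s0 : 0 < s.
Hypothesis DE : forall B, measurable B -> P (D @^-1` B) = normal_prob 0 s B.

Lemma normal_sqi : sqi P D.
Proof.
split; first by move=> _ B mB; exact: (measurable_funP D measurableT B mB).
have m2 : measurable_fun [set: measurableTypeR R] (fun x : R => (x ^+ 2)%:E).
  by apply/measurable_EFinP; exact: measurable_funX.
rewrite -[ltLHS]/(\int[P]_w ((fun x : measurableTypeR R => (x ^+ 2)%:E) \o D) w)%E.
rewrite -ge0_integral_distribution//; last by move=> x; rewrite lee_fin sqr_ge0.
rewrite (eq_measure_integral (normal_prob 0%R s)); last by move=> A mA _; exact: DE.
rewrite normal_sqr_scale// lte_mul_pinfty ?lee_fin ?sqr_ge0//.
exact: normal_sqr_fin.
Qed.

Lemma normal_expectation_sqr :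
  \int[P]_w (D w ^+ 2) = normal_var R * s ^+ 2.
Proof.
have m2 : measurable_fun [set: measurableTypeR R] (fun x : R => (x ^+ 2)%:E).
  by apply/measurable_EFinP; exact: measurable_funX.
rewrite /Rintegral.
rewrite -[X in fine X]/(\int[P]_w ((fun x : measurableTypeR R => (x ^+ 2)%:E) \o D) w)%E.
rewrite -ge0_integral_distribution//; last by move=> x; rewrite lee_fin sqr_ge0.
rewrite (eq_measure_integral (normal_prob 0%R s)); last by move=> A mA _; exact: DE.
rewrite normal_sqr_scale// fineM//; first by rewrite mulrC.
rewrite ge0_fin_numE; first exact: normal_sqr_fin.
by apply: integral_ge0 => x _; rewrite lee_fin sqr_ge0.
Qed.

Lemma integrable_normal : P.-integrable setT (EFin \o D).
Proof.
exact: sqi_integrable normal_sqi.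
Qed.

(** By symmetry [D] and [- D] have the same law, so the expectation equals its opposite. *)
Lemma normal_expectation : \int[P]_w D w = 0.
Proof.
have mN : measurable_fun [set: Om] (fun w => - D w : measurableTypeR R) by exact: measurableT_comp.
pose N : {mfun Om >-> measurableTypeR R} := MeasurableFun.Pack
  (MeasurableFun.Class (isMeasurableFun.Build _ _ _ _ _ mN)).
have iN : P.-integrable setT (EFin \o N).
  apply: (eq_integrable measurableT (-%E \o (EFin \o D))%E) => //.
  by apply: integrableN => //; exact: integrable_normal.

have mid : measurable_fun [set: measurableTypeR R] (EFin : R -> \bar R) by exact/measurable_EFinP.
suff : \int[P]_w N w = \int[P]_w D w.
  have -> : \int[P]_w N w = - \int[P]_w D w.
    rewrite -[RHS]mulN1r -RintegralZl//; last exact: integrable_normal.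
    by apply: eq_Rintegral => w _; rewrite mulN1r.
  by move=> H; lra.
rewrite /Rintegral; congr fine.
have := integral_distribution mid iN; rewrite /comp => <-.
have := integral_distribution mid integrable_normal; rewrite /comp => <-.
apply: eq_measure_integral => A mA _.
rewrite [RHS]DE// -normal_prob_opp ?gt_eqF// -DE//.
by have := @oppr_measurable R setT measurableT A mA; rewrite setTI.
Qed.

End normal_increments.

(** * Independence of Brownian increments from the filtration *)

Section filtration.
Context (R : realType) (d : measure_display) (Om : measurableType d)
  (P : probability Om R) (W : R -> {RV P >-> R}) (Fs : set (set Om)).
Local Notation F := (filtration Fs W).
Hypothesis basis : stochastic_basis Fs W.

Definition filtration_generators (t : R) : set (set Om) :=
  history `[0, t] W `|` Fs `|` P.-negligible.

Lemma history_measurable D : <<s history D W >> `<=` measurable.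
Proof.
apply: smallest_sub; first exact: sigma_algebra_measurable.
move=> _ [s [B [_ mB ->]]]; rewrite -(setTI (_ @^-1` B)); exact: measurable_funP.
Qed.

Lemma filtration_measurable t : F t `<=` measurable.
Proof.
case: basis => cP _ [_ FsM] _ _.
apply: smallest_sub; first exact: sigma_algebra_measurable.
move=> A [[hA|/FsM//]|/cP//].
by apply: (@history_measurable `[0, t]); exact: sub_sigma_algebra.
Qed.

Lemma filtration_mono s t : s <= t -> F s `<=` F t.
Proof.
move=> st; apply: sub_sigma_algebra2 => A [[[r [B [rs mB ->]]]|FA]|NA].
- left; left; exists r, B; split => //.
  by move: rs; rewrite /= !in_itv/= => /andP[-> /le_trans]; exact.
- by left; right.
- by right.
Qed.

Definition increment s t (w : Om) : R := W t w - W s w.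
Local Notation incr := increment.

Lemma measurable_incr s t : measurable_fun setT (incr s t).
Proof. by apply: measurable_funB; exact: measurable_funP. Qed.

(** Two finite measures, [P] restricted to the increment event and [P] scaled by the probability of
    that event, agree on a family stable under intersection that generates [F s], hence on [F s]. *)
Lemma filtration_indep s t A B : 0 <= s -> s < t -> F s A -> measurable B ->
  P (A `&` incr s t @^-1` B) = (P A * P (incr s t @^-1` B))%E.
Proof.
move=> s0 st FA mB; case: basis => cP [_ bW _] [sFs FsM] indFs _.
have [_ indW] := bW s t s0 st.
set D := incr s t @^-1` B.
have mD : measurable D.
  by rewrite -(setTI D); exact: measurable_incr.
(* Allowing [A3 = setT] next to null sets puts the whole space and each single generator into
   [G]. *)
pose G : set (set Om) := [set X | exists A1 A2 A3,
  [/\ <<s history `[0, s] W >> A1, Fs A2, P.-negligible A3 \/ A3 = setT &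
      X = A1 `&` A2 `&` A3]].
have hT D' : <<s history D' W >> setT.
  have [h0 hC _] := smallest_sigma_algebra setT (history D' W).
  by have := hC _ h0; rewrite setD0.
have FsT : Fs setT by case: sFs => F0 FC _; rewrite -(setD0 setT); exact: FC.
have mG : G `<=` measurable.
  move=> _ [A1 [A2 [A3 [h1 h2 h3 ->]]]].
  apply: measurableI; last by case: h3 => [/cP//|->].
  by apply: measurableI; [exact: history_measurable h1|exact: FsM].
have GI : setI_closed G.
  move=> _ _ [A1 [A2 [A3 [h1 h2 h3 ->]]]] [B1 [B2 [B3 [k1 k2 k3 ->]]]].
  exists (A1 `&` B1), (A2 `&` B2), (A3 `&` B3); split.
  - exact: (@measurableI _ (g_sigma_algebraType (history `[0, s] W))).
  - case: sFs => F0 FC FU; rewrite -(setCK (A2 `&` B2)) setCI -setTD.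
    apply: (FC); rewrite -bigcup2E; apply: FU => -[|[|n]] /=; last exact: F0.
      by rewrite -setTD; exact: FC.
    by rewrite -setTD; exact: FC.
  - case: h3 => [N3|->]; first by left; apply: negligibleS N3 => w [].
    by case: k3 => [N3|->]; [left; apply: negligibleS N3 => w []|right; rewrite setTI].
  - by rewrite setIACA -[in RHS](setIACA A1); congr (_ `&` _).
have GT : G setT.
  exists setT, setT, setT; split => //; last by rewrite !setTI.
  by right.
have Ggen : <<s G >> A.
  move: A FA; apply: smallest_sub; first exact: smallest_sigma_algebra.
  move=> A [[hA|FA]|NA]; apply: sub_sigma_algebra.
  - exists A, setT, setT; split => //; [exact: sub_sigma_algebra|by right|].
    by rewrite !setIT.
  - by exists setT, A, setT; split => //; [right|rewrite setTI setIT].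
  - by exists setT, setT, A; split => //; [left|rewrite !setTI].
have key X : G X -> P (X `&` D) = (P X * P D)%E.
  move=> [A1 [A2 [A3 [h1 h2 h3 ->]]]].
  case: h3 => [N3|->].
    have z Y : measurable Y -> Y `<=` A3 -> P Y = 0%E.
      move=> mY YA; apply: measure_negligible => //; exact: negligibleS N3.
    have m3 := cP _ N3; have m2 := FsM _ h2; have m1 := history_measurable h1.
    have m12 : measurable (A1 `&` A2) by exact: measurableI.
    have m123 : measurable (A1 `&` A2 `&` A3) by exact: measurableI.
    have -> : P (A1 `&` A2 `&` A3) = 0%E by apply: z => // w [].
    by rewrite mul0e; apply: z; [exact: measurableI|move=> w [[]]].
  rewrite setIT.
  (* The history over [[0, +oo[] contains both the past event [A1] and the increment event, so [A2]
     is separated from the two together; the Brownian property then separates the increment from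
     [A1]. *)
  have D1 : <<s history `[0, +oo[ W >> (A1 `&` D).
    have sub1 : <<s history `[0, s] W >> `<=` <<s history `[0, +oo[ W >>.
      apply: sub_sigma_algebra2 => _ [r [C [rs mC ->]]]; exists r, C; split => //.
      by move: rs; rewrite /= !in_itv/= => /andP[->].
    apply: (@measurableI _ (g_sigma_algebraType (history `[0, +oo[ W))).
      exact: sub1.
    have mW r : 0 <= r -> measurable_fun setT
        (W r : g_sigma_algebraType (history `[0, +oo[ W) -> R).
      move=> r0 _ C mC; rewrite setTI; apply: sub_sigma_algebra.
      by exists r, C; split => //; rewrite /= in_itv/= r0.
    rewrite -(setTI D); apply: (measurable_funB (mW t _) (mW s _)) => //.
    by rewrite (le_trans s0)// ltW.
  have := indFs _ _ h2 D1.
  rewrite (_ : A1 `&` A2 `&` D = A2 `&` (A1 `&` D)); last by rewrite setICA setIA.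
  move=> ->.
  have D2 : [set A | exists2 B, measurable B & A = [set w | B (W t w - W s w)]] D.
    by exists B.
  rewrite setIC indW// setIC indFs//; last first.
    apply: (sub_sigma_algebra2 _ h1) => _ [r [C [rs mC ->]]]; exists r, C.
    by split => //; move: rs; rewrite /= !in_itv/= => /andP[->].
  by rewrite (muleC (P D)) muleA.
have PD0 : 0 <= fine (P D) by rewrite fine_ge0.
have := @g_sigma_algebra_measure_unique _ R Om G mG (fun=> setT).
move=> /(_ _ _ (mrestr P mD) (mscale (NngNum PD0) P)) H.
have mE X : mscale (NngNum PD0) P X = (P X * P D)%E.
  by rewrite /mscale/= fineK ?fin_num_measure// muleC.
rewrite -mE; apply: H => //.
- exact: bigcup_const.
- by move=> X GX; exact: (etrans (key X GX) (esym (mE X))).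
- by move=> _; rewrite -[X in (X < _)%E]/(P (setT `&` D)) setTI ltey_eq fin_num_measure.
Qed.


Definition fmeas t (f : Om -> R) : Prop :=
  forall B, measurable B -> F t (f @^-1` B).

Lemma fmeasP t f : fmeas t f <->
  measurable_fun setT (f : g_sigma_algebraType (filtration_generators t) -> R).
Proof.
by split=> [mf _ B mB|mf B mB]; have := mf; [rewrite setTI; apply|move=> /(_ measurableT _ mB); rewrite setTI].
Qed.

Lemma fmeas_mono s t f : s <= t -> fmeas s f -> fmeas t f.
Proof. by move=> st mf B mB; apply: (filtration_mono st); exact: mf. Qed.

Lemma fmeas_measurable t f : fmeas t f -> measurable_fun setT f.
Proof. by move=> mf _ B mB; rewrite setTI; apply: (@filtration_measurable t); exact: mf. Qed.

Lemma fmeasM t f g : fmeas t f -> fmeas t g -> fmeas t (fun w => f w * g w).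
Proof. by move=> /fmeasP mf /fmeasP mg; apply/fmeasP; exact: measurable_funM. Qed.

Lemma fmeas_cst t r : fmeas t (cst r).
Proof. by apply/fmeasP; exact: measurable_cst. Qed.

Lemma fmeas_incr r s t : 0 <= r -> r <= s -> s <= t -> fmeas t (incr r s).
Proof.
move=> r0 rs st; have mW q : 0 <= q <= t -> fmeas t (W q).
  move=> qt B mB; apply: sub_sigma_algebra; left; left; exists q, B; split => //.
apply/fmeasP; apply: measurable_funB; apply/fmeasP; apply: mW.
  by rewrite st (le_trans r0).
by rewrite r0 (le_trans rs).
Qed.

Lemma incr_moments s t : 0 <= s -> s <= t ->
  [/\ sqi P (incr s t), P.-integrable setT (EFin \o incr s t),
      \int[P]_w incr s t w = 0 &
      \int[P]_w (incr s t w ^+ 2) = normal_var R * (t - s)].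
Proof.
move=> s0; rewrite le_eqVlt => /predU1P[<-|st].
  have -> : incr s s = cst 0 by apply/funext => w; rewrite /increment subrr.
  split; first exact: sqi0.
  - exact: finite_measure_integrable_cst.
  - by rewrite /Rintegral integral0.
  - by rewrite subrr mulr0 /Rintegral integral0_eq// => w _; rewrite expr0n.
have sq0 : 0 < Num.sqrt (t - s) by rewrite sqrtr_gt0 subr_gt0.
pose D : {mfun Om >-> measurableTypeR R} := MeasurableFun.Pack
  (MeasurableFun.Class (isMeasurableFun.Build _ _ _ _ (incr s t : Om -> measurableTypeR R) (@measurable_incr s t))).
have DE B : measurable B -> P (D @^-1` B) = normal_prob 0 (Num.sqrt (t - s)) B.
  by move=> mB; case: basis => _ [_ /(_ s t s0 st)[+ _] _] _ _ _; exact.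
split.
- exact: (normal_sqi sq0 DE).
- exact: (integrable_normal sq0 DE).
- exact: (normal_expectation sq0 DE).
- by rewrite (normal_expectation_sqr sq0 DE) sqr_sqrtr// subr_ge0 ltW.
Qed.

Lemma fmeas_incr_indep s t g : 0 <= s -> s < t -> fmeas s g ->
  forall A B, measurable A -> measurable B ->
  P (g @^-1` A `&` incr s t @^-1` B) = (P (g @^-1` A) * P (incr s t @^-1` B))%E.
Proof. by move=> s0 st mg A B mA mB; apply: filtration_indep => //; exact: mg. Qed.

(** Increments are centered and independent of the past: the martingale property of [W] in tested
    form. *)
Lemma expectation_incr0 s t g : 0 <= s -> s <= t -> fmeas s g -> sqi P g ->
  ip P g (incr s t) = 0.
Proof.
move=> s0 st mg sg; have [si ii i0 _] := incr_moments s0 st.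
move: st; rewrite le_eqVlt => /predU1P[ts|st].
  rewrite /ip /Rintegral integral0_eq// => w _.
  by rewrite /increment ts subrr mulr0.
rewrite /ip (@expectation_indep _ _ _ P g (incr s t)) ?i0 ?mulr0//.
- exact: fmeas_measurable mg.
- exact: measurable_incr.
- exact: fmeas_incr_indep.
- exact: sqi_integrable.
- exact: sqi_integrableM.
Qed.

Lemma expectation_incr_sqr s t g C : 0 <= s -> s <= t -> fmeas s g ->
  (forall w, `|g w| <= C) ->
  \int[P]_w (g w * incr s t w ^+ 2) = normal_var R * (t - s) * \int[P]_w g w.
Proof.
move=> s0 st mg gC; have [si ii _ i2] := incr_moments s0 st.
move: st; rewrite le_eqVlt => /predU1P[ts|st].
  rewrite -ts subrr mulr0 mul0r /Rintegral integral0_eq// => w _.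
  by rewrite /increment subrr expr0n mulr0.
have mg' := fmeas_measurable mg.
have sgi : sqi P (fun w => g w * incr s t w) := sqi_bounded mg' gC si.
rewrite (@expectation_indep _ _ _ P g (fun w => incr s t w ^+ 2)) ?i2 1?mulrC//.
- by apply: measurable_funX; exact: measurable_incr.
- move=> A B mA mB.
  have mB2 : measurable ((fun x : R => x ^+ 2) @^-1` B).
    by rewrite -(setTI (_ @^-1` _)); exact: measurable_funX.
  exact: (fmeas_incr_indep s0 st mg mA mB2).
- by apply: sqi_integrable; exact: sqi_bdd gC.
- by have := sqi_integrableM si si; apply: eq_integrable => // w _; rewrite -expr2.
- have := sqi_integrableM sgi si; apply: eq_integrable => // w _.
  by rewrite -mulrA -expr2.
Qed.

End filtration.

(** * Integrals of simple processes *)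

Section generators.
Context (R : realType) (d : measure_display) (Om : measurableType d)
  (P : probability Om R) (W : R -> {RV P >-> R}) (Fs : set (set Om)).
Hypothesis basis : stochastic_basis Fs W.
Local Notation fmeas := (@fmeas R d Om P W Fs).
Local Notation incr := (increment W).
Local Notation Rm := (measurableTypeR R).

Definition timeprod : {measure set (Rm * Om) -> \bar R} :=
  (@lebesgue_measure R \x P)%E.

(** One block of a simple process. A list of blocks needs no common or ordered time grid, so
    concatenation and scaling give all linear combinations. *)
Record gen := Gen { ga : R; gb : R; gx : Om -> R }.

Definition gen_wf (g : gen) : Prop :=
  [/\ 0 <= ga g, ga g <= gb g, exists K, forall w, `|gx g w| <= K &
      fmeas (ga g) (gx g)].

Definition gen_int (g : gen) (w : Om) : R := gx g w * incr (ga g) (gb g) w.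

Definition gen_eval (g : gen) (p : Rm * Om) : R :=
  gx g p.2 * \1_(`]ga g, gb g]) p.1.

Lemma gen_int_sqi g : gen_wf g -> sqi P (gen_int g).
Proof.
move=> [a0 ab [K gK] mg]; apply: (sqi_bounded (fmeas_measurable basis mg) gK).
by have [] := incr_moments basis a0 ab.
Qed.

Lemma lebesgue_itv_fin a b : (lebesgue_measure (`]a, b]%classic : set Rm) < +oo)%E.
Proof. by rewrite lebesgue_measure_itv/=; case: ifP => // _; rewrite -EFinD ltry. Qed.

Lemma indic_timeprod_sqi a b :
  sqi timeprod (fun p : Rm * Om => \1_(`]a, b]) p.1).
Proof.
split.
  exact: (measurableT_comp (f := \1_(`]a, b]) : Rm -> R)).
have mA : measurable (`]a, b]%classic `*` setT : set (Rm * Om)).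
  exact: measurableX.
under eq_integral => p _.
  rewrite (_ : \1_(`]a, b]) p.1 ^+ 2 = \1_(`]a, b]%classic `*` setT) p :> R);
    last first.
    rewrite !indicE; case: p => s w /=.
    rewrite (_ : ((s, w) \in _) = (s \in `]a, b]%classic)).
      by case: (_ \in _); rewrite ?expr1n ?expr0n.
    by apply/idP/idP; rewrite !inE /=; [case|].
  over.
rewrite integral_indic// setIT [X in (X < _)%E]product_measure1E//.
rewrite [X in (_ * X)%E]probability_setT mule1; exact: lebesgue_itv_fin.
Qed.

Lemma gen_eval_sqi g : gen_wf g -> sqi timeprod (gen_eval g).
Proof.
move=> wg; case: (wg) => _ _ [K gK] mg.
apply: (@sqi_bounded _ _ _ _ K (fun p => gx g p.2)).
- by apply: measurableT_comp => //; exact: fmeas_measurable mg.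
- by move=> p; exact: gK.
- exact: indic_timeprod_sqi.
Qed.

Lemma gen_eval_ip g g' : gen_wf g -> gen_wf g' ->
  ip timeprod (gen_eval g) (gen_eval g') =
  fine (lebesgue_measure (`]ga g, gb g]%classic `&` `]ga g', gb g']%classic))
  * ip P (gx g) (gx g').
Proof.
move=> wg wg'; have int := sqi_integrableM (gen_eval_sqi wg) (gen_eval_sqi wg').
case: (wg) => _ _ [K gK] mg; case: (wg') => _ _ [K' gK'] mg'.
rewrite {1}/ip {1}/Rintegral -(integral12_prod_meas1 int) /fubini_F.
have sg := sqi_bdd P (fmeas_measurable basis mg) gK.
have sg' := sqi_bdd P (fmeas_measurable basis mg') gK'.
have igg := sqi_integrableM sg sg'.
set A := (X in lebesgue_measure X).
have mA : measurable (A : set Rm) by exact: measurableI.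
have Afin : (lebesgue_measure (A : set Rm) < +oo)%E.
  apply: le_lt_trans (lebesgue_itv_fin (ga g) (gb g)).
  by apply: le_measure; rewrite ?inE//; exact: subIsetl.
transitivity (fine (\int[lebesgue_measure]_s
    ((\1_A s : R)%:E * (ip P (gx g) (gx g'))%:E))%E).
  congr fine; apply: eq_integral => s _; rewrite /gen_eval/=.
  rewrite /ip /Rintegral fineK ?integrable_fin_num// -integralZl//.
  apply: eq_integral => w _; rewrite -EFinM; congr EFin.
  by rewrite mulrACA mulrC /A indicI.
rewrite integralZr//; last first.
  apply/integrableP; split.
    by apply/measurable_EFinP; exact: measurable_indic.
  under eq_integral do rewrite /= ger0_norm ?indic_ge0//.
  by rewrite integral_indic// setIT.
by rewrite integral_indic// setIT fineM// ge0_fin_numE.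
Qed.

(** The factor [eta] may be known only at time [s], after the first increment: the product of the
    values of two blocks is of this kind. *)
Lemma incr_orth q r s t K eta : 0 <= q -> q <= r -> r <= s -> s <= t ->
  fmeas s eta -> (forall w, `|eta w| <= K) ->
  ip P (fun w => eta w * incr q r w) (incr s t) = 0.
Proof.
move=> q0 qr rs st me eK; have s0 : 0 <= s by rewrite (le_trans q0)// (le_trans qr).
have [si _ _ _] := incr_moments basis q0 qr.
apply: (expectation_incr0 basis) => //.
  by apply: fmeasM => //; exact: fmeas_incr.
exact: sqi_bounded (fmeas_measurable basis me) eK si.
Qed.

(** Cutting the intervals at [a'] and at the smaller right end [m] leaves the overlap []a', m]],
    where the independence of the increment from [eta] produces [normal_var] times the length. The
    other pairs of pieces are orthogonal, one increment lying in the future of the other and of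
    [eta]. *)
Lemma gen_isometry g g' : gen_wf g -> gen_wf g' ->
  ip P (gen_int g) (gen_int g') =
  normal_var R * ip timeprod (gen_eval g) (gen_eval g').
Proof.
wlog le : g g' / ga g <= ga g'.
  move=> H wg wg'; have /orP[le|le] := le_total (ga g) (ga g'); first exact: H.
  by rewrite ipC H// ipC.
move=> wg wg'; rewrite gen_eval_ip//.
case: wg wg' => a0 ab [K xK] mx [a0' ab' [K' xK'] mx'].
case: g g' le a0 ab xK mx a0' ab' xK' mx' => a b x [a' b' x'] /=.
move=> le a0 ab xK mx a0' ab' xK' mx'; rewrite /gen_int/=.
pose eta w := x w * x' w.
have meta : fmeas a' eta by apply: fmeasM => //; exact: fmeas_mono mx.
have etaK w : `|eta w| <= K * K' by rewrite normrM ler_pM.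
have [ba'|a'b] := leP b a'.
  rewrite (_ : _ `&` _ = set0) ?measure0 ?mul0r ?mulr0; last first.
    apply/seteqP; split => // s [] /=; rewrite !in_itv/= => /andP[_ sb] /andP[a's _].
    by have := lt_le_trans a's (le_trans sb ba'); rewrite ltxx.
  rewrite -(@incr_orth a b a' b' (K * K') eta)// /ip.
  by apply: eq_Rintegral => w _; rewrite /eta; ring.
pose m := Num.min b b'.
have a'm : a' <= m by rewrite le_min ab' ltW.
have mb : m <= b by rewrite ge_min lexx.
have mb' : m <= b' by rewrite ge_min lexx orbT.
have leb : fine (lebesgue_measure (`]a, b]%classic `&` `]a', b']%classic : set Rm))
    = m - a'.
  rewrite (_ : _ `&` _ = `]a', m]%classic).
    rewrite lebesgue_measure_itv/= lte_fin.
    by case: ltgtP a'm => //= ->; rewrite subrr.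
  apply/seteqP; split => s /=; rewrite !in_itv/= ?le_min.
    by move=> [/andP[_ ->] /andP[-> ->]].
  by move=> /and3P[a's -> ->]; rewrite a's (le_lt_trans le).
rewrite leb; have m0 : 0 <= m by exact: le_trans a'm.
have [s1 _ _ _] := incr_moments basis a0 le.
have [s2 _ _ _] := incr_moments basis a0' a'm.
have [s3 _ _ _] := incr_moments basis m0 mb.
have [s4 _ _ _] := incr_moments basis m0 mb'.
have [s5 _ _ _] := incr_moments basis a0' ab'.
have meta' := fmeas_measurable basis meta.
have e1 := sqi_bounded meta' etaK s1.
have e2 := sqi_bounded meta' etaK s2.
have e3 := sqi_bounded meta' etaK s3.
have -> : ip P (fun w => x w * incr a b w) (fun w => x' w * incr a' b' w) =
    ip P (fun w => (eta w * incr a a' w + eta w * incr a' m w)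
                   + eta w * incr m b w) (incr a' b').
  by rewrite /ip; apply: eq_Rintegral => w _; rewrite /eta /increment; ring.
rewrite ipDl//; last exact: sqiD.
rewrite ipDl// (@incr_orth a a' a' b' (K * K'))// add0r.
(* At most one interval extends beyond [m]. Unless it is the first, this increment vanishes; if it
   is the first, the increment lies after []a', b']]. *)
have -> : ip P (fun w => eta w * incr m b w) (incr a' b') = 0.
  have [bb'|b'b] := leP b b'.
    have mE : m = b by rewrite /m min_l.
    rewrite /ip mE /Rintegral integral0_eq// => w _.
    by rewrite /increment subrr mulr0 mul0r.
  have mE : m = b' by rewrite /m min_r// ltW.
  rewrite -(@incr_orth a' b' m b (K * K') eta) -?mE// /ip.
  - by apply: eq_Rintegral => w _; ring.
  - exact: fmeas_mono meta.
rewrite addr0.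
have -> : incr a' b' = fun w => incr a' m w + incr m b' w.
  by apply/funext => w; rewrite /increment; ring.
rewrite ipDr// (@incr_orth a' m m b' (K * K'))//; last exact: fmeas_mono meta.
rewrite addr0.
have -> : ip P (fun w => eta w * incr a' m w) (incr a' m) =
    \int[P]_w (eta w * incr a' m w ^+ 2).
  by rewrite /ip; apply: eq_Rintegral => w _; rewrite -mulrA expr2.
by rewrite (expectation_incr_sqr basis a0' a'm meta etaK) mulrA.
Qed.

Definition gens_int (s : seq gen) (w : Om) : R := \sum_(g <- s) gen_int g w.

Definition gens_eval (s : seq gen) (p : Rm * Om) : R := \sum_(g <- s) gen_eval g p.

Fixpoint gens_wf (s : seq gen) : Prop :=
  if s is g :: s' then gen_wf g /\ gens_wf s' else True.

Lemma gens_int_cons g s :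
  gens_int (g :: s) = (fun w => gen_int g w + gens_int s w).
Proof. by apply/funext => w; rewrite /gens_int big_cons. Qed.

Lemma gens_eval_cons g s :
  gens_eval (g :: s) = (fun w => gen_eval g w + gens_eval s w).
Proof. by apply/funext => w; rewrite /gens_eval big_cons. Qed.

Lemma gens_int_nil : gens_int [::] = cst 0.
Proof. by apply/funext => w; rewrite /gens_int big_nil. Qed.

Lemma gens_eval_nil : gens_eval [::] = cst 0.
Proof. by apply/funext => w; rewrite /gens_eval big_nil. Qed.

Lemma gens_int_sqi s : gens_wf s -> sqi P (gens_int s).
Proof.
elim: s => [_|g s IH [wg ws]]; first by rewrite gens_int_nil; exact: sqi0.
by rewrite gens_int_cons; apply: sqiD; [exact: gen_int_sqi|exact: IH].
Qed.

Lemma gens_eval_sqi s : gens_wf s -> sqi timeprod (gens_eval s).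
Proof.
elim: s => [_|g s IH [wg ws]]; first by rewrite gens_eval_nil; exact: sqi0.
by rewrite gens_eval_cons; apply: sqiD; [exact: gen_eval_sqi|exact: IH].
Qed.

Lemma ip0l d1 (T : measurableType d1) (mu : {measure set T -> \bar R}) f :
  ip mu (cst 0) f = 0.
Proof. by rewrite /ip /Rintegral integral0_eq// => x _; rewrite mul0r. Qed.

Lemma gens_isometry s s' : gens_wf s -> gens_wf s' ->
  ip P (gens_int s) (gens_int s') =
  normal_var R * ip timeprod (gens_eval s) (gens_eval s').
Proof.
elim: s => [_ _|g s IH [wg ws] ws'].
  by rewrite gens_int_nil gens_eval_nil !ip0l mulr0.
have := gens_int_sqi ws; have := gens_int_sqi ws'.
have := gens_eval_sqi ws; have := gens_eval_sqi ws' => *.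
have := gen_int_sqi wg; have := gen_eval_sqi wg => *.
rewrite gens_int_cons gens_eval_cons !ipDl// IH// mulrDr; congr (_ + _).
clear -basis wg ws'; elim: s' ws' => [_|g' s' IH [wg' ws'']].
  by rewrite gens_int_nil gens_eval_nil [LHS]ipC [X in _ * X]ipC !ip0l mulr0.
have := gens_int_sqi ws''; have := gens_eval_sqi ws'' => *.
have := gen_int_sqi wg'; have := gen_eval_sqi wg' => *.
have := gen_int_sqi wg; have := gen_eval_sqi wg => *.
by rewrite gens_int_cons gens_eval_cons !ipDr// IH// mulrDr gen_isometry.
Qed.

Lemma gens_bounded s : gens_wf s -> exists K, forall p, `|gens_eval s p| <= K.
Proof.
elim: s => [_|g s IH [[_ _ [K gK] _] /IH[K' sK']]].
  by exists 0 => p; rewrite gens_eval_nil normr0.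
exists (K + K') => p; rewrite gens_eval_cons (le_trans (ler_normD _ _))//.
rewrite lerD// /gen_eval normrM indicE; case: (_ \in _) => /=.
  by rewrite normr1 mulr1.
by rewrite normr0 mulr0 (le_trans _ (gK p.2)).
Qed.

Lemma gens_wf_cat s s' : gens_wf s -> gens_wf s' -> gens_wf (s ++ s').
Proof. by elim: s => //= g s IH [? ?] ?; split => //; exact: IH. Qed.

Definition gen_scale (a : R) (g : gen) : gen :=
  Gen (ga g) (gb g) (fun w => a * gx g w).

Lemma gens_wf_scale a s : gens_wf s -> gens_wf (map (gen_scale a) s).
Proof.
elim: s => //= g s IH [[? ? [K gK] mg] ?]; split; last exact: IH.
split => //.
  by exists (`|a| * K) => w; rewrite /= normrM ler_wpM2l.
by apply: fmeasM => //; exact: fmeas_cst.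
Qed.

Lemma gens_int_add a s s' :
  gens_int (s ++ map (gen_scale a) s') =
  (fun w => gens_int s w + a * gens_int s' w).
Proof.
apply/funext => w; rewrite /gens_int big_cat big_map mulr_sumr; congr (_ + _).
by apply: eq_bigr => g _; rewrite /gen_int /= mulrA.
Qed.

End generators.

(** * Ito integrals *)

Section convergence.
Context (R : realType).

Lemma cvge0_lt (u : nat -> \bar R) e : 0 < e -> u @ \oo --> 0%E ->
  \forall n \near \oo, (u n < e%:E)%E.
Proof.
move=> e0 /(_ [set x | (x < e%:E)%E]); apply.
apply: open_nbhs_nbhs; split; last by rewrite /= lte_fin.
exact: open_ereal_lt_ereal.
Qed.

Lemma le_of_linear_error (x y A : R) : 0 <= A ->
  (forall e, 0 < e -> x <= y + A * e) -> x <= y.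
Proof.
move=> A0 H; apply/ler_addgt0Pr => e e0.
have A1 : 0 < A + 1 by rewrite ltr_wpDl.
apply: (le_trans (H (e / (A + 1)) _)); first by rewrite divr_gt0.
by rewrite lerD2l mulrCA ler_piMr ?(ltW e0)// ler_pdivrMr// mul1r lerDl.
Qed.

End convergence.

Section ito.
Context (R : realType) (d : measure_display) (Om : measurableType d)
  (P : probability Om R) (W : R -> {RV P >-> R}) (Fs : set (set Om)) (T : R).
Hypothesis basis : stochastic_basis Fs W.
Local Notation F := (filtration Fs W).
Local Notation Rm := (measurableTypeR R).
Local Notation Lam := (timeprod P).

(** Extension by zero to the whole product, so that integrands on different time intervals are
    compared in the single space L2([timeprod P]). *)
Definition time_cut (t : R) (H : R -> Om -> R) : Rm * Om -> R :=
  (fun p => H p.1 p.2) \_ (`[0, t]%classic `*` setT).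

Lemma time_cutE t H s w : time_cut t H (s, w) = if 0 <= s <= t then H s w else 0.
Proof.
rewrite /time_cut patchE; case: ifPn => [|/negP]; rewrite inE/= in_itv/=.
  by move=> [-> _].
by case: ifP => // st []; split.
Qed.

(* The product of [R] and [Om] in [jointly_measurable] and that of [timeprod]
   have the same measurable sets but different displays. *)
Lemma measurable_cut t H : t <= T -> jointly_measurable T H ->
  measurable_fun setT (time_cut t H).
Proof.
move=> tT mH.
have mD : measurable (`[0, t]%classic `*` setT : set (Rm * Om)).
  exact: measurableX.
have mDT : measurable (`[0, T]%classic `*` setT : set (Rm * Om)).
  exact: measurableX.
have mH' : measurable_fun (`[0, T]%classic `*` setT : set (Rm * Om))
    (fun p : Rm * Om => H p.1 p.2) by exact: mH.
have sub : (`[0, t]%classic `*` setT : set (Rm * Om)) `<=` `[0, T]%classic `*` setT.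
  by move=> [s w] /=; rewrite !in_itv/= => -[/andP[-> /le_trans->]].
exact: (measurable_restrictT _ mD).1 (measurable_funS mDT sub mH').
Qed.

Lemma integral_cut (t : R) (H : R -> Om -> R) : measurable_fun setT (time_cut t H) ->
  (\int[Lam]_p ((time_cut t H p) ^+ 2)%:E =
   \int[P]_w \int[lebesgue_measure]_(s in `[0%R, t]) ((H s w) ^+ 2)%:E)%E.
Proof.
move=> mc.
have mc2 : measurable_fun setT (fun p => ((time_cut t H p) ^+ 2)%:E).
  by apply/measurable_EFinP; exact: measurable_funX.
have c0 p : (0 <= ((time_cut t H p) ^+ 2)%:E)%E by rewrite lee_fin sqr_ge0.
rewrite [LHS](fubini_tonelli2 _ mc2 c0).
rewrite /fubini_G; apply: eq_integral => w _; rewrite [RHS]integral_mkcond/=.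
apply: eq_integral => s _; rewrite time_cutE patchE.
rewrite (_ : (s \in _) = (0 <= s <= t)); last first.
  by apply/idP/idP; rewrite inE/= in_itv.
by case: ifP => //; rewrite expr0n.
Qed.

Lemma cut_sqi (t : R) (H : R -> Om -> R) : measurable_fun setT (time_cut t H) ->
  (\int[P]_w \int[lebesgue_measure]_(s in `[0%R, t]) ((H s w) ^+ 2)%:E < +oo)%E ->
  sqi Lam (time_cut t H).
Proof. by move=> mc fin; split; [|rewrite integral_cut]. Qed.

Lemma le_integral_cut (t : R) (H : R -> Om -> R) : t <= T ->
  measurable_fun setT (time_cut t H) -> measurable_fun setT (time_cut T H) ->
  (\int[Lam]_p ((time_cut t H p) ^+ 2)%:E <= \int[Lam]_p ((time_cut T H p) ^+ 2)%:E)%E.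
Proof.
move=> tT mt mT; apply: ge0_le_integral.
- exact: measurableT.
- by move=> p _; rewrite lee_fin sqr_ge0.
- by apply/measurable_EFinP; exact: measurable_funX.
- by apply/measurable_EFinP; exact: measurable_funX.
move=> [s w] _; rewrite !time_cutE lee_fin; case: ifPn => [/andP[-> st]|_].
  by rewrite (le_trans st tT).
by case: ifPn => _; rewrite expr0n/= ?sqr_ge0.
Qed.

(** A block starting at [t] or later collapses to []t, t]]; its value is replaced by 0 because it is
    in general not measurable at the new starting time [t]. *)
Definition stop (S : simple_process P) (t : R) : seq (gen R Om) :=
  [seq Gen (Num.min (sp_time S i) t) (Num.min (sp_time S i.+1) t)
     (if sp_time S i < t then sp_value S i else cst 0) | i <- iota 0 (sp_size S)].


Lemma simple_time_le (S : simple_process P) i j : simple_wf F T S -> (i <= j)%N -> (j <= sp_size S)%N ->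
  sp_time S i <= sp_time S j.
Proof.
move=> [_ mono _ _] ij jS; rewrite -(subnK ij); move: ij jS.
rewrite leq_eqVlt => /predU1P[->|]; first by rewrite subnn.
move=> ij jS; have : (j - i + i <= sp_size S)%N by rewrite subnK// ltnW.
elim: (j - i)%N => [//|k IH]; rewrite addSn => kS.
by rewrite (le_trans (IH (ltnW kS)))// mono.
Qed.

Lemma stop_int S t : simple_wf F T S ->
  gens_int W (stop S t) = simple_integral W S t.
Proof.
move=> wf; apply/funext => w; rewrite /gens_int /stop big_map /simple_integral.
rewrite -(big_mkord xpredT (fun i => sp_value S i w *
  (W (Num.min (sp_time S i.+1) t) w - W (Num.min (sp_time S i) t) w))).
rewrite /index_iota subn0 !big_seq; apply: eq_bigr => i; rewrite mem_iota add0n => /andP[_ iS].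
rewrite /gen_int/= /increment; case: ifPn => //; rewrite -leNgt => ts /=.
rewrite mul0r !min_r ?subrr ?mulr0// (le_trans ts)//.
by apply: simple_time_le wf _ _.
Qed.

Lemma stop_eval S t s w : simple_wf F T S ->
  gens_eval (stop S t) (s, w) = time_cut t (simple_eval S) (s, w).
Proof.
move=> wf; rewrite time_cutE /gens_eval /stop big_map /simple_eval.
rewrite -(big_mkord xpredT (fun i => sp_value S i w *
  \1_(`]sp_time S i, sp_time S i.+1]) s)).
rewrite /index_iota subn0 !big_seq.
have t0 i : (i < sp_size S)%N -> 0 <= sp_time S i.
  move=> iS; case: (wf) => -[h _] _ _ _; apply: (le_trans h).
  by apply: simple_time_le wf _ (ltnW iS).
transitivity (\sum_(i <- iota 0 (sp_size S) | i \in iota 0 (sp_size S))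
    if 0 <= s <= t then sp_value S i w * \1_(`]sp_time S i, sp_time S i.+1]) s else 0);
  last by case: ifP => // _; rewrite big1.
apply: eq_bigr => i; rewrite mem_iota add0n => /andP[_ iS].
rewrite /gen_eval/= !indicE !mem_setE !in_itv/=.
have [ist|tis] := ltP (sp_time S i) t.
  rewrite le_min.
  have [sis|iss] := ltP (sp_time S i) s; last first.
    by rewrite /= mulr0; case: ifP.
  rewrite (le_trans (t0 _ iS) (ltW sis))/=.
  by case: (s <= t); rewrite ?andbF ?andbT ?mulr0.
rewrite /= mul0r; case: ifPn => // /andP[_ st].
by rewrite ltNge (le_trans st tis) /= mulr0.
Qed.

Lemma stop_wf S t : simple_wf F T S -> 0 <= t -> gens_wf W Fs (stop S t).
Proof.
move=> wf t0; rewrite /stop.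
suff : forall s, (forall i, i \in s -> (i < sp_size S)%N) -> gens_wf W Fs
   [seq Gen (Num.min (sp_time S i) t) (Num.min (sp_time S i.+1) t)
     (if sp_time S i < t then sp_value S i else cst 0 : Om -> R) | i <- s].
  by apply => i; rewrite mem_iota add0n => /andP[].
elim=> [//|i s IH] is_lt; split; last by apply: IH => j js; apply: is_lt; rewrite inE js orbT.
have iS : (i < sp_size S)%N by apply: is_lt; rewrite inE eqxx.
case: (wf) => -[h0 hT] mono bdd adp.
have ti0 : 0 <= sp_time S i.
  by apply: (le_trans h0); apply: simple_time_le wf _ (ltnW iS).
split => /=.
- by rewrite le_min ti0.
- by rewrite le_min !ge_min lexx orbT (mono _ iS).
- case: ifP => _; last by exists 0 => w; rewrite normr0.
  exact: bdd.
- case: ifPn => ti; last exact: fmeas_cst.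
  by rewrite min_l ?(ltW ti)// => B mB; exact: adp.
Qed.

(** One index makes both errors of [is_ito_integral] smaller than [e ^+ 2]. Square integrability of
    [M t] is deduced from its finite distance to a simple integral. *)
Lemma ito_approx H M t e : is_ito_integral F W T H M -> 0 <= t <= T -> 0 < e ->
  exists s, [/\ gens_wf W Fs s, sqi Lam (time_cut t H), sqi P (M t),
    nrm P (fun w => gens_int W s w - M t w) <= e &
    nrm Lam (fun p => gens_eval s p - time_cut t H p) <= e].
Proof.
move=> [adH mH fH [S [wfS SH SM]]] /andP[t0 tT] e0.
have tI : t \in `[0, T] by rewrite in_itv/= t0.
have e20 : 0 < e ^+ 2 by rewrite exprn_gt0.
have [n _ /(_ n (leqnn n)) [n1 n2]] :=
  filterI (cvge0_lt e20 SH) (cvge0_lt e20 (SM t tI)).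
have mt := measurable_cut tT mH; have mT := measurable_cut (lexx T) mH.
have sH : sqi Lam (time_cut t H).
  apply: (cut_sqi mt); apply: le_lt_trans fH.
  by rewrite -(integral_cut mt) -(integral_cut mT); exact: le_integral_cut.
have ws := stop_wf (wfS n) t0.
have sI := gens_int_sqi basis ws; have sE := gens_eval_sqi basis ws.
have dI : sqi P (fun w => gens_int W (stop (S n) t) w - M t w).
  split; first by apply: measurable_funB; [case: sI|exact: measurable_funP].
  rewrite stop_int//; exact: lt_trans n2 (ltry _).
have sM : sqi P (M t).
  rewrite (_ : (M t : Om -> R) = fun w => gens_int W (stop (S n) t) w -
    (gens_int W (stop (S n) t) w - M t w)); first exact: sqiB.
  by apply/funext => w; ring.
exists (stop (S n) t); split => //.
  rewrite -ler_sqr ?nnegrE ?nrm_ge0 ?(ltW e0)// nrm_sqr -lee_fin -ipE//.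
  by rewrite stop_int// ltW.
have dE : sqi Lam (fun p => gens_eval (stop (S n) t) p - time_cut t H p) by exact: sqiB.
rewrite -ler_sqr ?nnegrE ?nrm_ge0 ?(ltW e0)// nrm_sqr -lee_fin -ipE//.
(* The error on [[0, t]] is compared with the one on [[0, T]], which is the one that the convergence
   of the integrands controls. *)
apply: le_trans (ltW n1).
pose D s w := simple_eval (S n) s w - H s w.
have mD : jointly_measurable T D.
  apply: measurable_funB; last exact: mH.
  rewrite /simple_eval; apply: measurable_sum => i.
  apply: measurable_funM; first by apply: measurable_funTS; exact: measurableT_comp.
  apply: measurable_funTS; apply: measurableT_comp => //; exact: measurable_indic.
have mDt := measurable_cut tT mD; have mDT := measurable_cut (lexx T) mD.
rewrite -[leRHS]/(\int[P]_w \int[lebesgue_measure]_(t in `[0%R, T]) ((D t w) ^+ 2)%:E)%E.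
rewrite -(integral_cut mDT); apply: le_trans (le_integral_cut tT mDt mDT).
rewrite le_eqVlt; apply/orP; left; apply/eqP; apply: eq_integral => -[s w] _.
by rewrite stop_eval// !time_cutE /D; case: ifP => _; rewrite ?subr0.
Qed.

Lemma normal_var_ge0 : 0 <= normal_var R.
Proof. by apply: Rintegral_ge0 => x _; rewrite sqr_ge0. Qed.

Lemma gens_nrm s : gens_wf W Fs s ->
  nrm P (gens_int W s) = Num.sqrt (normal_var R) * nrm Lam (gens_eval s).
Proof.
by move=> ws; rewrite /nrm (gens_isometry basis)// sqrtrM ?normal_var_ge0.
Qed.

Lemma ito_nrm H M t : is_ito_integral F W T H M -> 0 <= t <= T ->
  [/\ sqi Lam (time_cut t H), sqi P (M t) &
    nrm P (M t) <= Num.sqrt (normal_var R) * nrm Lam (time_cut t H)].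
Proof.
move=> ito tT; have [s0 [_ sH sM _ _]] := ito_approx ito tT ltr01.
split => //; set c := Num.sqrt _; have c0 : 0 <= c by exact: sqrtr_ge0.
apply: (@le_of_linear_error _ _ _ (1 + c)); first by rewrite addr_ge0.
move=> e e0; have [s [ws _ _ h1 h2]] := ito_approx ito tT e0.
have sI := gens_int_sqi basis ws; have sE := gens_eval_sqi basis ws.
have -> : (M t : Om -> R) = fun w => gens_int W s w - (gens_int W s w - M t w).
  by apply/funext => w; ring.
apply: (le_trans (nrmB sI (sqiB sI sM))); rewrite gens_nrm// -/c.
have -> : gens_eval s = fun p => time_cut t H p + (gens_eval s p - time_cut t H p).
  by apply/funext => p; ring.
have := ler_wpM2l c0 (nrmD sH (sqiB sE sH)); have := ler_wpM2l c0 h2.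
move: h1; set a := nrm P _; set b := nrm Lam _; set f := nrm Lam _; set g := nrm Lam _.
by nra.
Qed.

(* An approximate substitute for the martingale representation of [eta]: it
   suffices to project on the space of the integrals of simple processes. *)
Lemma ito_represent eta t k : 0 <= t <= T -> sqi P eta -> 0 < k ->
  exists theta : Rm * Om -> R, [/\ sqi Lam theta,
    exists K, forall p, `|theta p| <= K,
    nrm Lam theta <= 2 * Num.sqrt (normal_var R) * nrm P eta &
    forall H M, is_ito_integral F W T H M ->
      `|ip P eta (M t) - ip Lam theta (time_cut t H)| <= k * nrm Lam (time_cut t H)].
Proof.
move=> tT se k0; set c := normal_var R; have c0 : 0 <= c by exact: normal_var_ge0.
pose K := [set f | exists2 s, gens_wf W Fs s & f = gens_int W s].
have K0 : K (cst 0) by exists [::] => //; rewrite gens_int_nil.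
have KD a f g : K f -> K g -> K (fun x => f x + a * g x).
  move=> [s ws ->] [s' ws' ->]; exists (s ++ map (gen_scale a) s').
    by apply: gens_wf_cat => //; exact: gens_wf_scale.
  by rewrite gens_int_add.
have Ks f : K f -> sqi P f by move=> [s ws ->]; exact: gens_int_sqi basis _ ws.
(* Chosen so that [q * Num.sqrt c <= k]: orthogonality up to [q] is relative to the norm of a simple
   integral, which is [Num.sqrt c] times the norm of its integrand. *)
pose q := k / (Num.sqrt c + 1).
have sc0 : 0 <= Num.sqrt c by exact: sqrtr_ge0.
have sc1 : 0 < Num.sqrt c + 1 by rewrite ltr_wpDl.
have q0 : 0 < q by rewrite divr_gt0.
have [_ [[s ws ->] ne orth]] := near_projection K0 KD Ks se q0.
have sI := gens_int_sqi basis ws; have sE := gens_eval_sqi basis ws.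
(* The factor [c] comes from the isometry: pairing two simple integrals in L2(P) is [c] times
   pairing their integrands. *)
exists (fun p => c * gens_eval s p); split.
- exact: sqiZ.
- have [K' sK'] := gens_bounded ws; exists (c * K') => p.
  by rewrite normrM (ger0_norm c0) ler_wpM2l.
- rewrite nrmZ// (ger0_norm c0).
  have -> : c * nrm Lam (gens_eval s) = Num.sqrt c * nrm P (gens_int W s).
    by rewrite gens_nrm// mulrA -expr2 sqr_sqrtr.
  by rewrite mulrAC [leRHS]mulrC ler_wpM2l.
move=> H M ito; have [_ [_ sH sM _ _]] := ito_approx ito tT ltr01.
apply: (@le_of_linear_error _ _ _ (nrm P eta + k + c * nrm Lam (gens_eval s))).
  by rewrite !addr_ge0 ?mulr_ge0 ?nrm_ge0// ltW.
move=> e e0; have [h [wh _ _ h1 h2]] := ito_approx ito tT e0.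
have sIh := gens_int_sqi basis wh; have sEh := gens_eval_sqi basis wh.
have := orth (gens_int W h); rewrite gens_nrm// => /(_ (ex_intro2 _ _ _ wh erefl)) o1.
have e1 := cauchy_schwarz se (sqiB sIh sM).
have e2 := cauchy_schwarz sE (sqiB sEh sH).
rewrite ipBr// in e1; rewrite ipBr// in e2; rewrite ipBl// (gens_isometry basis)// -/c in o1.
rewrite ipZl//.
have h3 : nrm Lam (gens_eval h) <= nrm Lam (time_cut t H) + e.
  have -> : gens_eval h = fun p => time_cut t H p + (gens_eval h p - time_cut t H p).
    by apply/funext => p; ring.
  by apply: (le_trans (nrmD sH (sqiB sEh sH))); rewrite lerD2l.
have o2 : q * (Num.sqrt c * nrm Lam (gens_eval h)) <= k * (nrm Lam (time_cut t H) + e).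
  rewrite mulrA ler_pM ?mulr_ge0 ?nrm_ge0 ?(ltW q0)//.
    exact: ltW.
  by rewrite /q mulrAC ler_pdivrMr// ler_wpM2l ?(ltW k0)// lerDl.
have e1' := le_trans e1 (ler_wpM2l (nrm_ge0 P eta) h1).
have e2' := ler_wpM2l c0 (le_trans e2 (ler_wpM2l (nrm_ge0 Lam (gens_eval s)) h2)).
have o1' := le_trans o1 o2.
have -> : ip P eta (M t) - c * ip Lam (gens_eval s) (time_cut t H) =
  - (ip P eta (gens_int W h) - ip P eta (M t)) +
  (ip P eta (gens_int W h) - c * ip Lam (gens_eval s) (gens_eval h)) +
  c * (ip Lam (gens_eval s) (gens_eval h) - ip Lam (gens_eval s) (time_cut t H)) by ring.
apply: (le_trans (ler_normD _ _)).
rewrite [`|c * _|]normrM (ger0_norm c0).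
have := ler_normD (- (ip P eta (gens_int W h) - ip P eta (M t)))
  (ip P eta (gens_int W h) - c * ip Lam (gens_eval s) (gens_eval h)).
rewrite normrN; lra.
Qed.

End ito.

(** * Linearized coefficients *)

Section measurability.
Context (R : realType).

(** [phi] is replaced by representatives of cells of length [1 / n.+1]; each approximation is
    measurable as a countable union over cells, and continuity in the parameter gives the limit.
    Continuity is asked at [phi w] and within [S] only, since controls live in an arbitrary set
    [U]. *)
Lemma measurable_caratheodory dT (T : measurableType dT) (S : set R)
    (phi : T -> R) (G : R -> T -> R) :
  measurable_fun setT phi -> (forall w, S (phi w)) ->
  (forall y, S y -> measurable_fun setT (G y)) ->
  (forall w e, 0 < e -> exists2 r, 0 < r &
     forall y, S y -> `|y - phi w| < r -> `|G y w - G (phi w) w| < e) ->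
  measurable_fun setT (fun w => G (phi w) w).
Proof.
move=> mphi Sphi mG cG.
pose cell (n : nat) (w : T) : int := Num.floor (n.+1%:R * phi w).
(* A point of [S] in each cell, as [G] is controlled only there; the default 0 occurs only for cells
   that miss [S], which [phi] never enters. *)
pose rep (n : nat) (m : int) : R :=
  xget 0 [set y | S y /\ Num.floor (n.+1%:R * y) = m].
have repP n w : S (rep n (cell n w)) /\
    Num.floor (n.+1%:R * rep n (cell n w)) = cell n w.
  by apply: (@xgetPex _ 0 [set y | S y /\ _]); exists (phi w).
pose h n w := G (rep n (cell n w)) w.
have mcell n m : measurable [set w | cell n w = m].
  have -> : [set w | cell n w = m] =
      (fun w => n.+1%:R * phi w) @^-1` `[m%:~R, (m + 1)%:~R[.
    apply/seteqP; split => w /=; rewrite in_itv/=.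
      by move=> <-; exact: floor_itv.
    by move=> H; exact: floor_def.
  rewrite -[X in measurable X]setTI.
  have mm : measurable_fun setT (fun w => n.+1%:R * phi w).
    exact: measurable_funM.
  exact: mm.
have mh n : measurable_fun setT (h n).
  move=> _ B mB; rewrite setTI.
  have -> : h n @^-1` B = \bigcup_(m : int)
      ([set w | cell n w = m] `&` G (rep n m) @^-1` B).
    apply/seteqP; split => [w /= hB|w [m _ [/= <-]]//].
    by exists (cell n w).
  apply: countable_bigcupT_measurable => // m.
  have [[w0 w0m]|no] := pselect (exists w, cell n w = m).
    apply: measurableI => //; rewrite -[X in measurable X]setTI.
    by apply: mG => //; rewrite -w0m; exact: (repP n w0).1.
  rewrite (_ : _ `&` _ = set0)//; apply/seteqP; split => // w [/= wm _].
  by apply: no; exists w.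
apply: (measurable_fun_cvg mh) => w _; apply/cvgrPdist_lt => e e0.
have [r r0 Gr] := cG w e e0.
exists (Num.truncn r^-1) => // n /= nr.
rewrite distrC; apply: Gr; first exact: (repP n w).1.
have n1 : r^-1 < n.+1%:R.
  apply: (lt_le_trans (truncnS_gt r^-1)); first by rewrite ler_nat ltnS.
have n0 : 0 < n.+1%:R :> R by rewrite ltr0n.
have rn : n.+1%:R^-1 < r by rewrite -[r]invrK ltf_pV2 ?posrE ?invr_gt0.
apply: lt_trans rn; rewrite -(ltr_pM2l n0) mulfV ?gt_eqF//.
rewrite -{1}(ger0_norm (ltW n0)) -normrM mulrBr.
have := floor_itv (n.+1%:R * phi w); have := floor_itv (n.+1%:R * rep n (cell n w)).
rewrite (repP n w).2 /cell intrD => /andP[a1 a2] /andP[b1 b2].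
by rewrite ltr_norml; apply/andP; split; lra.
Qed.

Definition locally_near (f : R -> R) (y : R) : Prop :=
  forall e, 0 < e -> exists2 r, 0 < r &
    forall y', `|y' - y| < r -> `|f y' - f y| < e.

Lemma continuous_near (f : R * R -> R) (a b : R) : {for (a, b), continuous f} ->
  locally_near (fun y => f (a, y)) b /\ locally_near (fun x => f (x, b)) a.
Proof.
move=> /cvgrPdist_lt cf; split=> e e0; have /nbhs_ballP[r /= r0 H] := cf e e0;
  exists r => // y' y'r; rewrite distrC; apply: H; split => //=.
- exact: ballxx.
- by rewrite /ball/= distrC.
- by rewrite /ball/= distrC.
- exact: ballxx.
Qed.

Lemma lipschitz_near (y K e : R) : 0 < e ->
  exists2 r, 0 < r & forall y', `|y' - y| < r ->
    K * `|y' - y| < e.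
Proof.
move=> e0; have K1 : 0 < `|K| + 1 by rewrite ltr_wpDl.
exists (e / (`|K| + 1)) => [|y' y'r]; first by rewrite divr_gt0.
apply: (@le_lt_trans _ _ ((`|K| + 1) * `|y' - y|)).
  by rewrite ler_wpM2r// (le_trans (ler_norm K))// lerDl.
by rewrite mulrC -ltr_pdivlMr.
Qed.

(** The integral of a nonnegative function is a supremum over simple functions below it, so
    monotonicity holds without measurability; this handles suprema over uncountably many times. *)
Lemma ge0_le_integralT d (T : measurableType d) (mu : {measure set T -> \bar R})
    (f g : T -> \bar R) : (forall x, 0 <= f x)%E -> (forall x, f x <= g x)%E ->
  (\int[mu]_x f x <= \int[mu]_x g x)%E.
Proof.
move=> f0 fg; have g0 x : (0 <= g x)%E by exact: le_trans (f0 x) (fg x).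
rewrite !ge0_integralTE//; apply: ereal_sup_le => _ [h hf <-]; exists h => // x.
exact: le_trans (hf x) (fg x).
Qed.

Lemma sup_moment d (Om : measurableType d) (P : probability Om R)
    (X : R -> {RV P >-> R}) (D : set R) :
  (\int[P]_w ereal_sup [set ((X t w) ^+ 2)%:E | t in D] < +oo)%E ->
  exists2 K, 0 <= K & forall s, D s -> sqi P (X s) /\ ip P (X s) (X s) <= K.
Proof.
have [[s0 Ds0]|D0] := pselect (exists s, D s); last first.
  by move=> _; exists 0 => // s Ds; exfalso; apply: D0; exists s.
set I := (\int[P]_w _)%E => Ifin.
have le s : D s -> (\int[P]_w ((X s w) ^+ 2)%:E <= I)%E.
  move=> Ds; apply: ge0_le_integralT => w; first by rewrite lee_fin sqr_ge0.
  by apply: ereal_sup_ubound; exists s.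
have I0 : (0 <= I)%E.
  apply: le_trans (le _ Ds0); apply: integral_ge0 => w _.
  by rewrite lee_fin sqr_ge0.
have IE : I = (fine I)%:E by rewrite fineK// ge0_fin_numE.
exists (fine I); first by rewrite fine_ge0.
move=> s Ds; have sX : sqi P (X s).
  by split; [exact: measurable_funP|exact: le_lt_trans (le s Ds) Ifin].
by split => //; rewrite -lee_fin -ipE// -IE; exact: le.
Qed.

(** The diagonal coupling has zero cost. This removes the Wasserstein term from the Lipschitz
    condition at a frozen law. *)
Lemma W2_refl (nu : probability R R) : W2 nu nu = 0.
Proof.
have mdiag : measurable_fun setT (fun a : R => (a, a)).
  exact: measurable_fun_pair.
pose dg : {mfun R >-> (R * R)%type} := MeasurableFun.Pack
  (MeasurableFun.Class (isMeasurableFun.Build _ _ _ _ _ mdiag)).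
rewrite /W2; set I := ereal_inf _.
have I0 : (0 <= I)%E.
  apply: le_ereal_inf_tmp => _ [pi _ <-]; apply: integral_ge0 => z _.
  by rewrite lee_fin /sqn /dot/= -expr2 sqr_ge0.
suff -> : I = 0%E by rewrite sqrtr0.
apply/eqP; rewrite eq_le I0 andbT; apply: ereal_inf_lbound.
exists (distribution nu dg).
  move=> A mA; split; rewrite /distribution /pushforward; congr (nu _);
    apply/seteqP; split => x //=; by [case|split].
rewrite ge0_integral_distribution//.
- by rewrite integral0_eq// => x _; rewrite /= subrr /sqn /dot/= mulr0.
- apply/measurable_EFinP; rewrite /sqn /dot/=; apply: measurable_funM;
    exact: measurable_funB.
- by move=> z; rewrite lee_fin /sqn /dot/= -expr2 sqr_ge0.
Qed.

End measurability.

Section linearized_coefficients.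
Context (R : realType) (d : measure_display) (Om : measurableType d)
  (P : probability Om R).
Variables (F : R -> set (set Om)) (T l : R) (U : set R).
Variables (X u v : R -> {RV P >-> R}).
Hypotheses (l0 : 0 < l) (T0 : 0 < T).
Hypothesis SX : S2_process F T (- l) X.
Hypotheses (adu : admissible F T U u) (adv : admissible F T U v).

Local Notation coef := (R -> R * R -> probability R R -> R -> R).
Local Notation law := (distribution P).

Definition kernel_nu (dpsi : R -> R * R -> probability R R -> R -> R -> R)
    (s : R) (p : Om * Om) : R :=
  dpsi s (X s p.1, X (s - l) p.1) (law (X s)) (u s p.1) (X s p.2).

(** All that the later estimates use of the coefficients. Measurability is stated at a fixed time;
    joint measurability of the whole right-hand side comes with the variational equation. *)
Definition linear_bounds (K : R) (psi : coef)
    (dpsi : R -> R * R -> probability R R -> R -> R -> R) : Prop :=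
  forall s, 0 <= s <= T ->
  [/\ measurable_fun setT (d_x l X u psi s) /\
        (forall w, `|d_x l X u psi s w| <= K),
      measurable_fun setT (d_x' l X u psi s) /\
        (forall w, `|d_x' l X u psi s w| <= K),
      measurable_fun setT (kernel_nu dpsi s) /\
        (forall p, `|kernel_nu dpsi s p| <= K) &
      sqi P (Delta l X u v psi s) /\ nrm P (Delta l X u v psi s) <= K].

Lemma law_P2 s : - l <= s <= T -> L2 (X s) /\ P2 (law (X s)).
Proof.
move=> sT; have [K _ /(_ s)] := sup_moment (let: And3 _ _ h := SX in h).
rewrite /= in_itv/= => /(_ sT)[[mX fX] _].
have LX : L2 (X s).
  by apply: le_lt_trans fX; apply: ge0_le_integralT => w;
    rewrite ?lee_fin /sqn /dot/= -expr2 ?sqr_ge0.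
split => //; rewrite /P2 ge0_integral_distribution//.
- apply/measurable_EFinP; rewrite /sqn /dot/=.
  exact: measurable_funM.
- by move=> z; rewrite lee_fin /sqn /dot/= -expr2 sqr_ge0.
Qed.

Lemma admissible_moment (q : R -> {RV P >-> R}) : admissible F T U q ->
  exists2 K, 0 <= K & forall s, 0 <= s <= T -> sqi P (q s) /\ ip P (q s) (q s) <= K.
Proof.
move=> [_ _ _ /(_ 2)]; rewrite ler1n => /(_ isT) H.
have [|K K0 HK] := @sup_moment R d Om P q `[0, T]%classic.
  apply: le_lt_trans H; apply: ge0_le_integralT => w; last first.
    apply: ereal_sup_le => _ [s sT <-]; exists s => //.
    by rewrite powR_mulrn// real_normK ?num_real.
  apply: (@le_trans _ _ ((q 0 w) ^+ 2)%:E); first by rewrite lee_fin sqr_ge0.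
  by apply: ereal_sup_ubound; exists 0 => //=; rewrite in_itv/= lexx ltW.
by exists K => // s sT; apply: HK; rewrite /= in_itv.
Qed.

(** Three uses of [measurable_caratheodory], the control innermost: the Lipschitz condition on [U]
    handles the control, and continuity in each space variable separately handles the others. *)
Lemma measurable_coef3 dT (T' : measurableType dT) (K : R) (g : R -> R -> R -> R)
    (x y q : T' -> R) :
  measurable_fun setT x -> measurable_fun setT y -> measurable_fun setT q ->
  (forall w, U (q w)) ->
  (forall a b c c', U c -> U c' -> `|g a b c - g a b c'| <= K * `|c - c'|) ->
  (forall a b c, U c -> locally_near (g a ^~ c) b) ->
  (forall a b c, U c -> locally_near (fun a => g a b c) a) ->
  measurable_fun setT (fun w => g (x w) (y w) (q w)).
Proof.
move=> mx my mq Uq gc gb ga.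
apply: (@measurable_caratheodory _ _ _ setT x (fun a w => g a (y w) (q w))) => //.
- move=> a _.
  apply: (@measurable_caratheodory _ _ _ setT y (fun b w => g a b (q w))) => //.
  + move=> b _.
    apply: (@measurable_caratheodory _ _ _ U q (fun c _ => g a b c)) => //.
    move=> w e e0; have [r r0 H] := lipschitz_near (q w) K e0.
    exists r => // c Uc cr; apply: le_lt_trans (gc _ _ _ _ Uc (Uq w)) _.
    exact: H.
  + move=> w e e0; have [r r0 H] := gb a (y w) (q w) (Uq w) e e0.
    by exists r => // b' _; exact: H.
- move=> w e e0; have [r r0 H] := ga (x w) (y w) (q w) (Uq w) e e0.
  by exists r => // b' _; exact: H.
Qed.

Lemma linear_boundsP C C' (psi : coef)
    (dpsi : R -> R * R -> probability R R -> R -> R -> R) :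
  (forall t v, t \in `[0, T] -> U v ->
    regular_at P C (fun e nu => psi t e nu v) (fun e nu a => dpsi t e nu v a)) ->
  (forall t, t \in `[0, T] ->
    lip_order2 P U C' (fun v e nu => psi t e nu v)
                     (fun v e nu a => dpsi t e nu v a)) ->
  exists2 K, 0 <= K & linear_bounds K psi dpsi.
Proof.
move=> reg lip.
have [Ku Ku0 Hu] := admissible_moment adu; have [Kv Kv0 Hv] := admissible_moment adv.
(* [C] bounds the derivatives. By the Lipschitz condition in the control, the spike term is at most
   a multiple [C'] of the distance from [v] to [u], which gives the second summand. *)
exists (`|C| + `|C'| * (Num.sqrt Kv + Num.sqrt Ku)).
  by rewrite addr_ge0// mulr_ge0// addr_ge0 ?sqrtr_ge0.
move=> s sT; have sI : s \in `[0, T] by rewrite in_itv.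
have CK : C <= `|C| + `|C'| * (Num.sqrt Kv + Num.sqrt Ku).
  apply: (le_trans (ler_norm C)); rewrite lerDl.
  by rewrite mulr_ge0// addr_ge0 ?sqrtr_ge0.
have UQ (q : R -> {RV P >-> R}) : admissible F T U q -> forall w, U (q s w).
  by move=> [h _ _ _] w; exact: h.
have Uu := UQ _ adu; have Uv := UQ _ adv.
have P2s : P2 (law (X s)).
  apply: (law_P2 _).2; case/andP: sT => s0 ->; rewrite andbT.
  by rewrite (le_trans _ s0)// oppr_le0 ltW.
have reg' q (Uq : U q) := reg s q sI Uq; have lip' := lip s sI.
have n10 : `|(1, 0) : R * R| = 1 by rewrite prod_normE/= normr1 normr0 max_l.
have n01 : `|(0, 1) : R * R| = 1 by rewrite prod_normE/= normr1 normr0 max_r.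
(* Both partial derivatives at once: [(1, 0)] and [(0, 1)] are unit vectors for the sup norm. *)
have dir (h : R * R) : `|h| = 1 ->
    measurable_fun setT (fun w => 'D_h (fun e => psi s e (law (X s)) (u s w))
       (X s w, X (s - l) w)) /\
    (forall w, `|'D_h (fun e => psi s e (law (X s)) (u s w)) (X s w, X (s - l) w)|
       <= C).
  move=> h1; split; last first.
    move=> w; case: (reg' _ (Uu w)) => _ _ /(_ (X s w, X (s - l) w) _ P2s)[/(_ h)+ _] _.
    by rewrite h1 mulr1.
  apply: (@measurable_coef3 _ _ C' (fun a b c =>
    'D_h (fun e => psi s e (law (X s)) c) (a, b))) => //.
  - move=> a b q q' Uq Uq'; case: lip' => _ H _ _ _.
    by apply: H => //; rewrite h1.
  - move=> a b q Uq; case: (reg' _ Uq) => _ /(_ _ P2s)[_ + _] _ _ => cD.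
    exact: (continuous_near (cD h (a, b))).1.
  - move=> a b q Uq; case: (reg' _ Uq) => _ /(_ _ P2s)[_ + _] _ _ => cD.
    exact: (continuous_near (cD h (a, b))).2.
have mpsi (q : {RV P >-> R}) : (forall w, U (q w)) ->
    measurable_fun setT (fun w => psi s (X s w, X (s - l) w) (law (X s)) (q w)).
  move=> Uq.
  apply: (@measurable_coef3 _ _ C' (fun a b c => psi s (a, b) (law (X s)) c)) => //.
  - by move=> a b c c' Uc Uc'; case: lip' => H _ _ _ _; exact: H.
  - move=> a b c Uc; case: (reg' _ Uc) => _ /(_ _ P2s)[+ _ _] _ _ => cD.
    exact: (continuous_near (differentiable_continuous (cD (a, b)))).1.
  - move=> a b c Uc; case: (reg' _ Uc) => _ /(_ _ P2s)[+ _ _] _ _ => cD.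
    exact: (continuous_near (differentiable_continuous (cD (a, b)))).2.
split.
- have [m1 m2] := dir _ n10; split; first exact: m1.
  by move=> w; apply: le_trans CK; exact: m2.
- have [m1 m2] := dir _ n01; split; first exact: m1.
  by move=> w; apply: le_trans CK; exact: m2.
- split; last first.
    move=> p; case: (reg' _ (Uu p.1)) => _ _ /(_ (X s p.1, X (s - l) p.1) _ P2s)[_ /(_ (X s p.2)) H] _.
    exact: le_trans H CK.
  (* The law is the same on both sides, so the derivative in the measure is Lipschitz in the space
     variables alone. *)
  have lipe q e e' a a' : U q -> `|dpsi s e (law (X s)) q a - dpsi s e' (law (X s)) q a'|
      <= C * (`|e - e'| + `|a - a'|).
    move=> Uq; case: (reg' _ Uq) => _ _ _ /(_ e e' _ _ P2s P2s)[_ /(_ a a')].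
    by rewrite W2_refl addr0.
  apply: (@measurable_caratheodory _ _ _ setT (fun p : Om * Om => X s p.2)
    (fun a p => dpsi s (X s p.1, X (s - l) p.1) (law (X s)) (u s p.1) a)) => //.
  + exact: measurableT_comp.
  + move=> a _.
    apply: (@measurable_coef3 _ _ C' (fun x y c => dpsi s (x, y) (law (X s)) c a)
      (fun p : Om * Om => X s p.1) (fun p => X (s - l) p.1) (fun p => u s p.1)).
    * exact: measurableT_comp.
    * exact: measurableT_comp.
    * exact: measurableT_comp.
    * by move=> p.
    * by move=> x y c c' Uc Uc'; case: lip' => _ _ H _ _; exact: H.
    * move=> x y c Uc e e0; have [r r0 H] := lipschitz_near y C e0.
      exists r => // y' y'r; apply: le_lt_trans (lipe _ _ _ _ _ Uc) _.
      rewrite subrr normr0 addr0 prod_normE/= subrr normr0 max_r//.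
      exact: H.
    * move=> x y c Uc e e0; have [r r0 H] := lipschitz_near x C e0.
      exists r => // y' y'r; apply: le_lt_trans (lipe _ _ _ _ _ Uc) _.
      rewrite subrr normr0 addr0 prod_normE/= subrr normr0 max_l//.
      exact: H.
  + move=> p e e0; have [r r0 H] := lipschitz_near (X s p.2) C e0.
    exists r => // y' _ y'r; apply: le_lt_trans (lipe _ _ _ _ _ (Uu p.1)) _.
    by rewrite subrr normr0 add0r; exact: H.
have mD : measurable_fun setT (Delta l X u v psi s).
  by apply: measurable_funB; exact: mpsi.
have [su nu] := Hu s sT; have [sv nv] := Hv s sT.
have Dle w : `|Delta l X u v psi s w| <= `|C'| * `|v s w - u s w|.
  case: lip' => H _ _ _ _.
  apply: le_trans (H (X s w, X (s - l) w) _ P2s _ _ (Uv w) (Uu w)) _.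
  by rewrite ler_wpM2r// ler_norm.
have sd : sqi P (fun w => `|C'| * (v s w - u s w)) by apply: sqiZ; exact: sqiB.
have Dsq w : Delta l X u v psi s w ^+ 2 <= (`|C'| * (v s w - u s w)) ^+ 2.
  rewrite -[leLHS]real_normK ?num_real// -[leRHS]real_normK ?num_real//.
  by rewrite ler_sqr ?nnegrE// normrM normr_id.
have sD : sqi P (Delta l X u v psi s).
  apply: (sqi_le mD sd (sqi0 P)) => w.
  by rewrite expr0n addr0.
split => //.
apply: (@le_trans _ _ (nrm P (fun w => `|C'| * (v s w - u s w)))).
  rewrite -ler_sqr ?nnegrE ?nrm_ge0// !nrm_sqr -lee_fin -!ipE//.
  apply: ge0_le_integralT => w; first by rewrite lee_fin sqr_ge0.
  by rewrite lee_fin.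
rewrite nrmZ; last exact: sqiB.
rewrite normr_id ler_wpDl// ler_wpM2l// (le_trans (nrmB sv su))//.
by rewrite lerD// /nrm ler_sqrt.
Qed.

End linearized_coefficients.

(** * Kernel operators and time slices *)

Section kernel_operator.
Context (R : realType) (d : measure_display) (Om : measurableType d)
  (P : probability Om R).

Definition kernel_op (k : Om * Om -> R) (f : Om -> R) (w : Om) : R :=
  \int[P]_w' (k (w, w') * f w').

Variables (k : Om * Om -> R) (K : R).
Hypotheses (mk : measurable_fun setT k) (K0 : 0 <= K)
  (kK : forall p, `|k p| <= K).

Lemma integral_cst_prob (r : \bar R) : (\int[P]_w cst r w = r)%E.
Proof. by rewrite integral_cst// [X in (_ * X)%E]probability_setT mule1. Qed.

Lemma sqi_snd f : sqi P f -> sqi (P \x P)%E (fun p => f p.2).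
Proof.
move=> [mf fin]; have mf2 : measurable_fun setT (fun p : Om * Om => f p.2).
  exact: measurableT_comp.
split => //.
have m2 : measurable_fun setT (fun p : Om * Om => ((f p.2) ^+ 2)%:E).
  by apply/measurable_EFinP; exact: measurable_funX.
have p0 (p : Om * Om) : (0 <= ((f p.2) ^+ 2)%:E)%E by rewrite lee_fin sqr_ge0.
rewrite (fubini_tonelli1 _ m2 p0).
rewrite [X in (X < _)%E](_ : _ = \int[P]_w ((f w) ^+ 2)%:E)%E//.
by rewrite -[RHS]integral_cst_prob.
Qed.

Lemma sqi_fst f : sqi P f -> sqi (P \x P)%E (fun p => f p.1).
Proof.
move=> [mf fin]; have mf2 : measurable_fun setT (fun p : Om * Om => f p.1).
  exact: measurableT_comp.
split => //.
have m2 : measurable_fun setT (fun p : Om * Om => ((f p.1) ^+ 2)%:E).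
  by apply/measurable_EFinP; exact: measurable_funX.
have p0 (p : Om * Om) : (0 <= ((f p.1) ^+ 2)%:E)%E by rewrite lee_fin sqr_ge0.
rewrite (fubini_tonelli2 _ m2 p0).
rewrite [X in (X < _)%E](_ : _ = \int[P]_w ((f w) ^+ 2)%:E)%E//.
by rewrite -[RHS]integral_cst_prob.
Qed.

Lemma kernel_section w : sqi P (fun w' => k (w, w')).
Proof.
apply: (@sqi_bdd _ _ _ P K) => //.
by apply: measurableT_comp => //; exact: measurable_fun_pair.
Qed.

Lemma nrm_bounded C (f : Om -> R) : measurable_fun setT f -> 0 <= C ->
  (forall w, `|f w| <= C) -> nrm P f <= C.
Proof.
move=> mf C0 fC; have sf := sqi_bdd P mf fC.
rewrite -ler_sqr ?nnegrE ?nrm_ge0// nrm_sqr -lee_fin -ipE//.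
apply: (@le_trans _ _ (\int[P]_w (C ^+ 2)%:E)%E); last first.
  by rewrite integral_cst// [X in (_ * X)%E]probability_setT mule1.
apply: ge0_le_integralT => w; first by rewrite lee_fin sqr_ge0.
by rewrite lee_fin -real_normK ?num_real// ler_sqr ?nnegrE.
Qed.

(** Cauchy-Schwarz on each section bounds the image pointwise by [K * nrm P f]; on a probability
    space this also bounds its norm. *)
Lemma kernel_op_sqi f : sqi P f ->
  sqi P (kernel_op k f) /\ nrm P (kernel_op k f) <= K * nrm P f.
Proof.
move=> sf.
have s2 := sqi_snd sf.
have sk : sqi (P \x P)%E (fun p => k p * f p.2) := sqi_bounded mk kK s2.
(* The factor 1 presents the integrand as a product of two square-integrable functions on the
   product space, so Fubini gives the measurability of the image. *)
have s1 : sqi (P \x P)%E (fun p : Om * Om => 1).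
  by have := sqi_fst (sqi1 P).
have int := sqi_integrableM s1 sk.
have mop : measurable_fun setT (kernel_op k f).
  have := measurable_fubini_F int; rewrite /fubini_F => m.
  have -> : kernel_op k f =
      fun w => fine (\int[P]_w' (1 * (k (w, w') * f w'))%:E)%E.
    by apply/funext => w; rewrite /kernel_op /Rintegral; under eq_integral do rewrite -[_ * _]mul1r.
  exact: measurableT_comp.
have bd w : `|kernel_op k f w| <= K * nrm P f.
  apply: (le_trans (cauchy_schwarz (kernel_section w) sf)).
  rewrite ler_wpM2r ?nrm_ge0//; apply: nrm_bounded => //.
  by case: (kernel_section w).
split; first exact: sqi_bdd bd.
by apply: nrm_bounded => //; rewrite mulr_ge0 ?nrm_ge0.
Qed.

(** Exchanging the two factors of the kernel turns a mean over the copy, tested on the original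
    space, into a mean of the test function. *)
Lemma kernel_op_adjoint f g : sqi P f -> sqi P g ->
  ip P g (kernel_op k f) = ip P (kernel_op (fun p => k (p.2, p.1)) g) f.
Proof.
move=> sf sg; have s2 := sqi_snd sf; have s1 := sqi_fst sg.
have int := sqi_integrableM s1 (sqi_bounded mk kK s2).
rewrite /ip /Rintegral.
transitivity (fine (\int[P]_w \int[P]_w' (g w * (k (w, w') * f w'))%:E)%E).
  congr fine; apply: eq_integral => w _; rewrite /kernel_op /Rintegral.
  have ikf := sqi_integrableM (kernel_section w) sf.
  rewrite EFinM fineK ?integrable_fin_num// -integralZl//.
rewrite (Fubini int); congr fine; apply: eq_integral => w' _.
rewrite /kernel_op /Rintegral /=.
have sk' : sqi P (fun w => k (w, w')).
  apply: (@sqi_bdd _ _ _ P K) => //.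
  by apply: measurableT_comp => //; exact: measurable_fun_pair.
have ikg := sqi_integrableM sk' sg.
rewrite EFinM fineK ?integrable_fin_num// -integralZr//.
by apply: eq_integral => w _; rewrite -EFinM mulrCA mulrA.
Qed.

End kernel_operator.

Section time_slices.
Context (R : realType) (d : measure_display) (Om : measurableType d)
  (P : probability Om R).
Local Notation Rm := (measurableTypeR R).
Local Notation Lam := (timeprod P).
Implicit Types (H : R -> Om -> R) (t : R) (th : Rm * Om -> R).

Lemma cut_slice t H s : (fun w => time_cut t H (s, w)) =
  if 0 <= s <= t then H s else cst 0.
Proof. by apply/funext => w; rewrite time_cutE; case: ifP. Qed.

Lemma mem_itv0 t (s : Rm) : (s \in `[0, t]%classic) = (0 <= s <= t).
Proof. by apply/idP/idP; rewrite inE/= in_itv. Qed.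

Lemma integral_slice t H : measurable_fun setT (time_cut t H) ->
  (forall s, 0 <= s <= t -> sqi P (H s)) ->
  (\int[Lam]_p ((time_cut t H p) ^+ 2)%:E =
   \int[lebesgue_measure]_(s in `[0%R, t]) ((nrm P (H s)) ^+ 2)%:E)%E.
Proof.
move=> mc sH.
have mc2 : measurable_fun setT (fun p => ((time_cut t H p) ^+ 2)%:E).
  by apply/measurable_EFinP; exact: measurable_funX.
have c0 p : (0 <= ((time_cut t H p) ^+ 2)%:E)%E by rewrite lee_fin sqr_ge0.
rewrite [LHS](fubini_tonelli1 _ mc2 c0) /fubini_F [RHS]integral_mkcond/=.
apply: eq_integral => s _; rewrite patchE mem_itv0.
transitivity (\int[P]_w (((if 0 <= s <= t then H s else cst 0) w) ^+ 2)%:E)%E.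
  by apply: eq_integral => w _; rewrite -cut_slice.
case: ifPn => [st|_]; first by rewrite ipE ?nrm_sqr//; exact: sH.
by rewrite integral0_eq// => w _; rewrite expr0n.
Qed.

Lemma measurable_slice t H : measurable_fun setT (time_cut t H) ->
  (forall s, 0 <= s <= t -> sqi P (H s)) ->
  measurable_fun (`[0, t]%classic : set Rm) (fun s => nrm P (H s)).
Proof.
move=> mc sH.
have mc2 : measurable_fun setT (fun p => ((time_cut t H p) ^+ 2)%:E).
  by apply/measurable_EFinP; exact: measurable_funX.
have c0 p : (0 <= ((time_cut t H p) ^+ 2)%:E)%E by rewrite lee_fin sqr_ge0.
have mF := measurable_fun_fubini_tonelli_F (m2 := P) _ mc2 c0.
have m1 : measurable_fun setT (fun s : Rm =>
    Num.sqrt (fine (\int[P]_w ((time_cut t H (s, w)) ^+ 2)%:E)%E)).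
  apply: (measurableT_comp (f := Num.sqrt : R -> R)).
    by apply: continuous_measurable_fun; exact: sqrt_continuous.
  by apply: measurableT_comp => //; exact: fine_measurable.
apply: (eq_measurable_fun _ _ (measurable_funTS m1)) => s.
rewrite mem_itv0 => st; rewrite /nrm /ip /Rintegral; congr (Num.sqrt (fine _)).
by apply: eq_integral => w _; rewrite time_cutE st expr2.
Qed.

Lemma ip_slice t H th : sqi Lam th -> sqi Lam (time_cut t H) ->
  (forall s, 0 <= s <= t -> sqi P (H s)) ->
  (forall s, 0 <= s <= t -> sqi P (fun w => th (s, w))) ->
  lebesgue_measure.-integrable (`[0, t]%classic : set Rm)
    (fun s => (ip P (fun w => th (s, w)) (H s))%:E) /\
  ip Lam th (time_cut t H) =
    \int[lebesgue_measure]_(s in `[0, t]) ip P (fun w => th (s, w)) (H s).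
Proof.
move=> sth sc sH sths; have int := sqi_integrableM sth sc.
have iF := integrable_fubini_F int.
have E s : fubini_F P (fun p => (th p * time_cut t H p)%:E) s =
    ((fun s => (ip P (fun w => th (s, w)) (H s))%:E) \_ `[0, t]%classic) s.
  rewrite /fubini_F patchE mem_itv0; case: ifPn => [st|st].
    have i1 := sqi_integrableM (sths s st) (sH s st).
    rewrite /ip /Rintegral fineK ?integrable_fin_num//.
    by apply: eq_integral => w _; rewrite time_cutE st.
  by rewrite integral0_eq// => w _; rewrite time_cutE (negbTE st) mulr0.
split.
  apply/integrable_mkcond => //.
  by apply: (eq_integrable _ _ _ _ iF) => // s _; exact: E.
rewrite {1}/ip /Rintegral -(integral12_prod_meas1 int) [in RHS]integral_mkcond.
by congr fine; apply: eq_integral => s _; exact: E.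
Qed.

(** The test function for the drift: pairing with it amounts to pairing [f] in L2(P) with the
    integral over [[0, t]]. *)
Definition tens (t : R) (f : Om -> R) (p : Rm * Om) : R := f p.2 * \1_(`[0, t]) p.1.

Lemma lebesgue_itv0 t : 0 <= t ->
  lebesgue_measure (`[0%R, t]%classic : set Rm) = t%:E.
Proof.
rewrite le_eqVlt => /predU1P[<-|t0]; first by rewrite set_itv1 lebesgue_measure_set1.
by rewrite lebesgue_measure_itv/= lte_fin t0 sube0.
Qed.

Lemma tens_sqi t f : 0 <= t -> sqi P f ->
  sqi Lam (tens t f) /\ nrm Lam (tens t f) = Num.sqrt t * nrm P f.
Proof.
move=> t0 sf; have [mf _] := sf.
have mt : measurable_fun setT (tens t f).
  apply: measurable_funM; first exact: measurableT_comp.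
  exact: (measurableT_comp (f := \1_(`[0, t]) : Rm -> R)).
have E : tens t f = time_cut t (fun=> f).
  apply/funext => -[s w]; rewrite time_cutE /tens/= indicE mem_itv0.
  by case: ifP; rewrite ?mulr1 ?mulr0.
have mc : measurable_fun setT (time_cut t (fun=> f)) by rewrite -E.
have IE : (\int[Lam]_p ((tens t f p) ^+ 2)%:E = (nrm P f ^+ 2)%:E *
    lebesgue_measure (`[0%R, t]%classic : set Rm))%E.
  by rewrite E integral_slice// integral_cst.
have leb := lebesgue_itv0 t0.
have st : sqi Lam (tens t f) by split => //; rewrite IE leb -EFinM ltry.
split => //; rewrite /nrm; have := ipE st; rewrite IE leb -EFinM => -[<-].
by rewrite mulrC sqrtrM// sqrtr_sqr ger0_norm ?nrm_ge0.
Qed.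

End time_slices.

Section time_bounds.
Context (R : realType) (d : measure_display) (Om : measurableType d)
  (P : probability Om R).
Local Notation Rm := (measurableTypeR R).
Local Notation Lam := (timeprod P).
Local Notation mu := (@lebesgue_measure R).

Lemma indicr_ge0 (E : set R) (s : R) : 0 <= (\1_E s : R).
Proof. by rewrite indicE ler0n. Qed.

Lemma nrm_mulb K (f g : Om -> R) : measurable_fun setT f -> 0 <= K ->
  (forall w, `|f w| <= K) -> sqi P g ->
  sqi P (fun w => f w * g w) /\ nrm P (fun w => f w * g w) <= K * nrm P g.
Proof.
move=> mf K0 fK sg; have sfg := sqi_bounded mf fK sg; split => //.
have sK := sqiZ K sg.
rewrite -(ger0_norm K0) -nrmZ// -ler_sqr ?nnegrE ?nrm_ge0// !nrm_sqr -lee_fin -!ipE//.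
apply: ge0_le_integralT => w; first by rewrite lee_fin sqr_ge0.
rewrite lee_fin !exprMn ler_wpM2r ?sqr_ge0//.
by rewrite -[leLHS]real_normK ?num_real// ler_sqr ?nnegrE.
Qed.

Lemma integral_expR (g t : R) : 0 < g -> 0 <= t ->
  (\int[mu]_(s in `[0%R, t]) (expR (g * s))%:E <= (expR (g * t) / g)%:E)%E.
Proof.
move=> g0; rewrite le_eqVlt => /predU1P[<-|t0].
  by rewrite set_itv1 integral_set1 lee_fin divr_ge0 ?expR_ge0// ltW.
pose F (s : R) : R := g^-1 * expR (g * s).
have dF (x : R) : is_derive x (1 : R) F (expR (g * x)).
  have dg : is_derive x (1 : R) (fun s : R => g * s) g.
    by rewrite -[X in is_derive _ _ _ X]mulr1; exact: is_deriveZ.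
  have de := is_derive1_comp (is_derive_expR (g * x)) dg.
  have h := is_deriveZ g^-1 de.
  apply: (is_derive_eq h); rewrite /GRing.scale/=.
  by rewrite mulrCA mulVf ?mulr1// gt_eqF.
have cF : continuous F.
  move=> x; apply: differentiable_continuous; apply/derivable1_diffP.
  by have [] := dF x.
have cf : continuous (fun s : R => expR (g * s)).
  move=> x; apply: continuous_comp; last exact: continuous_expR.
  exact: mulrl_continuous.
rewrite (@continuous_FTC2 _ _ F 0 t t0).
- rewrite -EFinB lee_fin /F mulr0 expR0 mulr1 mulrC lerBlDr lerDl invr_ge0.
  exact: ltW.
- exact: continuous_subspaceT.
- split.
  + by move=> x _; have [] := dF x.
  + by apply: cvg_at_right_filter; exact: cF.
  + by apply: cvg_at_left_filter; exact: cF.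
- by move=> x _; rewrite derive1E; exact: derive_val.
Qed.

(** The shape of the bounds on squared norms of right-hand sides: a weight, whose integral gains the
    factor [1 / g], and a spike, which contributes at most its measure. *)
Lemma integral_expR_indic (g t a b eps : R) (E : set R) :
  0 < g -> 0 <= t -> 0 <= a -> 0 <= b -> measurable E -> mu E = eps%:E ->
  (\int[mu]_(s in `[0%R, t]) (a * expR (g * s) + b * \1_E s)%:E
   <= (a * (expR (g * t) / g) + b * eps)%:E)%E.
Proof.
move=> g0 t0 a0 b0 mE lE.
have mexp : measurable_fun (`[0%R, t]%classic : set Rm) (fun s : Rm => expR (g * s)).
  apply: measurable_funTS; apply: (measurableT_comp (f := expR : R -> R)) => //.
have mind : measurable_fun (`[0%R, t]%classic : set Rm) (\1_E : Rm -> R).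
  by apply: measurable_funTS; exact: measurable_indic.
under eq_integral do rewrite EFinD.
rewrite ge0_integralD//; first last.
- by apply/measurable_EFinP; exact: measurable_funM.
- by move=> s _; rewrite lee_fin mulr_ge0.
- by apply/measurable_EFinP; exact: measurable_funM.
- by move=> s _; rewrite lee_fin mulr_ge0 ?expR_ge0.
rewrite EFinD; apply: leeD.
  under eq_integral do rewrite EFinM.
  rewrite ge0_integralZl//; first last.
  - exact/measurable_EFinP.
  by rewrite EFinM; apply: lee_wpmul2l => //; exact: integral_expR.
under eq_integral do rewrite EFinM.
rewrite ge0_integralZl//; first last.
- exact/measurable_EFinP.
rewrite EFinM -lE; apply: lee_wpmul2l => //.
rewrite integral_indic//; apply: le_measure; rewrite ?inE//.
by apply: measurableI.
Qed.

Lemma time_cut_sqi t H C : 0 <= t -> measurable_fun setT (time_cut t H) ->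
  (forall s, 0 <= s <= t -> sqi P (H s) /\ nrm P (H s) <= C) ->
  sqi Lam (time_cut t H).
Proof.
move=> t0 mc HC; split => //.
have sH s : 0 <= s <= t -> sqi P (H s) by move=> /HC[].
rewrite (integral_slice mc sH).
apply: (@le_lt_trans _ _ (\int[mu]_(s in `[0%R, t]) (C ^+ 2)%:E)%E).
  apply: ge0_le_integral => //.
  - by move=> s _; rewrite lee_fin sqr_ge0.
  - apply/measurable_EFinP; apply: measurable_funX; exact: measurable_slice.
  - move=> s; rewrite /= in_itv/= => st; rewrite lee_fin ler_sqr ?nnegrE ?nrm_ge0//.
      exact: (HC s st).2.
    exact: le_trans (nrm_ge0 _ _) (HC s st).2.
rewrite integral_cst// lte_mul_pinfty ?lee_fin ?sqr_ge0//.
by rewrite [X in (X < _)%E](lebesgue_itv0 t0) ltry.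
Qed.

Lemma nrm_time_cut_le t H a b g eps (E : set R) :
  0 < g -> 0 <= t -> 0 <= a -> 0 <= b -> measurable E -> mu E = eps%:E ->
  sqi Lam (time_cut t H) -> (forall s, 0 <= s <= t -> sqi P (H s)) ->
  (forall s, 0 <= s <= t -> nrm P (H s) ^+ 2 <= a * expR (g * s) + b * \1_E s) ->
  nrm Lam (time_cut t H) ^+ 2 <= a * (expR (g * t) / g) + b * eps.
Proof.
move=> g0 t0 a0 b0 mE lE sc sH HC; rewrite nrm_sqr -lee_fin -(ipE sc).
have mc : measurable_fun setT (time_cut t H) by case: sc.
rewrite (integral_slice mc sH).
apply: le_trans (integral_expR_indic g0 t0 a0 b0 mE lE).
apply: ge0_le_integral => //.
- by move=> s _; rewrite lee_fin sqr_ge0.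
- apply/measurable_EFinP; apply: measurable_funX; exact: measurable_slice.
- apply/measurable_EFinP; apply: measurable_funD; apply: measurable_funM => //.
    apply: measurable_funTS; apply: (measurableT_comp (f := expR : R -> R)) => //.
Qed.

Lemma drift_ip t B (I eta : Om -> R) : 0 <= t -> sqi P eta -> sqi P I ->
  sqi Lam (time_cut t B) ->
  {ae P, forall w, I w = \int[mu]_(s in `[0, t]) B s w} ->
  ip P eta I = ip Lam (tens t eta) (time_cut t B).
Proof.
move=> t0 se sI sB aeI; have [st _] := tens_sqi t0 se.
(* Tested with 1, the integrand is [B] itself on [[0, t]], so almost every path of [B] is integrable
   there; the constant [eta w] can then be moved inside the time integral. *)
have [s1 _] := tens_sqi t0 (sqi1 P).
have int := sqi_integrableM st sB; have int1 := sqi_integrableM s1 sB.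
rewrite {2}/ip /Rintegral -(integral21_prod_meas1 int) /ip /Rintegral.
congr fine; apply: ae_eq_integral => //.
- by case/integrableP: (sqi_integrableM se sI).
- exact: (measurable_fubini_G int).
have ae1 := ae_integrable2 int1.
near=> w => _.
have Iw : I w = \int[mu]_(s in `[0, t]) B s w by near: w.
have i1 : (mu : {measure set Rm -> \bar R}).-integrable setT
    (fun s => (tens t (cst 1) (s, w) * time_cut t B (s, w))%:E) by near: w.
rewrite /fubini_G.
transitivity (\int[mu]_s ((eta w)%:E * (tens t (cst 1) (s, w) * time_cut t B (s, w))%:E))%E.
  rewrite integralZl// EFinM; congr (_ * _)%E; rewrite Iw /Rintegral.
  rewrite [in LHS]integral_mkcond.
  have E s : ((fun s => (B s w)%:E) \_ `[0%R, t]%classic) s =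
      (tens t (cst 1) (s, w) * time_cut t B (s, w))%:E.
    rewrite patchE mem_itv0 time_cutE /tens/= indicE mem_itv0.
    by case: ifP => _; rewrite ?mul1r ?mul0r ?mulr0.
  rewrite (_ : (\int[mu]_s _)%E = (\int[mu]_s
      (tens t (cst 1) (s, w) * time_cut t B (s, w))%:E)%E); last first.
    by apply: eq_integral => s _; exact: E.
  by rewrite fineK// integrable_fin_num.
apply: eq_integral => s _; rewrite -EFinM; congr EFin.
by rewrite /tens/= mul1r mulrA.
Unshelve. all: by end_near.
Qed.

End time_bounds.

(** * The first variation *)

Section linear_right_hand_side.
Context (R : realType) (d : measure_display) (Om : measurableType d)
  (P : probability Om R).
Variables (T l : R) (X u v : R -> {RV P >-> R}) (K : R).
Hypothesis K0 : 0 <= K.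
Variables (psi : R -> R * R -> probability R R -> R -> R)
  (dpsi : R -> R * R -> probability R R -> R -> R -> R).
Hypothesis bounds : linear_bounds T l X u v K psi dpsi.

(** Drift and diffusion share this shape, so each estimate is proved once for both. *)
Definition lin_rhs (X1 : R -> {RV P >-> R}) (E : set R) (t : R) (w : Om) : R :=
  d_x l X u psi t w * X1 t w + d_x' l X u psi t w * X1 (t - l) w
  + mean_nu l X u dpsi X1 t w + Delta l X u v psi t w * \1_E t.

(** The factor 2 counts the local and the mean-field terms, both controlled by the present value of
    the process. *)
Lemma lin_rhs_sqi (X1 : R -> {RV P >-> R}) (E : set R) s : 0 <= s <= T -> sqi P (X1 s) -> sqi P (X1 (s - l)) ->
  sqi P (lin_rhs X1 E s) /\
  nrm P (lin_rhs X1 E s) <= K * (2 * nrm P (X1 s) + nrm P (X1 (s - l)) + \1_E s).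
Proof.
move=> sT s1 s2; have [[m1 b1] [m2 b2] [m3 b3] [sD nD]] := bounds sT.
have [q1 n1] := nrm_mulb m1 K0 b1 s1.
have [q2 n2] := nrm_mulb m2 K0 b2 s2.
have [q3 n3] := kernel_op_sqi m3 K0 b3 s1.
have q4 := sqiZ (\1_E s) sD.
have -> : lin_rhs X1 E s = fun w => (d_x l X u psi s w * X1 s w +
    d_x' l X u psi s w * X1 (s - l) w +
    kernel_op P (kernel_nu l X u dpsi s) (X1 s) w) +
    \1_E s * Delta l X u v psi s w.
  by apply/funext => w; rewrite /lin_rhs [\1_E s * _]mulrC.
have q12 := sqiD q1 q2; have q123 := sqiD q12 q3.
split; first exact: sqiD.
have -> : K * (2 * nrm P (X1 s) + nrm P (X1 (s - l)) + \1_E s) =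
    K * nrm P (X1 s) + K * nrm P (X1 (s - l)) + K * nrm P (X1 s) + \1_E s * K.
  by ring.
apply: (le_trans (nrmD q123 q4)); apply: lerD.
  apply: (le_trans (nrmD q12 q3)); apply: lerD => //.
  by apply: (le_trans (nrmD q1 q2)); exact: lerD.
by rewrite nrmZ// (ger0_norm (indicr_ge0 _ _)) ler_wpM2l// indicr_ge0.
Qed.

(* The test functions obtained by transposing the terms of [lin_rhs] in
   [X1 s] and [X1 (s - l)]. *)
Definition test_now (s : R) (eta : Om -> R) (w : Om) : R :=
  d_x l X u psi s w * eta w +
  kernel_op P (fun p => kernel_nu l X u dpsi s (p.2, p.1)) eta w.

Definition test_delay (s : R) (eta : Om -> R) (w : Om) : R :=
  d_x' l X u psi s w * eta w.

Lemma test_sqi s eta : 0 <= s <= T -> sqi P eta ->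
  [/\ sqi P (test_now s eta), nrm P (test_now s eta) <= 2 * K * nrm P eta,
      sqi P (test_delay s eta) & nrm P (test_delay s eta) <= K * nrm P eta].
Proof.
move=> sT se; have [[m1 b1] [m2 b2] [m3 b3] _] := bounds sT.
have [q1 n1] := nrm_mulb m1 K0 b1 se.
have [q2 n2] := nrm_mulb m2 K0 b2 se.
have m4 : measurable_fun setT (fun p : Om * Om => kernel_nu l X u dpsi s (p.2, p.1)).
  by apply: measurableT_comp => //; exact: measurable_fun_pair.
have [q3 n3] := kernel_op_sqi m4 K0 (fun p => b3 (p.2, p.1)) se.
split => //; first exact: sqiD.
have -> : 2 * K * nrm P eta = K * nrm P eta + K * nrm P eta by ring.
rewrite [test_now s eta](_ : _ = fun w => d_x l X u psi s w * eta w +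
  kernel_op P (fun p => kernel_nu l X u dpsi s (p.2, p.1)) eta w)//.
apply: (le_trans (nrmD q1 q3)); exact: lerD n1 n3.
Qed.

(** The spike term does not contain the process, so it is estimated by Cauchy-Schwarz rather than
    transposed. *)
Lemma lin_rhs_dual (X1 : R -> {RV P >-> R}) (E : set R) s eta : 0 <= s <= T -> sqi P eta ->
  sqi P (X1 s) -> sqi P (X1 (s - l)) ->
  `|ip P eta (lin_rhs X1 E s)| <=
    `|ip P (test_now s eta) (X1 s)| + `|ip P (test_delay s eta) (X1 (s - l))|
    + K * nrm P eta * \1_E s.
Proof.
move=> sT se s1 s2; have [[m1 b1] [m2 b2] [m3 b3] [sD nD]] := bounds sT.
have [q1 _] := nrm_mulb m1 K0 b1 s1.
have [q2 _] := nrm_mulb m2 K0 b2 s2.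
have [q3 _] := kernel_op_sqi m3 K0 b3 s1.
have [e1 _] := nrm_mulb m1 K0 b1 se.
have m4 : measurable_fun setT (fun p : Om * Om => kernel_nu l X u dpsi s (p.2, p.1)).
  by apply: measurableT_comp => //; exact: measurable_fun_pair.
have [e3 _] := kernel_op_sqi m4 K0 (fun p => b3 (p.2, p.1)) se.
have q4 := sqiZ (\1_E s) sD.
have -> : lin_rhs X1 E s = fun w => (d_x l X u psi s w * X1 s w +
    d_x' l X u psi s w * X1 (s - l) w +
    kernel_op P (kernel_nu l X u dpsi s) (X1 s) w) +
    \1_E s * Delta l X u v psi s w.
  by apply/funext => w; rewrite /lin_rhs [\1_E s * _]mulrC.
have q12 := sqiD q1 q2; have q123 := sqiD q12 q3.
rewrite !ipDr// ipZr// /test_now ipDl// (kernel_op_adjoint m3 b3 s1 se).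
have -> : ip P eta (fun w => d_x l X u psi s w * X1 s w) =
    ip P (fun w => d_x l X u psi s w * eta w) (X1 s).
  by rewrite /ip; apply: eq_Rintegral => w _; rewrite mulrCA mulrA.
have -> : ip P eta (fun w => d_x' l X u psi s w * X1 (s - l) w) =
    ip P (test_delay s eta) (X1 (s - l)).
  by rewrite /ip; apply: eq_Rintegral => w _; rewrite /test_delay mulrCA mulrA.
set a := ip P _ (X1 s); set b := ip P _ (X1 (s - l)); set c := ip P _ (X1 s).
have -> : a + b + c + \1_E s * ip P eta (Delta l X u v psi s) =
  (a + c) + b + \1_E s * ip P eta (Delta l X u v psi s) by ring.
apply: (le_trans (ler_normD _ _)); apply: lerD; first exact: ler_normD.
rewrite normrM (ger0_norm (indicr_ge0 _ _)) mulrC ler_wpM2r ?indicr_ge0//.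
apply: (le_trans (cauchy_schwarz se sD)).
by rewrite mulrC ler_wpM2r ?nrm_ge0.
Qed.

End linear_right_hand_side.

Section variation.
Context (R : realType) (d : measure_display) (Om : measurableType d)
  (P : probability Om R) (W : R -> {RV P >-> R}) (Fs : set (set Om)).
Hypothesis basis : stochastic_basis Fs W.
Local Notation F := (filtration Fs W).
Local Notation Rm := (measurableTypeR R).
Local Notation Lam := (timeprod P).
Variables (T l : R) (c : coefficients R) (X u v : R -> {RV P >-> R}) (K : R).
Hypotheses (l0 : 0 < l) (T0 : 0 < T) (K0 : 0 <= K).
Hypothesis bb : linear_bounds T l X u v K (b c) (db c).
Hypothesis bs : linear_bounds T l X u v K (sigma c) (dsigma c).

Local Notation Bd := (lin_rhs l X u v (b c) (db c)).
Local Notation Sd := (lin_rhs l X u v (sigma c) (dsigma c)).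
Local Notation cv := (normal_var R).

Variables (E : set R) (X1 : R -> {RV P >-> R}).
Hypothesis fv : first_variation F W T l c X u v E X1.

Lemma variation_past t : - l <= t <= 0 -> (X1 t : Om -> R) = cst 0.
Proof.
move=> tl; apply/funext => w; case: fv => H _ _; apply: H.
by rewrite in_itv.
Qed.

(** A bound without rate in the measure of [E]: it provides integrability and makes the supremum of
    the Gronwall argument finite. *)
Lemma variation_sqi : exists2 C, 0 <= C &
  forall t, - l <= t <= T -> sqi P (X1 t) /\ nrm P (X1 t) <= C.
Proof.
case: fv => _ [_ _ fin] _; have [C C0 HC] := sup_moment fin.
exists (Num.sqrt C); first exact: sqrtr_ge0.
move=> t tT; have [|sX nX] := HC t; first by rewrite /= in_itv.
by split => //; rewrite /nrm ler_sqrt.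
Qed.

Lemma delay_range s : 0 <= s <= T -> - l <= s <= T /\ - l <= s - l <= T.
Proof.
move=> /andP[s0 sT]; have := ltW l0 => l0'.
by split; apply/andP; split; lra.
Qed.

Lemma rhs_cut_sqi psi dpsi t : linear_bounds T l X u v K psi dpsi ->
  jointly_measurable T (lin_rhs l X u v psi dpsi X1 E) -> 0 <= t <= T ->
  sqi Lam (time_cut t (lin_rhs l X u v psi dpsi X1 E)).
Proof.
move=> bd jm /andP[t0 tT]; have [C C0 HC] := variation_sqi.
apply: (@time_cut_sqi _ _ _ _ _ _ (K * (3 * C + 1))) => //.
  exact: measurable_cut tT jm.
move=> s /andP[s0 st]; have sT : 0 <= s <= T by rewrite s0 (le_trans st).
have [/HC[s1 n1] /HC[s2 n2]] := delay_range sT.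
have [sR nR] := lin_rhs_sqi K0 bd E sT s1 s2; split => //.
apply: (le_trans nR); rewrite ler_wpM2l//.
have : \1_E s <= 1 :> R by rewrite indicE; case: (_ \in _).
lra.
Qed.

(** The tested form of the equation, which replaces its paths in all later arguments. *)
Lemma variation_test : exists M : R -> {RV P >-> R},
  [/\ is_ito_integral F W T (Sd X1 E) M,
      jointly_measurable T (Bd X1 E), jointly_measurable T (Sd X1 E),
      forall t eta, 0 <= t <= T -> sqi P eta ->
        ip P eta (X1 t) = ip Lam (tens t eta) (time_cut t (Bd X1 E)) + ip P eta (M t) &
      forall t, 0 <= t <= T -> nrm P (X1 t) <=
        Num.sqrt T * nrm Lam (time_cut t (Bd X1 E)) +
        Num.sqrt cv * nrm Lam (time_cut t (Sd X1 E))].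
Proof.
case: fv => past _ [adB jmB fB [M ito eqX]].
have jmS : jointly_measurable T (Sd X1 E) by case: ito.
have X10 w : X1 0 w = 0 by apply: past; rewrite in_itv/= lexx oppr_le0 ltW.
have [C C0 HC] := variation_sqi.
have sX t : 0 <= t <= T -> sqi P (X1 t).
  by move=> /delay_range[/HC[]].
have aeq t : 0 <= t <= T ->
    {ae P, forall w, X1 t w - M t w = \int[lebesgue_measure]_(s in `[0, t]) Bd X1 E s w}.
  move=> tT; have tI : t \in `[0, T] by rewrite in_itv.
  have := eqX t tI; apply: filterS => w; rewrite X10 add0r => ->.
  by rewrite addrK.
have main t eta : 0 <= t <= T -> sqi P eta ->
    ip P eta (fun w => X1 t w - M t w) = ip Lam (tens t eta) (time_cut t (Bd X1 E)).
  move=> tT se; have [_ sM _] := ito_nrm basis ito tT; case/andP: (tT) => t0 _.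
  apply: drift_ip => //; [apply: sqiB => //; exact: sX|exact: rhs_cut_sqi|exact: aeq].
exists M; split => //.
- move=> t eta tT se; have [_ sM _] := ito_nrm basis ito tT.
  by rewrite -main// ipBr ?subrK//; exact: sX.
- move=> t tT; have [sS sM nM] := ito_nrm basis ito tT; case/andP: (tT) => t0 t1.
  have sI : sqi P (fun w => X1 t w - M t w) by apply: sqiB => //; exact: sX.
  have -> : (X1 t : Om -> R) = fun w => (X1 t w - M t w) + M t w.
    by apply/funext => w; rewrite subrK.
  apply: (le_trans (nrmD sI sM)); apply: lerD => //.
  have sB := rhs_cut_sqi bb jmB tT.
  (* The drift part is tested against itself: its squared norm is at most [Num.sqrt t] times its
     norm times that of the integrand, and one factor cancels. *)
  have [st nt] := tens_sqi t0 sI.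
  have := cauchy_schwarz st sB; rewrite -(main _ _ tT sI) ger0_norm ?ip_ge0//.
  rewrite -nrm_sqr nt expr2 => H.
  have [->|n0] := eqVneq (nrm P (fun w => X1 t w - M t w)) 0.
    by rewrite mulr_ge0 ?sqrtr_ge0 ?nrm_ge0.
  have np : 0 < nrm P (fun w => X1 t w - M t w) by rewrite lt0r n0 nrm_ge0.
  rewrite -(ler_pM2l np); apply: (le_trans H).
  rewrite -mulrA mulrCA ler_wpM2l ?nrm_ge0// ler_wpM2r ?nrm_ge0//.
  by rewrite ler_sqrt// (le_trans t0).
Qed.

(* With [N] the supremum of [e^(-g s) E X1(s)^2], the equation gives
   [N <= N / 2 + O(eps)] for [g] large. *)
Lemma variation_moment eps : measurable E -> lebesgue_measure E = eps%:E ->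
  0 <= eps ->
  let A := 2 * (T + cv) * K ^+ 2 in
  forall t, - l <= t <= T ->
  nrm P (X1 t) ^+ 2 <= 4 * A * expR ((40 * A + 1) * T) * eps.
Proof.
move=> mE lE e0 A; have c0 : 0 <= cv := normal_var_ge0 R.
have A0 : 0 <= A by rewrite /A !mulr_ge0// ?addr_ge0 ?sqr_ge0// ltW.
(* If [x ^+ 2] and [y ^+ 2] are at most [z] and [i] is an indicator, then
   [(2 * x + y + i) ^+ 2 <= 20 * z + 2 * i]. The rate is chosen so that [20 * A / g <= 1 / 2]. *)
set g := 40 * A + 1; have g0 : 0 < g by rewrite /g; lra.
have [C C0 HC] := variation_sqi; have [M [ito jmB jmS _ nX]] := variation_test.
pose S := [set nrm P (X1 s) ^+ 2 * expR (- (g * s)) | s in [set s | 0 <= s <= T]].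
have hS : has_sup S.
  split; first by exists (nrm P (X1 0) ^+ 2 * expR (- (g * 0))); exists 0 => //=; rewrite lexx ltW.
  exists (C ^+ 2) => _ [s /= sT <-]; have [/HC[_ n1] _] := delay_range sT.
  rewrite -[leRHS]mulr1 ler_pM ?sqr_ge0 ?expR_ge0//.
    by rewrite ler_sqr ?nnegrE ?nrm_ge0.
  by rewrite expR_le1 oppr_le0 mulr_ge0 ?(ltW g0)//; case/andP: sT.
set N := sup S.
have bN s : 0 <= s <= T -> nrm P (X1 s) ^+ 2 <= N * expR (g * s).
  move=> sT; rewrite -ler_pdivrMr ?expR_gt0// -expRN.
  by apply: ub_le_sup; [case: hS|exists s].
have N0 : 0 <= N.
  have := bN 0; rewrite lexx ltW// mulr0 expR0 mulr1 => /(_ isT).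
  exact: le_trans (sqr_ge0 _).
(* The delayed value obeys the same bound: it vanishes before time 0, and afterwards the weight at
   the earlier time is smaller. *)
have bN' s : 0 <= s <= T -> nrm P (X1 (s - l)) ^+ 2 <= N * expR (g * s).
  move=> /andP[s0 sT]; have [sl|ls] := leP s l.
    rewrite variation_past; last by apply/andP; split; lra.
    rewrite nrm_sqr ip0l mulr_ge0 ?expR_ge0//.
  apply: (le_trans (bN (s - l) _)); first by apply/andP; split; have := l0; lra.
  rewrite ler_wpM2l// ler_expR ler_wpM2l ?(ltW g0)//; have := l0; lra.
have rhs psi dpsi t : linear_bounds T l X u v K psi dpsi ->
    jointly_measurable T (lin_rhs l X u v psi dpsi X1 E) -> 0 <= t <= T ->
    nrm Lam (time_cut t (lin_rhs l X u v psi dpsi X1 E)) ^+ 2 <=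
    20 * K ^+ 2 * N * (expR (g * t) / g) + 2 * K ^+ 2 * eps.
  move=> bd jm tT; case/andP: (tT) => t0 t1.
  have slice s : 0 <= s <= t -> 0 <= s <= T.
    by move=> /andP[-> st]; rewrite (le_trans st).
  have sq s : 0 <= s <= t -> _ := fun st =>
    let: conj h1 h2 := delay_range (slice s st) in
    lin_rhs_sqi K0 bd E (slice s st) (HC _ h1).1 (HC _ h2).1.
  apply: (nrm_time_cut_le g0 t0 _ _ mE lE).
  - by rewrite !mulr_ge0 ?sqr_ge0.
  - by rewrite mulr_ge0 ?sqr_ge0.
  - exact: rhs_cut_sqi.
  - by move=> s /sq[].
  move=> s st; have [_ h] := sq s st; have sT := slice s st.
  have h1 := bN s sT; have h2 := bN' s sT.
  apply: (@le_trans _ _ ((K * (2 * nrm P (X1 s) + nrm P (X1 (s - l)) + \1_E s)) ^+ 2)).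
    rewrite ler_sqr ?nnegrE ?nrm_ge0//.
    by rewrite mulr_ge0// !addr_ge0 ?mulr_ge0 ?nrm_ge0 ?indicr_ge0.
  rewrite exprMn.
  have -> : 20 * K ^+ 2 * N * expR (g * s) + 2 * K ^+ 2 * \1_E s =
    K ^+ 2 * (20 * (N * expR (g * s)) + 2 * \1_E s) by ring.
  rewrite ler_wpM2l ?sqr_ge0//.
  have i2 : (\1_E s : R) ^+ 2 = \1_E s.
    by rewrite indicE; case: (_ \in _); rewrite ?expr1n ?expr0n.
  move: h1 h2 i2; move: (nrm P (X1 s)) (nrm P (X1 (s - l))) (\1_E s : R) (N * _).
  move=> x y i z h1 h2 i2; rewrite -{2}i2.
  by have := sqr_ge0 (2 * x + y - i); have := sqr_ge0 (2 * x - y); lra.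
have step s : 0 <= s <= T ->
    nrm P (X1 s) ^+ 2 <= N / 2 * expR (g * s) + 2 * A * eps.
  move=> sT; have := nX s sT; have := rhs _ _ s bb jmB sT; have := rhs _ _ s bs jmS sT.
  have g2 : 20 * A * (N * expR (g * s) / g) <= N / 2 * expR (g * s).
    rewrite mulrA ler_pdivrMr// mulrC [leRHS]mulrAC -mulrA.
    have := mulr_ge0 N0 (expR_ge0 (g * s)); rewrite /g; move: (expR _) => y Ny.
    rewrite [leRHS](_ : _ = (N * y) * ((40 * A + 1) / 2)); last by ring.
    by rewrite ler_wpM2l//; lra.
  have := nrm_ge0 P (X1 s).
  have := nrm_ge0 Lam (time_cut s (Bd X1 E)); have := nrm_ge0 Lam (time_cut s (Sd X1 E)).
  move: g2; rewrite [N * _ / g](_ : _ = N * (expR (g * s) / g)); last by ring.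
  move: (nrm P _) (nrm Lam _) (nrm Lam _) (expR (g * s) / g) (N / 2 * _).
  move=> x bd sd q r g2 sd0 bd0 x0 hS1 hB1 hx.
  have x2 : x ^+ 2 <= 2 * (T * bd ^+ 2 + cv * sd ^+ 2).
    have h0 : 0 <= Num.sqrt T * bd + Num.sqrt cv * sd by exact: le_trans hx.
    apply: (@le_trans _ _ ((Num.sqrt T * bd + Num.sqrt cv * sd) ^+ 2)).
      by rewrite ler_sqr ?nnegrE.
    have -> : T * bd ^+ 2 = (Num.sqrt T * bd) ^+ 2 by rewrite exprMn sqr_sqrtr// ltW.
    have -> : cv * sd ^+ 2 = (Num.sqrt cv * sd) ^+ 2 by rewrite exprMn sqr_sqrtr.
    by have := sqr_ge0 (Num.sqrt T * bd - Num.sqrt cv * sd); lra.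
  have hB2 := ler_wpM2l (ltW T0) hB1; have hS2 := ler_wpM2l c0 hS1.
  apply: (le_trans x2); apply: (@le_trans _ _ (20 * A * (N * q) + 2 * A * eps)).
    rewrite (_ : 20 * A * (N * q) + 2 * A * eps =
      2 * (T * (20 * K ^+ 2 * N * q + 2 * K ^+ 2 * eps) +
           cv * (20 * K ^+ 2 * N * q + 2 * K ^+ 2 * eps))); last by rewrite /A; ring.
    by rewrite ler_wpM2l// lerD.
  by rewrite lerD2r.
have NA : N <= 4 * A * eps.
  suff : N <= N / 2 + 2 * A * eps by lra.
  apply: ge_sup; first by case: hS.
  move=> _ [s /= sT <-]; have e1 := expR_ge0 (- (g * s)).
  apply: (le_trans (ler_wpM2r e1 (step s sT))).
  rewrite mulrDl -[N / 2 * _ * _]mulrA expRxMexpNx_1 mulr1 lerD2l.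
  have h2A : 0 <= 2 * A * eps := mulr_ge0 (mulr_ge0 (ler0n _ 2) A0) e0.
  rewrite ler_piMr// expR_le1 oppr_le0 mulr_ge0 ?(ltW g0)//.
  by case/andP: sT.
move=> t /andP[tl tT]; have A4 : 0 <= 4 * A * eps := mulr_ge0 (mulr_ge0 (ler0n _ 4) A0) e0.
have [t0|t0] := leP 0 t; last first.
  rewrite variation_past; last by apply/andP; split; lra.
  by rewrite nrm_sqr ip0l mulrAC mulr_ge0 ?expR_ge0.
apply: (le_trans (bN t _)); first by rewrite t0.
rewrite [leRHS]mulrAC; apply: ler_pM => //.
by rewrite ler_expR ler_wpM2l ?(ltW g0).
Qed.

End variation.

(** * Weak limit of the first variation *)

Lemma le_sqrt_of_sqr (R : rcfType) (x y : R) : 0 <= y -> x ^+ 2 <= y -> x <= Num.sqrt y.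
Proof. by move=> y0 xy; rewrite (le_trans (ler_norm x))// -sqrtr_sqr ler_sqrt. Qed.

Section bounded_limits.
Context (R : realType) (d : measure_display) (T : measurableType d)
  (mu : {measure set T -> \bar R}) (D : set T).
Hypotheses (mD : measurable D) (fD : (mu D < +oo)%E).

Lemma bounded_cvg0 (g : nat -> T -> R) (B e : R) : 0 < e ->
  (forall n, measurable_fun D (g n)) -> (forall n x, D x -> 0 <= g n x <= B) ->
  (forall x (e : R), D x -> 0 < e -> \forall n \near \oo, g n x <= e) ->
  \forall n \near \oo, (\int[mu]_(x in D) (g n x)%:E <= e%:E)%E.
Proof.
move=> e0 mg gB g0.
have cv : (fun n => \int[mu]_(x in D) (g n x)%:E)%E @ \oo -->
    (\int[mu]_(x in D) (cst 0%E x : \bar R))%E.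
  apply: (@dominated_cvg _ _ _ mu D mD (fun n x => (g n x)%:E) (cst 0%E) (cst B%:E)).
  - by move=> n; exact/measurable_EFinP.
  - move=> x Dx; apply: cvg_EFin; first by near=> n.
    apply/cvgrPdist_le => //= e' e'0.
    have := g0 x e' Dx e'0; apply: filterS => n h.
    by rewrite sub0r normrN ger0_norm//; case/andP: (gB n x Dx).
  - by [].
  - apply/integrableP; split; first exact: measurable_cst.
    under eq_integral do rewrite /=.
    rewrite (integral_cst _ mD (`|B%:E|)%E) lte_mul_pinfty// abse_fin_num//.
  - by move=> n x Dx; rewrite lee_fin ger0_norm; case/andP: (gB n x Dx).
rewrite integral0_eq// in cv.
have := cvge0_lt e0 cv; apply: filterS => n; exact: ltW.
Unshelve. all: by end_near. Qed.

(* After division by [sqrt (eps n)] the indicator of the spike set contributes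
   [sqrt (eps n)] to the integral, although it does not tend to zero pointwise. *)
Lemma limit_excess (G : nat -> T -> R) (q : T -> R) (B C Q e : R) (E : nat -> set T)
    (eps : nat -> R) :
  0 < e -> 0 <= C -> 0 <= B ->
  (forall n, mu.-integrable D (EFin \o G n)) ->
  measurable_fun D q -> (forall x, D x -> 0 <= q x) ->
  (\int[mu]_(x in D) (q x)%:E <= Q%:E)%E ->
  (forall n, measurable (E n)) -> (forall n, mu (E n) = (eps n)%:E) ->
  (forall n, 0 < eps n) -> eps @ \oo --> 0 ->
  (forall n x, D x -> `|G n x| <= B * Num.sqrt (eps n) + C * \1_(E n) x) ->
  (forall x, D x -> \forall n \near \oo,
    `|G n x| <= q x * Num.sqrt (eps n) + C * \1_(E n) x) ->
  \forall n \near \oo, `|\int[mu]_(x in D) G n x| <= (Q + e) * Num.sqrt (eps n).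
Proof.
move=> e0 C0 B0 iG mq q0 qQ mE lE ep ec GB Gq.
pose r n := Num.sqrt (eps n); have r0 n : 0 < r n by rewrite sqrtr_gt0.
have mG n : measurable_fun D (G n) by apply/measurable_EFinP; case/integrableP: (iG n).
(* The positive part of what exceeds the expected bound, after division by [r n]. With the spike
   removed it is bounded by [B] and tends to 0 pointwise, so dominated convergence applies. *)
pose g n x := Num.max 0 (`|G n x| / r n - C * \1_(E n) x / r n - q x).
have mI n : measurable_fun D (\1_(E n) : T -> R).
  by apply: measurable_funTS; exact: measurable_indic.
have mg n : measurable_fun D (g n).
  apply: measurable_maxr => //; apply: measurable_funB => //; apply: measurable_funB.
    by apply: measurable_funM => //; exact: measurableT_comp.
  by apply: measurable_funM => //; exact: measurable_funM.
have g0 n x : 0 <= g n x by rewrite /g le_max lexx.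
have gle n x a : 0 <= a -> D x -> `|G n x| <= (a + q x) * r n + C * \1_(E n) x -> g n x <= a.
  move=> a0 Dx h; rewrite /g ge_max a0/= -mulrBl lerBlDr ler_pdivrMr// lerBlDr//.
have e2 : 0 < e / 2 by rewrite divr_gt0.
have gi : \forall n \near \oo, (\int[mu]_(x in D) (g n x)%:E <= (e / 2)%:E)%E.
  apply: (@bounded_cvg0 _ B) => //.
  - move=> n x Dx; rewrite g0/=; apply: gle => //; apply: le_trans (GB n x Dx) _.
    by rewrite -/(r n) lerD2r (ler_wpM2r (ltW (r0 n)))// lerDl q0.
  - move=> x e' Dx e'0; have := Gq x Dx; apply: filterS => n h.
    apply: gle => //; first exact: ltW.
    by apply: (le_trans h); rewrite -/(r n) lerD2r (ler_wpM2r (ltW (r0 n)))// lerDr ltW.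
(* The spike integrates to at most [C * eps n], that is [(C * r n) * r n]: the second half of [e]
   pays for it. *)
have rc : \forall n \near \oo, C * r n <= e / 2.
  have C1 : 0 < C + 1 by rewrite ltr_wpDl.
  have s0 : 0 < (e / 2 / (C + 1)) ^+ 2 by rewrite exprn_gt0// divr_gt0.
  move/cvgrPdist_le/(_ _ s0) : ec; apply: filterS => n /=.
  rewrite sub0r normrN gtr0_norm// => h.
  have h2 : r n <= e / 2 / (C + 1).
    rewrite -ler_sqr ?nnegrE ?(ltW (r0 n))//; last by rewrite divr_ge0// ltW.
    by rewrite /r sqr_sqrtr// ltW.
  apply: (@le_trans _ _ ((C + 1) * r n)); first by rewrite ler_wpM2r ?(ltW (r0 n))// lerDl.
  by rewrite mulrC -ler_pdivlMr.
near=> n.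
have gn : (\int[mu]_(x in D) (g n x)%:E <= (e / 2)%:E)%E by near: n.
have rn : C * r n <= e / 2 by near: n.
rewrite -/(r n) -lee_fin.
have fG : (\int[mu]_(x in D) (G n x)%:E)%E \is a fin_num by exact: (integrable_fin_num mD (iG n)).
rewrite -abse_EFin /Rintegral fineK//.
have GM : measurable_fun D (EFin \o G n) by exact/measurable_EFinP.
apply: (le_trans (le_abse_integral mu mD GM)).
have mgq : measurable_fun D (fun x => ((r n * (g n x + q x))%:E)).
  by apply/measurable_EFinP; apply: measurable_funM => //; exact: measurable_funD.
have mCI : measurable_fun D (fun x => ((C * \1_(E n) x)%:E)).
  by apply/measurable_EFinP; exact: measurable_funM.
have gq0 x : D x -> 0 <= r n * (g n x + q x).
  by move=> Dx; rewrite mulr_ge0 ?(ltW (r0 n))// addr_ge0// q0.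
have CI0 x : 0 <= C * \1_(E n) x by rewrite mulr_ge0// indicr_ge0.
apply: (@le_trans _ _ (\int[mu]_(x in D)
    ((r n * (g n x + q x))%:E + (C * \1_(E n) x)%:E))%E).
  apply: ge0_le_integral => //.
  - exact: measurableT_comp.
  - exact: emeasurable_funD.
  move=> x Dx; rewrite -EFinD lee_fin -lerBlDr -(ler_pdivrMl _ _ (r0 n)) -lerBlDr.
  by rewrite [_^-1 * _]mulrC mulrBl /g le_max lexx orbT.
have iC : (\int[mu]_(x in D) (C * \1_(E n) x)%:E =
    C%:E * \int[mu]_(x in D) (\1_(E n) x)%:E)%E.
  under eq_integral do rewrite EFinM.
  rewrite ge0_integralZl//; exact/measurable_EFinP.
have igq : (\int[mu]_(x in D) (g n x + q x)%:E =
    \int[mu]_(x in D) (g n x)%:E + \int[mu]_(x in D) (q x)%:E)%E.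
  under eq_integral do rewrite EFinD.
  by rewrite ge0_integralD//; [move=> x _; rewrite lee_fin|exact/measurable_EFinP|exact/measurable_EFinP].
have irgq : (\int[mu]_(x in D) (r n * (g n x + q x))%:E =
    (r n)%:E * \int[mu]_(x in D) (g n x + q x)%:E)%E.
  under eq_integral do rewrite EFinM.
  rewrite ge0_integralZl// ?lee_fin ?(ltW (r0 n))//.
    by apply/measurable_EFinP; exact: measurable_funD.
  by move=> x Dx; rewrite lee_fin addr_ge0// q0.
have gq0' x : D x -> (0 <= (r n * (g n x + q x))%:E)%E by rewrite lee_fin; exact: gq0.
have CI0' x : D x -> (0 <= (C * \1_(E n) x)%:E)%E by rewrite lee_fin.
rewrite (ge0_integralD _ mD gq0' mgq CI0' mCI) irgq igq iC.
apply: (@le_trans _ _ ((r n)%:E * ((e / 2)%:E + Q%:E) + C%:E * (eps n)%:E)%E).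
  apply: leeD.
    by apply: lee_wpmul2l; [rewrite lee_fin ltW|exact: leeD].
  apply: lee_wpmul2l; first by rewrite lee_fin.
  rewrite integral_indic// -lE; apply: le_measure; rewrite ?inE//.
  exact: measurableI.
rewrite -[X in (X <= _)%E]/((r n * (e / 2 + Q) + C * eps n)%:E) lee_fin.
have -> : eps n = r n * r n by rewrite -expr2 sqr_sqrtr// ltW.
rewrite mulrA; have := ler_wpM2r (ltW (r0 n)) rn.
lra.
Unshelve. all: by end_near. Qed.

End bounded_limits.

Section weak_limit.
Context (R : realType) (d : measure_display) (Om : measurableType d)
  (P : probability Om R) (W : R -> {RV P >-> R}) (Fs : set (set Om)).
Hypothesis basis : stochastic_basis Fs W.
Local Notation F := (filtration Fs W).
Local Notation Rm := (measurableTypeR R).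
Local Notation Lam := (timeprod P).
Local Notation mu := (@lebesgue_measure R).
Variables (T l : R) (c : coefficients R) (X u v : R -> {RV P >-> R}) (K : R).
Hypotheses (l0 : 0 < l) (T0 : 0 < T) (K0 : 0 < K).
Hypothesis bb : linear_bounds T l X u v K (b c) (db c).
Hypothesis bs : linear_bounds T l X u v K (sigma c) (dsigma c).

Local Notation Bd := (lin_rhs l X u v (b c) (db c)).
Local Notation Sd := (lin_rhs l X u v (sigma c) (dsigma c)).
Local Notation cv := (normal_var R).

(** The error of [ito_represent] is relative to this norm; being of order [Num.sqrt eps], it stays
    small after division by [Num.sqrt eps]. *)
Lemma variation_noise (E : set R) (X1 : R -> {RV P >-> R}) eps C t :
  first_variation F W T l c X u v E X1 ->
  measurable E -> mu E = eps%:E -> 0 <= eps -> 0 <= C -> 0 <= t <= T ->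
  sqi Lam (time_cut t (Sd X1 E)) ->
  (forall s, - l <= s <= T -> nrm P (X1 s) <= C * Num.sqrt eps) ->
  nrm Lam (time_cut t (Sd X1 E)) <=
    Num.sqrt (2 * K ^+ 2 * (9 * C ^+ 2 * expR T + 1)) * Num.sqrt eps.
Proof.
move=> fv mE lE e0 C0 tT sS nX; case/andP: (tT) => t0 t1.
have [C' C'0 HC] := variation_sqi fv.
have A0 : 0 <= 2 * K ^+ 2 * (9 * C ^+ 2 * expR T + 1).
  exact: mulr_ge0 (mulr_ge0 (ler0n _ 2) (sqr_ge0 K))
    (addr_ge0 (mulr_ge0 (mulr_ge0 (ler0n _ 9) (sqr_ge0 C)) (expR_ge0 T)) ler01).
rewrite -sqrtrM//; apply: le_sqrt_of_sqr; first exact: mulr_ge0 A0 e0.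
have slice s : 0 <= s <= t -> 0 <= s <= T.
  by move=> /andP[-> st]; rewrite (le_trans st).
have sq s : 0 <= s <= t -> _ := fun st =>
  let: conj h1 h2 := delay_range l0 (slice s st) in
  lin_rhs_sqi (ltW K0) bs E (slice s st) (HC _ h1).1 (HC _ h2).1.
have c18 : 0 <= 18 * K ^+ 2 * C ^+ 2 * eps :=
  mulr_ge0 (mulr_ge0 (mulr_ge0 (ler0n _ 18) (sqr_ge0 K)) (sqr_ge0 C)) e0.
have c2 : 0 <= 2 * K ^+ 2 := mulr_ge0 (ler0n _ 2) (sqr_ge0 K).
(* The weight of rate 1 is at least 1 on [[0, t]], so a constant bound fits the weighted form; 18
   and 2 come from [(3 * z + i) ^+ 2 <= 18 * z ^+ 2 + 2 * i] for an indicator [i]. *)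
have h : nrm Lam (time_cut t (Sd X1 E)) ^+ 2 <=
    18 * K ^+ 2 * C ^+ 2 * eps * (expR (1 * t) / 1) + 2 * K ^+ 2 * eps.
  apply: (nrm_time_cut_le ltr01 t0 _ _ mE lE sS).
  - by [].
  - by [].
  - by move=> s /sq[].
  move=> s st; have [_ h] := sq s st.
  have [/nX h1 /nX h2] := delay_range l0 (slice s st).
  apply: (@le_trans _ _ ((K * (2 * nrm P (X1 s) + nrm P (X1 (s - l)) + \1_E s)) ^+ 2)).
    rewrite ler_sqr ?nnegrE ?nrm_ge0//.
    by rewrite mulr_ge0 ?(ltW K0)// !addr_ge0 ?mulr_ge0 ?nrm_ge0 ?indicr_ge0.
  rewrite exprMn.
  have i2 : (\1_E s : R) ^+ 2 = \1_E s.
    by rewrite indicE; case: (_ \in _); rewrite ?expr1n ?expr0n.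
  have ex : 1 <= expR (1 * s) by rewrite mul1r -expR0 ler_expR; case/andP: st.
  have i0 := indicr_ge0 E s; have r2 : Num.sqrt eps ^+ 2 = eps by rewrite sqr_sqrtr.
  have n1 := nrm_ge0 P (X1 s); have n2 := nrm_ge0 P (X1 (s - l)).
  have r0 := mulr_ge0 C0 (sqrtr_ge0 eps).
  apply: (@le_trans _ _ (K ^+ 2 * (18 * (C * Num.sqrt eps) ^+ 2 + 2 * \1_E s))).
    rewrite ler_wpM2l ?sqr_ge0//; move: h1 h2 i2 i0 n1 n2 r0.
    move: (nrm P (X1 s)) (nrm P (X1 (s - l))) (\1_E s : R) (C * _).
    move=> x y i z h1 h2 i2 i0 x0 y0 z0.
    apply: (@le_trans _ _ ((3 * z + i) ^+ 2)).
      by rewrite ler_sqr ?nnegrE; lra.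
    by rewrite -{2}i2; have := sqr_ge0 (3 * z - i); lra.
  rewrite exprMn r2.
  rewrite (_ : K ^+ 2 * _ = 18 * K ^+ 2 * C ^+ 2 * eps + 2 * K ^+ 2 * \1_E s); last by ring.
  by rewrite lerD2r ler_peMr.
apply: (le_trans h); rewrite divr1 mul1r.
rewrite (_ : 2 * K ^+ 2 * _ * eps = 18 * K ^+ 2 * C ^+ 2 * eps * expR T + 2 * K ^+ 2 * eps); last by ring.
by rewrite lerD2r ler_wpM2l ?ler_expR.
Qed.


Variables (eps : nat -> R) (E : nat -> set R) (X1 : nat -> R -> {RV P >-> R}).
Hypothesis fv : forall n, first_variation F W T l c X u v (E n) (X1 n).
Hypotheses (mE : forall n, measurable (E n)) (lE : forall n, mu (E n) = (eps n)%:E).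
Hypotheses (ep : forall n, 0 < eps n) (ec : eps @ \oo --> 0).
Local Notation r n := (Num.sqrt (eps n)).

Lemma variation_rate : exists2 C, 0 <= C & forall n s, - l <= s <= T ->
  nrm P (X1 n s) <= C * r n.
Proof.
set A := 2 * (T + cv) * K ^+ 2.
set B := 4 * A * expR ((40 * A + 1) * T).
have B0 : 0 <= B.
  exact: mulr_ge0 (mulr_ge0 (ler0n _ 4) (mulr_ge0 (mulr_ge0 (ler0n _ 2)
    (addr_ge0 (ltW T0) (normal_var_ge0 R))) (sqr_ge0 K))) (expR_ge0 _).
exists (Num.sqrt B); first exact: sqrtr_ge0.
move=> n s sT; rewrite -sqrtrM//; apply: le_sqrt_of_sqr.
  exact: mulr_ge0 B0 (ltW (ep n)).
exact: (variation_moment basis l0 T0 (ltW K0) bb bs (fv n) (mE n) (lE n) (ltW (ep n)) sT).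
Qed.

(** Valid for every [n] with constants independent of [s]: the domination for the passage to the
    limit in time. The factor 3 is 2 for the present value and 1 for the delayed one. *)
Lemma rhs_dual_bound psi dpsi C m f n s : linear_bounds T l X u v K psi dpsi ->
  (forall n s, - l <= s <= T -> nrm P (X1 n s) <= C * r n) ->
  0 <= s <= T -> sqi P f -> nrm P f <= m ->
  `|ip P f (lin_rhs l X u v psi dpsi (X1 n) (E n) s)| <=
    3 * K * m * C * r n + K * m * \1_(E n) s.
Proof.
move=> bd HC sT sf fm; have [d1 d2] := delay_range l0 sT.
have [C' _ HC'] := variation_sqi (fv n).
have [s1 _] := HC' _ d1; have [s2 _] := HC' _ d2.
apply: (le_trans (lin_rhs_dual (ltW K0) bd (E n) sT sf s1 s2)).
have [q1 n1 q2 n2] := test_sqi (ltW K0) bd sT sf.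
have c1 := cauchy_schwarz q1 s1; have c2 := cauchy_schwarz q2 s2.
have n3 := HC n _ d1; have n4 := HC n _ d2.
have Km := ler_wpM2l (ltW K0) fm.
have m1 : nrm P (test_now l X u psi dpsi s f) * nrm P (X1 n s) <= (2 * (K * m)) * (C * r n).
  apply: ler_pM => //; try exact: nrm_ge0.
  by apply: (le_trans n1); rewrite -mulrA ler_wpM2l.
have m2 : nrm P (test_delay l X u psi s f) * nrm P (X1 n (s - l)) <= (K * m) * (C * r n).
  apply: ler_pM => //; try exact: nrm_ge0.
  exact: (le_trans n2).
apply: lerD; last by rewrite ler_wpM2r ?indicr_ge0.
rewrite (_ : 3 * K * m * C * r n = 2 * (K * m) * (C * r n) + K * m * (C * r n)); last by ring.
by apply: lerD; [exact: le_trans c1 m1|exact: le_trans c2 m2].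
Qed.

(** The index from which the inequality holds may depend on [t] and [eta]. A positive [h] in place
    of the norm keeps the right-hand side positive when [eta] vanishes almost everywhere. *)
Definition asymptotic_bound (g a : R) : Prop := forall t h eta,
  - l <= t <= T -> sqi P eta -> 0 < h -> nrm P eta <= h ->
  \forall n \near \oo, `|ip P eta (X1 n t)| <= a * expR (g * t) * h * r n.

(** The counterpart of [rhs_dual_bound] at a fixed time, with [C] improved to the hypothetical
    asymptotic constant; the delay only lowers the weight. *)
Lemma rhs_dual_asymptotic psi dpsi g a m f s : linear_bounds T l X u v K psi dpsi ->
  0 <= g -> 0 < a -> asymptotic_bound g a ->
  0 <= s <= T -> sqi P f -> 0 < m -> nrm P f <= m ->
  \forall n \near \oo, `|ip P f (lin_rhs l X u v psi dpsi (X1 n) (E n) s)| <=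
    3 * K * m * (a * expR (g * s)) * r n + K * m * \1_(E n) s.
Proof.
move=> bd g0 a0 ab sT sf m0 fm; have [d1 d2] := delay_range l0 sT.
have [q1 n1 q2 n2] := test_sqi (ltW K0) bd sT sf.
have Km := ler_wpM2l (ltW K0) fm.
have Km0 : 0 < K * m by rewrite mulr_gt0.
have p1 := ab s (2 * (K * m)) _ d1 q1; have p2 := ab (s - l) (K * m) _ d2 q2.
have {}p1 : \forall n \near \oo, `|ip P (test_now l X u psi dpsi s f) (X1 n s)| <=
    a * expR (g * s) * (2 * (K * m)) * r n.
  by apply: p1; [rewrite mulr_gt0|apply: (le_trans n1); rewrite -mulrA ler_wpM2l].
have {}p2 : \forall n \near \oo, `|ip P (test_delay l X u psi s f) (X1 n (s - l))| <=
    a * expR (g * (s - l)) * (K * m) * r n.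
  by apply: p2 => //; exact: (le_trans n2).
have exps : expR (g * (s - l)) <= expR (g * s).
  by rewrite ler_expR ler_wpM2l// lerBlDr lerDl ltW.
near=> n; have [C' _ HC'] := variation_sqi (fv n).
have [s1 _] := HC' _ d1; have [s2 _] := HC' _ d2.
apply: (le_trans (lin_rhs_dual (ltW K0) bd (E n) sT sf s1 s2)).
apply: lerD; last by rewrite ler_wpM2r ?indicr_ge0.
rewrite (_ : 3 * K * m * (a * expR (g * s)) * r n =
  a * expR (g * s) * (2 * (K * m)) * r n + a * expR (g * s) * (K * m) * r n); last by ring.
apply: lerD; first by near: n.
apply: (@le_trans _ _ (a * expR (g * (s - l)) * (K * m) * r n)); first by near: n.
by rewrite ler_wpM2r ?sqrtr_ge0// ler_wpM2r ?(ltW Km0)// ler_wpM2l ?(ltW a0).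
Unshelve. all: by end_near. Qed.


(** This is [24 * K * (2 + M / 4)] with [M = 96 * K * (cv + 1)], where [M] is the parameter of the
    Young inequality in [bound_halving]. *)
Definition halving_rate : R := 24 * K * (2 + 24 * K * (cv + 1)).

Lemma halving_rate_gt0 : 0 < halving_rate.
Proof.
have c1 : 0 < cv + 1 by rewrite ltr_wpDl// normal_var_ge0.
apply: mulr_gt0; first exact: mulr_gt0.
by apply: addr_gt0 => //; apply: mulr_gt0 => //; exact: mulr_gt0.
Qed.

(** Two contributions of at most one eighth each: [M] compensates the integral of the squared slice
    norms, and the integral of the exponential gains [1 / halving_rate]. *)
Lemma integral_excess_bound a h t (n : Rm -> R) : 0 < a -> 0 < h -> 0 <= t ->
  measurable_fun (`[0, t]%classic : set Rm) n -> 
  (\int[mu]_(s in `[0%R, t]) (n s ^+ 2)%:E <= (4 * cv * h ^+ 2)%:E)%E ->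
  forall M, M = 96 * K * (cv + 1) ->
  (\int[mu]_(s in `[0%R, t]) (3 * K * a * (n s ^+ 2 / (M * h) * expR (halving_rate * t)
      + (2 + M / 4) * h * expR (halving_rate * s)))%:E
    <= (a * expR (halving_rate * t) * h / 4)%:E)%E.
Proof.
move=> a0 h0 t0 mn nh M Mdef.
have c0 : 0 <= cv := normal_var_ge0 R; have c1 : 0 < cv + 1 by rewrite ltr_wpDl.
have M0 : 0 < M by rewrite Mdef; apply: mulr_gt0 => //; exact: mulr_gt0.
have g0 := halving_rate_gt0; set g := halving_rate in g0 *.
pose p := 3 * K * a / (M * h) * expR (g * t); pose q := 3 * K * a * ((2 + M / 4) * h).
have p0 : 0 <= p.
  apply: mulr_ge0 (expR_ge0 _); apply: divr_ge0; last by rewrite ltW// mulr_gt0.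
  by rewrite ltW// mulr_gt0// mulr_gt0.
have q0 : 0 <= q.
  apply: mulr_ge0; first by rewrite ltW// mulr_gt0// mulr_gt0.
  by apply: mulr_ge0 (ltW h0); rewrite addr_ge0// divr_ge0// ltW.
have mexp : measurable_fun (`[0%R, t]%classic : set Rm) (fun s : Rm => expR (g * s)).
  apply: measurable_funTS; apply: (measurableT_comp (f := expR : R -> R)) => //.
have e1 : (\int[mu]_(s in `[0%R, t]) (p * n s ^+ 2)%:E =
    p%:E * \int[mu]_(s in `[0%R, t]) (n s ^+ 2)%:E)%E.
  under eq_integral do rewrite EFinM.
  rewrite ge0_integralZl//.
  - by apply/measurable_EFinP; exact: measurable_funX.
  - by move=> s _; rewrite lee_fin sqr_ge0.
have e2 : (\int[mu]_(s in `[0%R, t]) (q * expR (g * s))%:E =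
    q%:E * \int[mu]_(s in `[0%R, t]) (expR (g * s))%:E)%E.
  under eq_integral do rewrite EFinM.
  by rewrite ge0_integralZl//; exact/measurable_EFinP.
have -> : (\int[mu]_(s in `[0%R, t]) (3 * K * a * (n s ^+ 2 / (M * h) * expR (g * t)
      + (2 + M / 4) * h * expR (g * s)))%:E =
    \int[mu]_(s in `[0%R, t]) ((p * n s ^+ 2)%:E + (q * expR (g * s))%:E))%E.
  by apply: eq_integral => s _; rewrite -EFinD /p /q; congr EFin; ring.
rewrite ge0_integralD//; first last.
- by apply/measurable_EFinP; exact: measurable_funM.
- by move=> s _; rewrite lee_fin mulr_ge0 ?expR_ge0.
- by apply/measurable_EFinP; apply: measurable_funM => //; exact: measurable_funX.
- by move=> s _; rewrite lee_fin mulr_ge0 ?sqr_ge0.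
rewrite e1 e2; apply: (@le_trans _ _ (p * (4 * cv * h ^+ 2) + q * (expR (g * t) / g))%:E).
  rewrite EFinD !EFinM; apply: leeD; first by apply: lee_wpmul2l.
  by apply: lee_wpmul2l => //; exact: integral_expR.
rewrite lee_fin.
have p1 : p * (4 * cv * h ^+ 2) <= a * expR (g * t) * h / 8.
  have -> : p * (4 * cv * h ^+ 2) = a * expR (g * t) * h / 8 * (cv / (cv + 1)).
    rewrite /p Mdef; field.
    by rewrite !gt_eqF.
  rewrite ler_piMr//; first by rewrite !mulr_ge0 ?expR_ge0// ltW.
  by rewrite ler_pdivrMr// mul1r lerDl.
have q1 : q * (expR (g * t) / g) = a * expR (g * t) * h / 8.
  rewrite /q Mdef /g /halving_rate; field.
  by rewrite !gt_eqF//; have := g0; rewrite /g /halving_rate; nra.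
by rewrite q1; lra.
Qed.


(** With [y = a * expR (g * t) * h] the target is [y / 2]: a quarter of [y] for the integral of the
    limiting bound [q], an eighth for the passage to the limit in time and an eighth for the error
    in the representation of [eta]. *)
Lemma bound_halving a : 0 < a -> asymptotic_bound halving_rate a ->
  asymptotic_bound halving_rate (a / 2).
Proof.
move=> a0 ab t h eta tl se h0 nh; have g0 := halving_rate_gt0.
set g := halving_rate in ab g0 *.
have [t0|t0] := ltP t 0.
  apply: nearW => n; rewrite (variation_past (fv n)); last first.
    by case/andP: tl => -> _; rewrite ltW.
  rewrite ipC ip0l normr0; apply: mulr_ge0 (sqrtr_ge0 _); apply: mulr_ge0 (ltW h0).
  by apply: mulr_ge0 (expR_ge0 _); rewrite divr_ge0// ltW.
have tT : 0 <= t <= T by rewrite t0; case/andP: tl.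
have [C C0 HC] := variation_rate.
set C2 := Num.sqrt (2 * K ^+ 2 * (9 * C ^+ 2 * expR T + 1)).
have C20 : 0 <= C2 := sqrtr_ge0 _.
set y := a * expR (g * t) * h; have y0 : 0 < y := mulr_gt0 (mulr_gt0 a0 (expR_gt0 _)) h0.
(* By [variation_noise] the diffusion integrand has norm at most [C2 * r n], so this precision costs
   at most [y / 8 * r n]. *)
have k0 : 0 < y / (8 * (C2 + 1)) by rewrite divr_gt0// mulr_gt0// ltr_wpDl.
have [th [sth [Kt' bt'] nth rep]] := ito_represent basis tT se k0.
set Kt := `|Kt'|; have Kt0 : 0 <= Kt := normr_ge0 _.
have bt p : `|th p| <= Kt by rewrite (le_trans (bt' p))// ler_norm.
have mth : measurable_fun setT th by case: sth.
have mths s : measurable_fun setT (fun w => th (s, w)).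
  exact: (measurableT_comp mth (pair1_measurable s)).
(* Boundedness of [th] gives square-integrable slices at every time. Their bound [Kt] serves for
   domination only; a size comparable to [h] is recovered after integrating the squared slice
   norms. *)
have nths s : sqi P (fun w => th (s, w)) /\ nrm P (fun w => th (s, w)) <= Kt.
  have bs' w : `|th (s, w)| <= Kt by exact: bt.
  by split; [exact: (sqi_bdd P (mths s) bs')|exact: (nrm_bounded P (mths s) Kt0 bs')].
(* Covers both [h + Kt], in the domination, and [2 * h + ns s], in the pointwise limit. *)
set m := 2 * h + Kt; have m0 : 0 <= m by rewrite addr_ge0// mulr_ge0// ltW.
pose ns s := nrm P (fun w => th (s, w)).
pose G n s := ip P eta (Bd (X1 n) (E n) s) + ip P (fun w => th (s, w)) (Sd (X1 n) (E n) s).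
pose M := 96 * K * (cv + 1).
have c1 : 0 < cv + 1 by rewrite ltr_wpDl// normal_var_ge0.
have M0 : 0 < M by apply: mulr_gt0 => //; exact: mulr_gt0.
pose q s := 3 * K * a * (ns s ^+ 2 / (M * h) * expR (g * t) + (2 + M / 4) * h * expR (g * s)).
have slice s : 0 <= s <= t -> 0 <= s <= T.
  by move=> /andP[-> st]; rewrite (le_trans st)//; case/andP: tT.
pose tth := time_cut t (fun s w => th (s, w)).
have mtth : measurable_fun setT tth.
  rewrite (_ : tth = fun p => th p * \1_(`[0, t]) p.1); last first.
    apply/funext => -[s w]; rewrite /tth time_cutE/= indicE mem_itv0.
    by case: ifP; rewrite ?mulr1 ?mulr0.
  apply: measurable_funM => //.
  exact: (measurableT_comp (f := \1_(`[0, t]) : Rm -> R)).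
have mns : measurable_fun (`[0, t]%classic : set Rm) ns.
  by apply: (measurable_slice mtth) => s _; have [] := nths s.
have ins : (\int[mu]_(s in `[0%R, t]) (ns s ^+ 2)%:E <= (4 * cv * h ^+ 2)%:E)%E.
  rewrite -(integral_slice mtth); last by move=> s _; have [] := nths s.
  apply: (@le_trans _ _ (\int[Lam]_p (th p ^+ 2)%:E)%E).
    apply: ge0_le_integralT => -[s w]; first by rewrite lee_fin sqr_ge0.
    by rewrite lee_fin /tth time_cutE; case: ifP => // _; rewrite expr0n sqr_ge0.
  rewrite (ipE sth) lee_fin -nrm_sqr.
  have -> : 4 * cv * h ^+ 2 = (2 * Num.sqrt cv * h) ^+ 2.
    by rewrite !exprMn sqr_sqrtr ?normal_var_ge0//; ring.
  rewrite ler_sqr ?nnegrE ?nrm_ge0//; last first.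
    by apply: mulr_ge0 (ltW h0); rewrite mulr_ge0// sqrtr_ge0.
  by apply: (le_trans nth); rewrite ler_wpM2l.
have iq := integral_excess_bound a0 h0 t0 mns ins (erefl M).
have rhs_sqi psi dpsi n s : linear_bounds T l X u v K psi dpsi -> 0 <= s <= t ->
    sqi P (lin_rhs l X u v psi dpsi (X1 n) (E n) s).
  move=> bd /slice sT; have [d1 d2] := delay_range l0 sT.
  have [C' _ HC'] := variation_sqi (fv n).
  by have [] := lin_rhs_sqi (ltW K0) bd (E n) sT (HC' _ d1).1 (HC' _ d2).1.
have parts n : mu.-integrable (`[0, t]%classic : set Rm) (EFin \o G n) /\
    `|ip P eta (X1 n t)| <= `|\int[mu]_(s in `[0, t]) G n s| +
      y / (8 * (C2 + 1)) * (C2 * r n).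
  have [N [ito jmB jmS eqX _]] := variation_test basis l0 (ltW K0) bb (fv n).
  have sB := rhs_cut_sqi l0 (ltW K0) (fv n) bb jmB tT.
  have sS := rhs_cut_sqi l0 (ltW K0) (fv n) bs jmS tT.
  have [stens _] := tens_sqi t0 se.
  have etens s : 0 <= s <= t -> (fun w => tens t eta (s, w)) = eta.
    by move=> st; apply/funext => w; rewrite /tens/= indicE mem_itv0 st mulr1.
  have [i1 e1] := ip_slice stens sB (fun s => rhs_sqi _ _ n s bb)
    (fun s st => eq_ind_r (sqi P) se (etens s st)).
  have [i2 e2] := ip_slice sth sS (fun s => rhs_sqi _ _ n s bs)
    (fun s _ => (nths s).1).
  have {}i1 : mu.-integrable (`[0, t]%classic : set Rm)
      (fun s => (ip P eta (Bd (X1 n) (E n) s))%:E).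
    apply: eq_integrable i1 => // s; rewrite mem_itv0 => st.
    by rewrite etens.
  have {}e1 : ip Lam (tens t eta) (time_cut t (Bd (X1 n) (E n))) =
      \int[mu]_(s in `[0, t]) ip P eta (Bd (X1 n) (E n) s).
    by rewrite e1; apply: eq_Rintegral => s; rewrite mem_itv0 => st; rewrite etens.
  have mI : measurable (`[0, t]%classic : set Rm) by [].
  split; first exact: (integrableD mI i1 i2).
  have -> : \int[mu]_(s in `[0, t]) G n s = ip Lam (tens t eta) (time_cut t (Bd (X1 n) (E n)))
      + ip Lam th (time_cut t (Sd (X1 n) (E n))).
    by rewrite e1 e2 -(RintegralD mI i1 i2).
  rewrite eqX//.
  have noise := variation_noise (fv n) (mE n) (lE n) (ltW (ep n)) C0 tT sS (HC n).
  have := rep _ _ ito; move: (ip P eta (N t)) (ip Lam th _) (ip Lam (tens t eta) _) => z1 z2 z3 h1.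
  rewrite (_ : z3 + z1 = (z3 + z2) + (z1 - z2)); last by ring.
  apply: (le_trans (ler_normD _ _)); rewrite lerD2l; apply: (le_trans h1).
  by rewrite ler_wpM2l ?(ltW k0).
have dom n s : 0 <= s <= t ->
    `|G n s| <= 3 * K * m * C * r n + K * m * \1_(E n) s.
  move=> st; apply: (le_trans (ler_normD _ _)).
  have b1 := rhs_dual_bound n bb HC (slice s st) se nh.
  have b2 := rhs_dual_bound n bs HC (slice s st) (nths s).1 (nths s).2.
  apply: (le_trans (lerD b1 b2)).
  rewrite (_ : 3 * K * m * C * r n + K * m * \1_(E n) s =
    (3 * K * h * C * r n + K * h * \1_(E n) s + (3 * K * Kt * C * r n + K * Kt * \1_(E n) s))
    + K * h * (3 * (C * r n) + \1_(E n) s)); last by rewrite /m; ring.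
  rewrite lerDl; apply: mulr_ge0; first by rewrite mulr_ge0// ltW.
  by rewrite addr_ge0 ?indicr_ge0// mulr_ge0// mulr_ge0 ?sqrtr_ge0.
have lim s : 0 <= s <= t -> \forall n \near \oo,
    `|G n s| <= q s * r n + K * m * \1_(E n) s.
  move=> st; have [s1 s2] := nths s.
  have hn0 : 0 < h + ns s by rewrite ltr_pwDl// nrm_ge0.
  have hn1 : nrm P (fun w => th (s, w)) <= h + ns s by rewrite lerDr ltW.
  have a1 := rhs_dual_asymptotic bb (ltW g0) a0 ab (slice s st) se h0 nh.
  have a2 := rhs_dual_asymptotic bs (ltW g0) a0 ab (slice s st) s1 hn0 hn1.
  (* Young's inequality [ns s <= ns s ^+ 2 / (M * h) + M * h / 4]: only the square of the slice norm
     has a controlled integral. Its weight is raised to the one at [t], while the other keeps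
     [expR (g * s)] to gain from integration. *)
  have key : (2 * h + ns s) * expR (g * s) <=
      ns s ^+ 2 / (M * h) * expR (g * t) + (2 + M / 4) * h * expR (g * s).
    have est : expR (g * s) <= expR (g * t).
      by rewrite ler_expR ler_wpM2l ?(ltW g0)//; case/andP: st.
    have Mh : 0 < M * h by rewrite mulr_gt0.
    apply: (@le_trans _ _ ((ns s ^+ 2 / (M * h) + (2 + M / 4) * h) * expR (g * s))).
      rewrite ler_wpM2r ?expR_ge0// -subr_ge0.
      rewrite (_ : _ - _ = (ns s - M * h / 2) ^+ 2 / (M * h)).
        by rewrite divr_ge0 ?sqr_ge0// ltW.
      by field; rewrite !gt_eqF.
    rewrite mulrDl lerD2r ler_wpM2l// divr_ge0 ?sqr_ge0// ltW//.
  near=> n; apply: (le_trans (ler_normD _ _)).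
  apply: (@le_trans _ _ ((3 * K * h * (a * expR (g * s)) * r n + K * h * \1_(E n) s) +
    (3 * K * (h + ns s) * (a * expR (g * s)) * r n + K * (h + ns s) * \1_(E n) s))).
    by apply: lerD; near: n.
  rewrite (_ : _ + _ = 3 * K * a * ((2 * h + ns s) * expR (g * s)) * r n
    + K * (2 * h + ns s) * \1_(E n) s); last by ring.
  apply: lerD.
    rewrite ler_wpM2r ?sqrtr_ge0// ler_wpM2l//.
    by rewrite mulr_ge0 ?(ltW a0)// mulr_ge0// ltW.
  by rewrite ler_wpM2r ?indicr_ge0// ler_wpM2l ?(ltW K0)// lerD2l.
have main : \forall n \near \oo, `|\int[mu]_(s in `[0, t]) G n s| <=
    (y / 4 + y / 8) * r n.
  apply: (@limit_excess _ _ Rm mu `[0, t]%classic _ _ G q (3 * K * m * C) (K * m)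
    (y / 4) (y / 8) E eps) => //.
  - by rewrite [X in (X < _)%E](lebesgue_itv0 t0) ltry.
  - by rewrite divr_gt0.
  - by rewrite mulr_ge0// ltW.
  - by rewrite mulr_ge0// mulr_ge0// mulr_ge0// ltW.
  - by move=> n; have [] := parts n.
  - apply: measurable_funM => //; apply: measurable_funD.
      apply: measurable_funM => //; apply: measurable_funM => //.
      exact: measurable_funX.
    apply: measurable_funM => //; apply: measurable_funTS.
    by apply: (measurableT_comp (f := expR : R -> R)).
  - move=> s _; apply: mulr_ge0; first by rewrite mulr_ge0 ?(ltW a0)// mulr_ge0// ltW.
    apply: addr_ge0; apply: mulr_ge0 (expR_ge0 _).
      by rewrite divr_ge0 ?sqr_ge0// ltW// mulr_gt0.
    by apply: mulr_ge0 (ltW h0); rewrite addr_ge0// divr_ge0// ltW.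
near=> n; have [_ hp] := parts n; apply: (le_trans hp).
rewrite (_ : a / 2 * _ * h * r n = (y / 4 + y / 8) * r n + y / 8 * r n); last by rewrite /y; field.
apply: lerD; first by near: n.
rewrite mulrA ler_wpM2r ?sqrtr_ge0// invfM mulrA -mulrA ler_piMr//.
  by rewrite divr_ge0// ltW.
have C21 : 0 < C2 + 1 by rewrite ltr_wpDl.
by rewrite mulrC ler_pdivrMr// mul1r lerDl.
Unshelve. all: by end_near. Qed.

Lemma variation_weakly_small eta t e : sqi P eta -> - l <= t <= T -> 0 < e ->
  \forall n \near \oo, `|ip P eta (X1 n t)| <= e * r n.
Proof.
move=> se tl e0; have [C C0 HC] := variation_rate.
have g0 := halving_rate_gt0; set g := halving_rate in g0.
(* Times start at [- l], where the weight is [expR (- (g * l))]; this factor makes the total weight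
   at least 1, and [C + 1] makes [a] positive. *)
pose a := (C + 1) * expR (g * l).
have a0 : 0 < a by rewrite mulr_gt0 ?expR_gt0// ltr_wpDl.
have base : asymptotic_bound halving_rate a.
  move=> s h f sT sf h0 fh; apply: nearW => n.
  have [C' _ HC'] := variation_sqi (fv n).
  apply: (le_trans (cauchy_schwarz sf (HC' _ sT).1)).
  rewrite [leRHS](_ : _ = h * ((C + 1) * expR (g * l) * expR (g * s) * r n)); last first.
    by rewrite /a -/g; ring.
  apply: ler_pM => //; try exact: nrm_ge0.
  apply: (le_trans (HC n s sT)); rewrite ler_wpM2r ?sqrtr_ge0// -mulrA -expRD.
  have : 1 <= expR (g * l + g * s).
    rewrite -expR0 ler_expR -mulrDr; apply: mulr_ge0; first exact: ltW.
    by case/andP: sT; lra.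
  by move: (expR _) => z z1; nra.
have iter k : asymptotic_bound halving_rate (a / 2 ^+ k).
  elim: k => [|k IH]; first by rewrite expr0 divr1.
  rewrite exprSr invfM mulrA; apply: bound_halving => //.
  by rewrite divr_gt0// exprn_gt0.
pose h := nrm P eta + 1; have h0 : 0 < h by rewrite ltr_wpDl// nrm_ge0.
pose y := a * expR (g * t) * h; have y0 : 0 < y := mulr_gt0 (mulr_gt0 a0 (expR_gt0 _)) h0.
(* Finitely many halvings suffice for a given [e], so the eventual bounds are never intersected
   infinitely often. *)
have [k hk] : exists k, y / 2 ^+ k <= e.
  exists (Num.bound (y / e)); rewrite ler_pdivrMr ?exprn_gt0// mulrC -ler_pdivrMr//.
  apply: (le_trans (ltW (archi_boundP _))); first by rewrite divr_ge0// ltW.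
  by rewrite -natrX ler_nat ltnW// ltn_expl.
have := iter k t h eta tl se h0; rewrite lerDl => /(_ ler01).
apply: filterS => n hn; apply: (le_trans hn); rewrite ler_wpM2r ?sqrtr_ge0//.
by apply: le_trans hk; rewrite le_eqVlt /y -/g; apply/orP; left; apply/eqP; ring.
Qed.

End weak_limit.

(** * Copies and the limit of the cost *)

Section copies.
Context (R : realType) (d : measure_display) (Om : measurableType d)
  (P : probability Om R) (d' : measure_display) (Omb : measurableType d')
  (Pb : probability Omb R) (copy : {mfun Omb >-> Om}).
Hypothesis copyP : is_copy P Pb copy.

Lemma integral_pushforward_copy (f : Om -> \bar R) :
  (\int[pushforward Pb copy]_w f w = \int[P]_w f w)%E.
Proof.
apply: eq_measure_integral => A mA _; exact: (copyP mA).
Qed.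

Lemma copy_sqi (f : Om -> R) : sqi P f -> sqi Pb (f \o copy).
Proof.
move=> [mf fin]; have mfc : measurable_fun setT (f \o copy) by exact: measurableT_comp.
split => //.
rewrite -[X in (X < _)%E](@ge0_integral_pushforward _ _ _ _ _ copy _ Pb setT
  (fun w => ((f w) ^+ 2)%:E))//.
- by rewrite integral_pushforward_copy.
- by apply/measurable_EFinP; exact: measurable_funX.
- by move=> w _; rewrite lee_fin sqr_ge0.
Qed.

Lemma copy_ip (f g : Om -> R) : sqi P f -> sqi P g ->
  ip Pb (f \o copy) (g \o copy) = ip P f g.
Proof.
move=> sf sg; have i := sqi_integrableM (copy_sqi sf) (copy_sqi sg).
rewrite /ip /Rintegral -(integral_pushforward_copy (fun w => (f w * g w)%:E)).
congr fine; rewrite integral_pushforward//.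
by apply/measurable_EFinP; apply: measurable_funM; [case: sf|case: sg].
Qed.

Lemma copy_nrm (f : Om -> R) : sqi P f -> nrm Pb (f \o copy) = nrm P f.
Proof. by move=> sf; rewrite /nrm copy_ip. Qed.

(** Up to the error [k], [zeta] represents the conditional expectation of [eta] given [copy];
    composition with [copy] is an isometry, so pairings of copies are pairings under [P]. *)
Lemma copy_projection (eta : Omb -> R) k : sqi Pb eta -> 0 < k ->
  exists2 zeta, sqi P zeta & forall f, sqi P f ->
    `|ip Pb eta (f \o copy) - ip P zeta f| <= k * nrm P f.
Proof.
move=> se k0.
pose K := [set f \o copy | f in [set f | sqi P f]].
have K0 : K (cst 0) by exists (cst 0) => //; exact: sqi0.
have KD a f g : K f -> K g -> K (fun x => f x + a * g x).
  move=> [f1 sf <-] [g1 sg <-]; exists (fun w => f1 w + a * g1 w) => //.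
  by apply: sqiD => //; exact: sqiZ.
have Ks f : K f -> sqi Pb f by move=> [f1 sf <-]; exact: copy_sqi.
have [_ [[z sz <-] _ zP]] := near_projection K0 KD Ks se k0.
exists z => // f sf.
have := zP (f \o copy); rewrite ipBl//; try exact: copy_sqi.
rewrite (copy_ip sz sf) (copy_nrm sf); apply.
by exists f.
Qed.

End copies.

Section measurable_integral.
Context (R : realType) (d1 d2 : measure_display) (T1 : measurableType d1)
  (T2 : measurableType d2) (m2 : {sigma_finite_measure set T2 -> \bar R}).

(** Positive and negative parts are treated separately by Tonelli, so the integral depends
    measurably on the parameter even where a section is not integrable. *)
Lemma measurable_integral_param (f : T1 * T2 -> R) : measurable_fun setT f ->
  measurable_fun setT (fun x => \int[m2]_y (f (x, y))%:E)%E.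
Proof.
move=> mf; have mfE : measurable_fun setT (EFin \o f) by exact/measurable_EFinP.
have mp := @measurable_fun_fubini_tonelli_F _ _ T1 T2 R m2 _ (measurable_funepos mfE) (funepos_ge0 _).
have mn := @measurable_fun_fubini_tonelli_F _ _ T1 T2 R m2 _ (measurable_funeneg mfE) (funeneg_ge0 _).
rewrite (_ : (fun x => _) = fubini_F m2 (EFin \o f)^\+ \- fubini_F m2 (EFin \o f)^\-)%E.
  exact: emeasurable_funB.
apply/funext => x; rewrite [LHS]integralE /fubini_F.
by congr (_ - _)%E; apply: eq_integral => y _; rewrite ?funeposE ?funenegE.
Qed.

End measurable_integral.

Section weak_copy.
Context (R : realType) (d : measure_display) (Om : measurableType d)
  (P : probability Om R) (d' : measure_display) (Omb : measurableType d')
  (Pb : probability Omb R) (copy : {mfun Omb >-> Om}).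
Hypothesis copyP : is_copy P Pb copy.
Variables (r : nat -> R) (C : R) (xi : nat -> Om -> R).
Hypotheses (r0 : forall n, 0 < r n) (C0 : 0 <= C).
Hypothesis xiP : forall n, sqi P (xi n) /\ nrm P (xi n) <= C * r n.
Hypothesis weak : forall eta (e : R), sqi P eta -> 0 < e ->
  \forall n \near \oo, `|ip P eta (xi n)| <= e * r n.

Lemma weak_copy eta (e : R) : sqi Pb eta -> 0 < e ->
  \forall n \near \oo, `|ip Pb eta (xi n \o copy)| <= e * r n.
Proof.
move=> se e0; have C1 : 0 < C + 1 by rewrite ltr_wpDl.
(* Half of [e] pays for the projection error, which is relative to [nrm P (xi n)], at most
   [(C + 1) * r n]. *)
have k0 : 0 < e / 2 / (C + 1) by rewrite !divr_gt0.
have [z sz zP] := copy_projection copyP se k0.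
have e2 : 0 < e / 2 by rewrite divr_gt0.
have := weak sz e2; apply: filterS => n h; have [sx nx] := xiP n.
rewrite -(subrK (ip P z (xi n)) (ip Pb eta _)).
apply: (le_trans (ler_normD _ _)); rewrite (splitr e) mulrDl; apply: lerD => //.
have hx : nrm P (xi n) <= (C + 1) * r n.
  by apply: (le_trans nx); rewrite ler_wpM2r ?(ltW (r0 n))// lerDl.
apply: (le_trans (zP _ sx)); apply: (le_trans (ler_wpM2l (ltW k0) hx)).
by rewrite mulrA divfK// gt_eqF.
Qed.

Variables (psi1 : Om * Omb -> R) (psi2 : Omb -> R) (B D : R).
Hypotheses (B0 : 0 <= B) (m1 : measurable_fun setT psi1).
Hypothesis b1 : {ae (P \x Pb)%E, forall p, `|psi1 p| <= B}.
Hypotheses (s2 : sqi Pb psi2) (n2 : nrm Pb psi2 <= D).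


Local Notation mean n w :=
  (\int[Pb]_wb (psi1 (w, wb) * psi2 wb * xi n (copy wb))%:E)%E.

(** The bound on [psi1] holds almost everywhere on the product, so a given section may violate it.
    Truncation bounds every section and changes [psi1] on a null set only. *)
Let chi (p : Om * Omb) : R := Num.max (- B) (Num.min B (psi1 p)).

Let chi_bound p : `|chi p| <= B.
Proof.
rewrite /chi ler_norml le_max lexx/= ge_max ge_min lexx andbT.
by rewrite (le_trans _ B0)// oppr_le0.
Qed.

Let chi_id p : `|psi1 p| <= B -> chi p = psi1 p.
Proof.
by rewrite ler_norml => /andP[h1 h2]; rewrite /chi (min_idPr h2) (max_idPr h1).
Qed.

Let mchi : measurable_fun setT chi.
Proof. by apply: measurable_maxr => //; exact: measurable_minr. Qed.

Let eta w wb : R := chi (w, wb) * psi2 wb.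

Let eta_sqi w : sqi Pb (eta w) /\ nrm Pb (eta w) <= B * D.
Proof.
have mw : measurable_fun setT (fun wb => chi (w, wb)).
  exact: (measurableT_comp mchi (pair1_measurable w)).
have [sc nc] := nrm_mulb mw B0 (fun wb => chi_bound (w, wb)) s2.
by split => //; apply: (le_trans nc); rewrite ler_wpM2l.
Qed.

(** Tonelli for the distance between [chi] and [psi1] passes from a null set of the product to null
    sections. *)
Let chi_ae : {ae P, forall w, {ae Pb, forall wb, chi (w, wb) = psi1 (w, wb)}}.
Proof.
have mdE : measurable_fun setT (fun p => `|chi p - psi1 p|%:E).
  by apply/measurable_EFinP; apply: measurableT_comp => //; exact: measurable_funB.
have d0 p : (0 <= `|chi p - psi1 p|%:E)%E by rewrite lee_fin.
have z : (\int[(P \x Pb)%E]_p `|chi p - psi1 p|%:E = 0)%E.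
  rewrite (ae_eq_integral (cst 0%E))//; first by rewrite integral0.
  by move: b1; apply: filterS => p h _ /=; rewrite chi_id// subrr normr0.
rewrite (fubini_tonelli1 _ mdE d0) in z.
have mF := @measurable_fun_fubini_tonelli_F _ _ _ _ R Pb _ mdE d0.
have F0 w : (0 <= fubini_F Pb (fun p => `|chi p - psi1 p|%:E) w)%E by exact: integral_ge0.
have /ae_eq_integral_abs : (\int[P]_w `|fubini_F Pb (fun p => `|chi p - psi1 p|%:E) w| = 0)%E.
  by under eq_integral do rewrite gee0_abs//.
move=> /(_ measurableT mF); apply: filterS => w /(_ I) /= zw.
have mw : measurable_fun setT (fun wb => `|chi (w, wb) - psi1 (w, wb)|%:E).
  exact: (measurableT_comp mdE (pair1_measurable w)).
have /ae_eq_integral_abs : (\int[Pb]_wb `| `|chi (w, wb) - psi1 (w, wb)|%:E| = 0)%E.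
  by under eq_integral do rewrite gee0_abs//.
move=> /(_ measurableT mw); apply: filterS => wb /(_ I) /= [/eqP].
by rewrite normr_eq0 subr_eq0 => /eqP.
Qed.

Let mean_eta n : {ae P, forall w, mean n w = (ip Pb (eta w) (xi n \o copy))%:E}.
Proof.
have [sx _] := xiP n; have sc := copy_sqi copyP sx.
have mx : measurable_fun setT (xi n \o copy) by case: sc.
have mp2 : measurable_fun setT psi2 by case: s2.
apply: filterS chi_ae => w h; have [se _] := eta_sqi w.
have i := sqi_integrableM se sc.
rewrite /ip /Rintegral fineK; last exact: integrable_fin_num.
apply: ae_eq_integral => //.
- apply/measurable_EFinP; apply: measurable_funM => //; apply: measurable_funM => //.
  exact: (measurableT_comp m1 (pair1_measurable w)).
- by case/integrableP: i.
- by move: h; apply: filterS => wb hwb _; rewrite /eta/= hwb.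
Qed.

Let measurable_eta n : measurable_fun setT (fun w => ip Pb (eta w) (xi n \o copy)).
Proof.
have [sx _] := xiP n; have sc := copy_sqi copyP sx.
have mx : measurable_fun setT (xi n \o copy) by case: sc.
have mp2 : measurable_fun setT psi2 by case: s2.
apply: (measurableT_comp (f := fine)) => //.
apply: (@measurable_integral_param _ _ _ _ _ Pb (fun p => chi p * psi2 p.2 * (xi n \o copy) p.2)).
by apply: measurable_funM; [apply: measurable_funM => //|]; exact: measurableT_comp.
Qed.

Let integral_mean n : (\int[P]_w (`|mean n w| ^+ 4) =
  \int[P]_w ((ip Pb (eta w) (xi n \o copy)) ^+ 4)%:E)%E.
Proof.
have [sx _] := xiP n; have sc := copy_sqi copyP sx.
have mx : measurable_fun setT (xi n \o copy) by case: sc.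
have mp2 : measurable_fun setT psi2 by case: s2.
apply: ge0_ae_eq_integral => //.
- pose m w := (`|mean n w|)%E; have mm : measurable_fun setT m; last first.
    exact: (emeasurable_funM mm (emeasurable_funM mm (emeasurable_funM mm mm))).
  apply: measurableT_comp => //.
  apply: (@measurable_integral_param _ _ _ _ _ Pb (fun p => psi1 p * psi2 p.2 * (xi n \o copy) p.2)).
  by apply: measurable_funM; [apply: measurable_funM => //|]; exact: measurableT_comp.
- by apply/measurable_EFinP; exact: measurable_funX.
- by move=> w _; rewrite expe_ge0.
- by move=> w _; rewrite lee_fin exprn_even_ge0.
- move: (mean_eta n); apply: filterS => w -> _.
  by rewrite abse_EFin -EFin_expe -normrX ger0_norm// exprn_even_ge0.
Qed.

Lemma mean_bound n : (\int[P]_w (`|mean n w| ^+ 4) <= ((B * D * C * r n) ^+ 4)%:E)%E.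
Proof.
rewrite integral_mean.
apply: (@le_trans _ _ (\int[P]_w ((B * D * C * r n) ^+ 4)%:E)%E); last first.
  by rewrite integral_cst// [X in (_ * X)%E]probability_setT mule1.
apply: ge0_le_integralT => w; first by rewrite lee_fin exprn_even_ge0.
have [se ne] := eta_sqi w; have [sx nx] := xiP n.
have cs := cauchy_schwarz se (copy_sqi copyP sx); rewrite (copy_nrm copyP sx) in cs.
rewrite lee_fin -[leLHS]ger0_norm ?exprn_even_ge0// normrX.
apply: lerXn2r; rewrite ?nnegrE//.
  apply: mulr_ge0 (ltW (r0 n)); apply: mulr_ge0 => //.
  exact: le_trans (nrm_ge0 _ _) ne.
apply: (le_trans cs); rewrite -[leRHS]mulrA.
  exact: (ler_pM (nrm_ge0 _ _) (nrm_ge0 _ _) ne nx).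
Qed.

Lemma mean_limit (e : R) : 0 < e ->
  \forall n \near \oo, (\int[P]_w (`|mean n w| ^+ 4) <= (e * r n ^+ 4)%:E)%E.
Proof.
move=> e0; pose g n w := (ip Pb (eta w) (xi n \o copy) / r n) ^+ 4.
have mg n : measurable_fun setT (g n).
  by apply: measurable_funX; apply: measurable_funM => //; exact: measurable_eta.
have P1 : (P setT < +oo)%E by rewrite probability_setT ltry.
have g0 n w : 0 <= g n w by rewrite exprn_even_ge0.
have := @bounded_cvg0 _ _ _ P setT measurableT P1 g ((B * D * C) ^+ 4) e e0 mg.
have gB n w : setT w -> 0 <= g n w <= (B * D * C) ^+ 4.
  move=> _; rewrite g0/=; have [se ne] := eta_sqi w; have [sx nx] := xiP n.
  have cs := cauchy_schwarz se (copy_sqi copyP sx); rewrite (copy_nrm copyP sx) in cs.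
  rewrite -[leLHS]ger0_norm// /g normrX.
  have BD : 0 <= B * D by exact: le_trans (nrm_ge0 _ _) ne.
  apply: lerXn2r; rewrite ?nnegrE//; first exact: mulr_ge0 BD C0.
  rewrite normrM normfV (gtr0_norm (r0 n)) ler_pdivrMr//.
  apply: (le_trans cs); rewrite -[leRHS]mulrA.
  exact: (ler_pM (nrm_ge0 _ _) (nrm_ge0 _ _) ne nx).
move=> /(_ gB) H; have {}H : \forall n \near \oo, (\int[P]_w (g n w)%:E <= e%:E)%E.
  apply: H => w e' _ e'0.
  (* Below 1 a fourth power is at most the number itself, so smallness of the pairing passes to its
     fourth power. *)
  have e1 : 0 < Num.min 1 e' by rewrite lt_min ltr01.
  have [se _] := eta_sqi w; have := weak_copy se e1; apply: filterS => n h.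
  rewrite -[leLHS]ger0_norm// /g normrX normrM normfV (gtr0_norm (r0 n)).
  have : `|ip Pb (eta w) (xi n \o copy)| / r n <= Num.min 1 e' by rewrite ler_pdivrMr.
  rewrite le_min => /andP[x1 xe].
  apply: le_trans xe; rewrite exprS ler_piMr//; first by rewrite divr_ge0// ltW.
  by rewrite exprn_ile1// divr_ge0// ltW.
apply: filterS H => n h; rewrite integral_mean.
have -> : (\int[P]_w ((ip Pb (eta w) (xi n \o copy)) ^+ 4)%:E =
    \int[P]_w ((r n ^+ 4)%:E * (g n w)%:E))%E.
  apply: eq_integral => w _; rewrite -EFinM /g expr_div_n mulrC divfK//.
  by rewrite expf_neq0// gt_eqF.
rewrite ge0_integralZl//.
- apply: (@le_trans _ _ ((r n ^+ 4)%:E * e%:E)%E); last by rewrite -EFinM mulrC.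
  by apply: lee_wpmul2l => //; rewrite lee_fin exprn_even_ge0.
- exact/measurable_EFinP.
- by move=> w _; rewrite lee_fin.
- by rewrite lee_fin exprn_even_ge0.
Qed.

End weak_copy.

(** * Joint measurability in time and integration over the time interval *)

Section jointly_measurable.
Context (R : realType).
Local Notation Rm := (measurableTypeR R).

Lemma measurable_patch_time dT (T : measurableType dT) (H : T * R -> R) (a b : R) :
  measurable_fun (setT `*` `[a, b]) H ->
  measurable_fun setT ((H : T * Rm -> R) \_ (setT `*` `[a, b])).
Proof.
move=> mH; have mD : measurable (setT `*` `[a, b]%classic : set (T * Rm)).
  exact: measurableX.
exact: (measurable_restrictT _ mD).1 mH.
Qed.

(** Paths are continuous in time and measurable at each fixed time, hence jointly measurable; the
    time is clamped because continuity is known on [[a, b]] only. *)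
Lemma measurable_paths d (Om : measurableType d) (P : probability Om R)
    (X : R -> {RV P >-> R}) (a b : R) : a <= b ->
  (forall w, {within `[a, b], continuous (fun t => X t w)}) ->
  measurable_fun setT (fun p : Rm * Om => X (Num.max a (Num.min b p.1)) p.2).
Proof.
move=> ab cX; pose clamp (t : R) := Num.max a (Num.min b t).
have clampS t : `[a, b]%classic (clamp t).
  by rewrite /= in_itv/= /clamp le_max lexx/= ge_max ab ge_min lexx.
apply: (@measurable_caratheodory R _ (Rm * Om)%type `[a, b]%classic (fun p => clamp p.1)
  (fun y p => X y p.2)).
- by apply: measurable_maxr => //; exact: measurable_minr.
- by move=> p; exact: clampS.
- by move=> y _; exact: measurableT_comp.
move=> [t w] e e0 /=; have := cX w; move=> /subspace_continuousP /(_ _ (clampS t)).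
move/cvgrPdist_lt => /(_ _ e0) /= /nbhs_ballP[r /= r0 H]; exists r => //.
move=> y Sy yr; rewrite distrC; apply: H => //.
by rewrite /ball/= distrC.
Qed.

End jointly_measurable.

Section spike_cost.
Context (R : realType) (d : measure_display) (Om : measurableType d)
  (P : probability Om R) (d' : measure_display) (Omb : measurableType d')
  (Pb : probability Omb R) (copy : {mfun Omb >-> Om}).
Variables (l T : R) (Psi1 : Om -> Omb -> R -> R) (Psi2 : Omb -> R -> R).
Local Notation Rm := (measurableTypeR R).
Local Notation mu := (@lebesgue_measure R).
Hypotheses (l0 : 0 < l) (T0 : 0 < T).
Hypothesis m1 : measurable_fun ([set: Om * Omb] `*` `[- l, T])
  (fun p : (Om * Omb) * R => Psi1 p.1.1 p.1.2 p.2).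
Hypothesis m2 : measurable_fun ([set: Omb] `*` `[- l, T])
  (fun p : Omb * R => Psi2 p.1 p.2).

Definition copy_mean (xi : R -> {RV P >-> R}) (w : Om) (t : R) : \bar R :=
  (\int[Pb]_wb (Psi1 w wb t * Psi2 wb t * xi t (copy wb))%:E)%E.

Lemma mem_spike_interval T1 (x : T1) (t : Rm) :
  ((x, t) \in ([set: T1] `*` `[- l, T]%classic)) = (- l <= t <= T).
Proof. by apply/idP/idP; rewrite inE/= in_itv/= => h; [case: h|split]. Qed.

(** Outside [[- l, T]] the processes [Psi1] and [Psi2] are set to 0 and the time of [xi] is clamped,
    which gives a function measurable on the whole product, ready for Tonelli. *)
Lemma copy_mean_measurable (xi : R -> {RV P >-> R}) :
  (forall w, {within `[- l, T], continuous (fun t => xi t w)}) ->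
  exists2 h : Om * Rm -> \bar R, measurable_fun setT h &
    forall w t, h (w, t) = if - l <= t <= T then copy_mean xi w t else 0%E.
Proof.
move=> cxi; have lT : - l <= T by have := l0; have := T0; lra.
have p1 := measurable_patch_time m1; have p2 := measurable_patch_time m2.
have p3 := measurable_paths lT cxi.
pose h (p : Om * Rm) := (\int[Pb]_wb (
  ((fun q : (Om * Omb) * Rm => Psi1 q.1.1 q.1.2 q.2) \_ (setT `*` `[- l, T])) ((p.1, wb), p.2) *
  ((fun q : Omb * Rm => Psi2 q.1 q.2) \_ (setT `*` `[- l, T])) (wb, p.2) *
  xi (Num.max (- l) (Num.min T p.2)) (copy wb))%:E)%E.
exists h.
  apply: (@measurable_integral_param _ _ _ (Om * Rm)%type Omb Pb (fun p =>
    ((fun q : (Om * Omb) * Rm => Psi1 q.1.1 q.1.2 q.2) \_ (setT `*` `[- l, T])) ((p.1.1, p.2), p.1.2) *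
    ((fun q : Omb * Rm => Psi2 q.1 q.2) \_ (setT `*` `[- l, T])) (p.2, p.1.2) *
    xi (Num.max (- l) (Num.min T p.1.2)) (copy p.2))).
  have f1 : measurable_fun setT (fun p : (Om * Rm) * Omb => p.1.1) by exact: measurableT_comp.
  have f2 : measurable_fun setT (fun p : (Om * Rm) * Omb => p.1.2) by exact: measurableT_comp.
  have f3 : measurable_fun setT (fun p : (Om * Rm) * Omb => p.2) by exact: measurable_snd.
  have f4 : measurable_fun setT (fun p : (Om * Rm) * Omb => copy p.2) by exact: measurableT_comp.
  apply: measurable_funM; first apply: measurable_funM.
  - exact: (measurableT_comp p1 (measurable_fun_pair (measurable_fun_pair f1 f3) f2)).
  - exact: (measurableT_comp p2 (measurable_fun_pair f3 f2)).
  - exact: (measurableT_comp p3 (measurable_fun_pair f2 f4)).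
move=> w t; rewrite /h /=; case: ifPn => tI.
  apply: eq_integral => wb _; rewrite !patchE !mem_spike_interval tI/=.
  by case/andP: tI => h1 h2; rewrite (min_idPr h2) (max_idPr h1).
by apply: integral0_eq => wb _; rewrite !patchE !mem_spike_interval (negbTE tI) !mul0r.
Qed.

Lemma spike_cost_swap (xi : R -> {RV P >-> R}) :
  (forall w, {within `[- l, T], continuous (fun t => xi t w)}) ->
  measurable_fun (`[- l, T]%classic : set Rm)
    (fun t => \int[P]_w (`|copy_mean xi w t| ^+ 4))%E /\
  (\int[P]_w \int[mu]_(t in `[(- l)%R, T]) (`|copy_mean xi w t| ^+ 4) =
   \int[mu]_(t in `[(- l)%R, T]) \int[P]_w (`|copy_mean xi w t| ^+ 4))%E.
Proof.
move=> /copy_mean_measurable[h mh hE].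
have mh4 : measurable_fun setT (fun p => `|h p| ^+ 4)%E.
  have ma : measurable_fun setT (fun p => `|h p|)%E by exact: measurableT_comp.
  exact: (emeasurable_funM ma (emeasurable_funM ma (emeasurable_funM ma ma))).
have h0 p : (0 <= `|h p| ^+ 4)%E by rewrite expe_ge0.
have mem (t : Rm) : (t \in `[- l, T]%classic) = (- l <= t <= T).
  by apply/idP/idP; rewrite inE/= in_itv.
have zero : (`|0%E| ^+ 4 = 0 :> \bar R)%E by rewrite abse0; exact: mul0e.
split.
  have mG := @measurable_fun_fubini_tonelli_G _ _ Om Rm R P _ mh4 h0.
  apply: (eq_measurable_fun _ _ (measurable_funTS mG)) => t; rewrite mem => tI.
  by rewrite /fubini_G; apply: eq_integral => w _; rewrite hE tI.
transitivity (\int[P]_w \int[mu]_t (`|h (w, t)| ^+ 4))%E.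
  apply: eq_integral => w _; rewrite integral_mkcond; apply: eq_integral => t _.
  by rewrite patchE mem hE; case: ifP.
rewrite (@fubini_tonelli _ _ Om Rm R P mu _ mh4 h0) [RHS]integral_mkcond.
apply: eq_integral => t _; rewrite patchE mem; case: ifPn => tI.
  by apply: eq_integral => w _; rewrite hE tI.
by apply: integral0_eq => w _; rewrite hE (negbTE tI).
Qed.


Lemma spike_sections t : - l <= t <= T ->
  measurable_fun setT (fun p : Om * Omb => Psi1 p.1 p.2 t) /\
  measurable_fun setT (fun wb => Psi2 wb t).
Proof.
move=> tI; have p1 := measurable_patch_time m1; have p2 := measurable_patch_time m2.
split.
  have q1 := measurableT_comp p1 (pair2_measurable (t : Rm)).
  apply: (eq_measurable_fun _ _ q1) => -[w wb] _ /=.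
  by rewrite patchE mem_spike_interval tI.
have q2 := measurableT_comp p2 (pair2_measurable (t : Rm)).
by apply: (eq_measurable_fun _ _ q2) => wb _ /=; rewrite patchE mem_spike_interval tI.
Qed.

Lemma moment_L2 : (exists C : R,
    (\int[Pb]_wb ereal_sup [set (`|Psi2 wb t| `^ (2 * 1))%:E
                           | t in `[(- l)%R, T]] <= C%:E)%E) ->
  exists2 D : R, 0 <= D & forall t, - l <= t <= T ->
    sqi Pb (Psi2 ^~ t) /\ nrm Pb (Psi2 ^~ t) <= D.
Proof.
move=> [C HC]; exists (Num.sqrt `|C|) => [|t tI]; first exact: sqrtr_ge0.
have [_ m] := spike_sections tI.
have le : (\int[Pb]_wb ((Psi2 wb t) ^+ 2)%:E <= C%:E)%E.
  apply: le_trans HC; apply: ge0_le_integralT => wb; first by rewrite lee_fin sqr_ge0.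
  apply: ereal_sup_ubound; exists t; first by rewrite /= in_itv.
  by rewrite mulr1 powR_mulrn// real_normK ?num_real.
have s2 : sqi Pb (Psi2 ^~ t) by split => //; exact: le_lt_trans le (ltry _).
split => //; apply: le_sqrt_of_sqr => //; rewrite nrm_sqr.
by move: le; rewrite ipE// lee_fin => /le_trans; apply; exact: ler_norm.
Qed.

Hypothesis copyP : is_copy P Pb copy.
Variables (B D C : R) (eps : nat -> R) (xi : nat -> R -> {RV P >-> R}).
Hypotheses (B0 : 0 <= B) (C0 : 0 <= C) (ep : forall n, 0 < eps n).
Hypothesis b1 : forall t, - l <= t <= T ->
  {ae (P \x Pb)%E, forall p, `|Psi1 p.1 p.2 t| <= B}.
Hypothesis b2 : forall t, - l <= t <= T ->
  sqi Pb (Psi2 ^~ t) /\ nrm Pb (Psi2 ^~ t) <= D.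
Hypothesis cxi : forall n w, {within `[- l, T], continuous (fun t => xi n t w)}.
Hypothesis xiP : forall n t, - l <= t <= T ->
  sqi P (xi n t) /\ nrm P (xi n t) <= C * Num.sqrt (eps n).
Hypothesis weak : forall eta t (e : R), sqi P eta -> - l <= t <= T -> 0 < e ->
  \forall n \near \oo, `|ip P eta (xi n t)| <= e * Num.sqrt (eps n).

Local Notation cost n := (\int[P]_w \int[mu]_(t in `[(- l)%R, T])
  (`|copy_mean (xi n) w t| ^+ 4))%E.
Local Notation mean_cost n t := (\int[P]_w (`|copy_mean (xi n) w t| ^+ 4))%E.

Let r4 n : Num.sqrt (eps n) ^+ 4 = eps n ^+ 2.
Proof. by rewrite (exprM _ 2 2) sqr_sqrtr// ltW. Qed.

Let r0 n : 0 < Num.sqrt (eps n). Proof. by rewrite sqrtr_gt0. Qed.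

Let mean_cost_bound n t : - l <= t <= T ->
  (mean_cost n t <= ((B * D * C) ^+ 4 * eps n ^+ 2)%:E)%E.
Proof.
move=> tI; have [f1 f2] := spike_sections tI; have [s2 n2] := b2 tI.
have := mean_bound copyP r0 C0 (fun n => xiP n tI) B0 f1 (b1 tI) s2 n2 n.
by rewrite -(r4 n) -exprMn.
Qed.

Let lebesgue_length : mu (`[(- l)%R, T]%classic : set Rm) = (T + l)%:E.
Proof.
by rewrite lebesgue_measure_itv/= lte_fin ifT -?EFinB ?opprK//; have := l0; have := T0; lra.
Qed.

Let mean_cost_ge0 n t : (0 <= mean_cost n t)%E.
Proof. by apply: integral_ge0 => w _; rewrite expe_ge0. Qed.

(** Makes the cost finite, so that its real part loses nothing in the definition of [rho]. *)
Lemma spike_cost_bound n : (cost n <= ((B * D * C) ^+ 4 * eps n ^+ 2 * (T + l))%:E)%E.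
Proof.
have [mc ->] := spike_cost_swap (@cxi n).
apply: (@le_trans _ _ (\int[mu]_(t in `[(- l)%R, T]) ((B * D * C) ^+ 4 * eps n ^+ 2)%:E)%E).
  apply: ge0_le_integral => //.
  by move=> t; rewrite /= in_itv/=; exact: mean_cost_bound.
by rewrite integral_cst// [X in (_ * X)%E]lebesgue_length -EFinM.
Qed.

Lemma spike_cost_limit (e : R) : 0 < e ->
  \forall n \near \oo, (cost n <= (e * eps n ^+ 2)%:E)%E.
Proof.
(* On [[- l, T]] each mean cost is finite by [mean_cost_bound], which also dominates these quotients
   uniformly in [n] and [t]. *)
move=> e0; pose g n (t : Rm) := fine (mean_cost n t) / eps n ^+ 2.
have e2 n : 0 < eps n ^+ 2 by rewrite exprn_gt0.
have fin n t : - l <= t <= T -> mean_cost n t \is a fin_num.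
  move=> tI; rewrite ge0_fin_numE//.
  exact: le_lt_trans (mean_cost_bound n tI) (ltry _).
have mg n : measurable_fun (`[- l, T]%classic : set Rm) (g n).
  apply: measurable_funM => //; have [mc _] := spike_cost_swap (@cxi n).
  exact: (measurableT_comp (fine_measurable _) mc).
have gB n t : `[- l, T]%classic t -> 0 <= g n t <= (B * D * C) ^+ 4.
  rewrite /= in_itv/= => tI; rewrite (divr_ge0 (fine_ge0 (mean_cost_ge0 n t)) (ltW (e2 n)))/=.
  by rewrite ler_pdivrMr// -lee_fin fineK ?fin// mean_cost_bound.
have gl (t : Rm) (e' : R) : `[- l, T]%classic t -> 0 < e' -> \forall n \near \oo, g n t <= e'.
  rewrite /= in_itv/= => tI e'0; have [f1 f2] := spike_sections tI; have [s2 n2] := b2 tI.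
  have := mean_limit copyP r0 C0 (fun n => xiP n tI)
    (fun eta e se => weak se tI) B0 f1 (b1 tI) s2 n2 e'0.
  apply: filterS => n h; rewrite ler_pdivrMr// -lee_fin fineK ?fin//.
  by rewrite -r4.
have lebesgue_fin : (mu (`[(- l)%R, T]%classic : set Rm) < +oo)%E.
  by rewrite [X in (X < _)%E]lebesgue_length ltry.
have := @bounded_cvg0 _ _ Rm mu `[- l, T]%classic _ lebesgue_fin g _ e e0 mg gB gl.
move=> /(_ (measurable_itv _)); apply: filterS => n h.
have [_ ->] := spike_cost_swap (@cxi n).
have -> : (\int[mu]_(t in `[(- l)%R, T]) mean_cost n t =
    \int[mu]_(t in `[(- l)%R, T]) ((eps n ^+ 2)%:E * (g n t)%:E))%E.
  apply: eq_integral => t; rewrite inE/= in_itv/= => tI.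
  by rewrite -EFinM /g mulrC divfK ?gt_eqF// fineK ?fin.
rewrite ge0_integralZl//.
- apply: (@le_trans _ _ ((eps n ^+ 2)%:E * e%:E)%E); last by rewrite -EFinM mulrC.
  by apply: lee_wpmul2l => //; rewrite lee_fin ltW.
- exact/measurable_EFinP.
- by move=> t tI; rewrite lee_fin; case/andP: (gB n t tI).
- by rewrite lee_fin ltW.
Qed.

End spike_cost.

Lemma linear_bounds_le (R : realType) d (Om : measurableType d) (P : probability Om R)
    (T l : R) (X u v : R -> {RV P >-> R}) (K K' : R) psi dpsi : K <= K' ->
  linear_bounds T l X u v K psi dpsi -> linear_bounds T l X u v K' psi dpsi.
Proof.
move=> KK H s /H[[m1 b1] [m2 b2] [m3 b3] [s4 b4]].
split; (split; [by []|]).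
- by move=> w; exact: le_trans (b1 w) KK.
- by move=> w; exact: le_trans (b2 w) KK.
- by move=> p; exact: le_trans (b3 p) KK.
- exact: le_trans b4 KK.
Qed.

Theorem lemma3p1 (R : realType)
  (d : measure_display) (Om : measurableType d) (P : probability Om R)
  (W : R -> {RV P >-> R}) (Fs : set (set Om))
  (l T : R) (U : set R) (x0 : R -> R) (c : coefficients R)
  (u X Y Z v : R -> {RV P >-> R})
  (E : R -> set R) (X1 : R -> R -> {RV P >-> R})
  (d' : measure_display) (Omb : measurableType d') (Pb : probability Omb R)
  (copy : {mfun Omb >-> Om})
  (Psi1 : Om -> Omb -> R -> R) (Psi2 : Omb -> R -> R) :
  let F := filtration Fs W in
  stochastic_basis Fs W ->
  0 < l -> l < T -> T <= 2 * l ->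
  {within `[- l, 0], continuous x0} ->
  coef_measurable T U c -> growth_lipschitz P T U c -> regular P T U c ->
  optimal F W T l x0 c U u X Y Z ->
  admissible F T U v ->
  (forall eps, 0 < eps <= T ->
    [/\ measurable (E eps), E eps `<=` `[0, T] &
        lebesgue_measure (E eps) = eps%:E]) ->
  (forall eps, 0 < eps <= T ->
    first_variation F W T l c X u v (E eps) (X1 eps)) ->
  is_copy P Pb copy ->
  measurable_fun ([set: Om * Omb] `*` `[- l, T])
    (fun p : (Om * Omb) * R => Psi1 p.1.1 p.1.2 p.2) ->
  measurable_fun ([set: Omb] `*` `[- l, T])
    (fun p : Omb * R => Psi2 p.1 p.2) ->
  (exists2 C : R, 0 < C & forall t, t \in `[- l, T] ->
    {ae (P \x Pb)%E, forall p : Om * Omb, `|Psi1 p.1 p.2 t| <= C}) ->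
  (forall beta : R, 1 <= beta -> exists C : R,
    (\int[Pb]_wb ereal_sup [set (`|Psi2 wb t| `^ (2 * beta))%:E
                           | t in `[(- l)%R, T]] <= C%:E)%E) ->
  exists rho : R -> R,
  [/\ forall eps, 0 < eps -> 0 < rho eps,
      rho eps @[eps --> 0^'+] --> 0 &
      forall eps, 0 < eps <= T ->
      (\int[P]_w \int[lebesgue_measure]_(t in `[(- l)%R, T])
         (`| \int[Pb]_wb (Psi1 w wb t * Psi2 wb t * X1 eps t (copy wb))%:E |
            ^+ 4)
       <= (eps ^+ 2 * rho eps)%:E)%E].
Proof.
move=> F basis l0 lT T2l cx0 cm gl reg opt adv HE HX copyP m1 m2 [B B0 HB] mom.
have T0 : 0 < T by exact: lt_trans lT.
have [adu [[past SX _] _] _] := opt.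
have [C [_ regC]] := reg; have [C' [_ _ _ lipC]] := gl.
have [K1 K10 bb] := linear_boundsP l0 T0 SX adu adv
  (fun t v tI Uv => let: And3 h _ _ := regC t v tI Uv in h)
  (fun t tI => let: And3 h _ _ := lipC t tI in h).
have [K2 K20 bs] := linear_boundsP l0 T0 SX adu adv
  (fun t v tI Uv => let: And3 _ h _ := regC t v tI Uv in h)
  (fun t tI => let: And3 _ h _ := lipC t tI in h).
(* A common constant for drift and diffusion, made strictly positive because [halving_rate] and the
   Young parameter must be. *)
pose K := K1 + K2 + 1; have K0 : 0 < K by rewrite ltr_wpDl// addr_ge0.
have {}bb : linear_bounds T l X u v K (b c) (db c).
  by apply: linear_bounds_le bb; rewrite /K; lra.
have {}bs : linear_bounds T l X u v K (sigma c) (dsigma c).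
  by apply: linear_bounds_le bs; rewrite /K; lra.
have [D D0 HD] := moment_L2 m1 m2 (mom 1 (lexx 1)).
pose cost eps := (\int[P]_w \int[lebesgue_measure]_(t in `[(- l)%R, T])
  (`|copy_mean Pb copy Psi1 Psi2 (X1 eps) w t| ^+ 4))%E.
have b1 t : - l <= t <= T -> {ae (P \x Pb)%E, forall p : Om * Omb, `|Psi1 p.1 p.2 t| <= B}.
  by move=> tI; apply: HB; rewrite in_itv.
(* Dominated convergence works along sequences, so the limit is first proved along an arbitrary
   sequence in []0, T]] tending to 0. *)
have seq (eps : nat -> R) : (forall n, 0 < eps n <= T) -> eps @ \oo --> 0 ->
    (forall n, (cost (eps n) < +oo)%E) /\
    forall e : R, 0 < e -> \forall n \near \oo, (cost (eps n) <= (e * eps n ^+ 2)%:E)%E.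
  move=> eT ec; have ep n : 0 < eps n by case/andP: (eT n).
  have fv n : first_variation F W T l c X u v (E (eps n)) (X1 (eps n)) by exact: HX.
  have mE n : measurable (E (eps n)) by have [] := HE _ (eT n).
  have lE n : lebesgue_measure (E (eps n)) = (eps n)%:E by have [] := HE _ (eT n).
  have cX n w : {within `[- l, T], continuous (fun t => X1 (eps n) t w)}.
    by have [_ [_ h _] _] := fv n; exact: h.
  have [A A0 HA] := variation_rate basis l0 T0 K0 bb bs fv mE lE ep.
  have sX n t : - l <= t <= T -> sqi P (X1 (eps n) t) /\
      nrm P (X1 (eps n) t) <= A * Num.sqrt (eps n).
    move=> tI; split; last exact: HA.
    by have [A' _ /(_ _ tI)[]] := variation_sqi (fv n).
  have weak eta t (e : R) : sqi P eta -> - l <= t <= T -> 0 < e ->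
      \forall n \near \oo, `|ip P eta (X1 (eps n) t)| <= e * Num.sqrt (eps n).
    exact: (variation_weakly_small basis l0 T0 K0 bb bs fv mE lE ep ec).
  split => [n|e e0].
    apply: le_lt_trans (ltry _).
    exact: (spike_cost_bound l0 T0 m1 m2 copyP (ltW B0) A0 ep b1 HD cX sX n).
  exact: (spike_cost_limit l0 T0 m1 m2 copyP (ltW B0) A0 ep b1 HD cX sX weak e0).
have cost0 eps : (0 <= cost eps)%E.
  by apply: integral_ge0 => w _; apply: integral_ge0 => t _; rewrite expe_ge0.
have cost_fin eps : 0 < eps <= T -> cost eps \is a fin_num.
  move=> /andP[e0 eT]; rewrite ge0_fin_numE//.
  (* A sequence whose term of index 0 is the given [eps]: finiteness along sequences becomes
     finiteness at [eps]. *)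
  have [] := seq (fun n => eps / n.+1%:R).
  - by move=> n; rewrite divr_gt0//= ler_pdivrMr// (le_trans eT)// ler_peMr ?ler1n ?(ltW T0).
  - rewrite -(mulr0 eps); apply: cvgM; first exact: cvg_cst.
    exact: cvg_harmonic.
  by move=> /(_ 0%N); rewrite divr1.
(* Adding [eps] keeps [rho] positive where the cost vanishes; beyond [T] only positivity is
   required. *)
exists (fun eps => if 0 < eps <= T then fine (cost eps) / eps ^+ 2 + eps else eps); split.
- move=> eps e0; case: ifP => // _.
  by rewrite ltr_wpDl// divr_ge0 ?fine_ge0// sqr_ge0.
- apply/cvg_at_rightP => z [z0 zc].
  (* A sequence tending to 0 from the right may exceed [T] at first; the cap changes finitely many
     terms. *)
  pose eps n := Num.min (z n) T.
  have eT n : 0 < eps n <= T by rewrite lt_min z0 T0 ge_min lexx orbT.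
  have ec : eps @ \oo --> 0.
    apply/cvgrPdist_le => e e0; move/cvgrPdist_le : zc => /(_ e e0).
    apply: filterS => n; rewrite !sub0r !normrN; apply: le_trans.
    have /andP[h _] := eT n; rewrite !gtr0_norm// ge_min lexx//.
  have [_ H] := seq eps eT ec.
  apply/cvgrPdist_le => /= e e0; have e2 : 0 < e / 2 by rewrite divr_gt0.
  near=> n.
  have zn : z n <= T.
    have : `|0 - z n| <= T by near: n; move/cvgrPdist_le: zc; apply.
    by rewrite sub0r normrN ger0_norm// ltW.
  have ze : z n <= e / 2.
    have : `|0 - z n| <= e / 2 by near: n; move/cvgrPdist_le: zc; apply.
    by rewrite sub0r normrN ger0_norm// ltW.
  have : (cost (eps n) <= (e / 2 * eps n ^+ 2)%:E)%E by near: n; exact: H.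
  rewrite /eps min_l// z0 zn/= sub0r normrN => h.
  have zT : 0 < z n <= T by rewrite z0.
  rewrite ger0_norm; last by rewrite addr_ge0 ?(ltW (z0 n))// divr_ge0 ?fine_ge0// sqr_ge0.
  rewrite (splitr e); apply: lerD => //.
  by rewrite ler_pdivrMr ?exprn_gt0// -lee_fin fineK// cost_fin.
move=> eps eT; rewrite eT -[leLHS]/(cost eps) -(fineK (cost_fin _ eT)) lee_fin.
have e0 : 0 < eps by case/andP: eT.
rewrite mulrDr mulrC divfK ?gt_eqF ?exprn_gt0// lerDl.
by rewrite mulr_ge0 ?sqr_ge0// ltW.
Unshelve. all: by end_near. Qed.
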